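(* Let $\theta\in[0,1]$, let $H,\bar H:\mathbb R^{2d}\to\mathbb R$, $f=-\frac{\partial H}{\partial Q}$, $g=\frac{\partial H}{\partial P}$, $a=-\frac{\partial\bar H}{\partial Q}$, $b=\frac{\partial\bar H}{\partial P}$, and let $(P,Q)$ solve on $[0,T]$ $$dP_t=f(P_t,Q_t)\,dt+a(P_t,Q_t)\circ dW_t,\qquad dQ_t=g(P_t,Q_t)\,dt+b(P_t,Q_t)\circ dW_t$$ with deterministic initial value $(P_0,Q_0)\in\mathbb R^{2d}$. Assume: (i) $f,g,a,b,\frac{\partial a}{\partial P}a,\frac{\partial a}{\partial Q}b,\frac{\partial b}{\partial P}a,\frac{\partial b}{\partial Q}b$ are globally Lipschitz continuous; (ii) $f,g\in C^3(\mathbb R^{2d};\mathbb R^d)$, $a,b\in C^4(\mathbb R^{2d};\mathbb R^d)$, and $D^kf,D^kg$ ($k=2,3$), $D^ka,D^kb$ ($k=2,3,4$) grow at most polynomially. Let $B$ be a Brownian motion independent of $W$ and let $U=(U_P,U_Q)$ be the solution, with $U(0)=0$, of the It\^o equations $$\begin{aligned} dU_P=&\Big[\tfrac{\partial}{\partial P}\big(f+\tfrac12\tfrac{\partial a}{\partial P}a+\tfrac12\tfrac{\partial a}{\partial Q}b\big)U_P+\tfrac{\partial}{\partial Q}\big(f+\tfrac12\tfrac{\partial a}{\partial P}a+\tfrac12\tfrac{\partial a}{\partial Q}b\big)U_Q\Big]dt\\ &+\Big[\tfrac{\partial a}{\partial P}U_P+\tfrac{\partial a}{\partial Q}U_Q\Big]dW_t+\tfrac{2\theta-1}{\sqrt2}\Big(\tfrac{\partial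 a}{\partial P}a-\tfrac{\partial a}{\partial Q}b\Big)dB_t,\\ dU_Q=&\Big[\tfrac{\partial}{\partial P}\big(g+\tfrac12\tfrac{\partial b}{\partial P}a+\tfrac12\tfrac{\partial b}{\partial Q}b\big)U_P+\tfrac{\partial}{\partial Q}\big(g+\tfrac12\tfrac{\partial b}{\partial P}a+\tfrac12\tfrac{\partial b}{\partial Q}b\big)U_Q\Big]dt\\ &+\Big[\tfrac{\partial b}{\partial P}U_P+\tfrac{\partial b}{\partial Q}U_Q\Big]dW_t+\tfrac{2\theta-1}{\sqrt2}\Big(\tfrac{\partial b}{\partial P}a-\tfrac{\partial b}{\partial Q}b\Big)dB_t, \end{aligned}$$ all coefficient functions being evaluated at $(P_t,Q_t)$. Then $U$ has a Hamiltonian formulation: it satisfies $$d\begin{pmatrix} U_P \\ U_Q \end{pmatrix}=\begin{pmatrix}-\frac{\partial H_0}{\partial U_Q}\\ \frac{\partial H_0}{\partial U_P}\end{pmatrix}dt+\begin{pmatrix}-\frac{\partial H_1}{\partial U_Q}\\ \frac{\partial H_1}{\partial U_P}\end{pmatrix}\circ dW_t+\begin{pmatrix}-\frac{\partial H_2}{\partial U_Q}\\ \frac{\partial H_2}{\partial U_P}\end{pmatrix}\circ dB_t,$$ where $$\begin{aligned} H_0&=\tfrac12U_P^{\top}\tfrac{\partial g}{\partial P}(P,Q)U_P-U_Q^{\top}\tfrac{\partial f}{\partial P}(P,Q)U_P-\tfrac12U_Q^{\top}\tfrac{\partial f}{\partial Q}(P,Q)U_Q,\\ H_1&=\tfrac12U_P^{\top}\tfrac{\partial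 b}{\partial P}(P,Q)U_P-U_Q^{\top}\tfrac{\partial a}{\partial P}(P,Q)U_P-\tfrac12U_Q^{\top}\tfrac{\partial a}{\partial Q}(P,Q)U_Q,\\ H_2&=\tfrac{2\theta-1}{\sqrt2}U_P^{\top}\Big(\tfrac{\partial b}{\partial P}a-\tfrac{\partial b}{\partial Q}b\Big)(P,Q)-\tfrac{2\theta-1}{\sqrt2}U_Q^{\top}\Big(\tfrac{\partial a}{\partial P}a-\tfrac{\partial a}{\partial Q}b\Big)(P,Q). \end{aligned}$$
   Context: $W$ is a one-dimensional Brownian motion on a complete filtered probability space; $B$ lives on an extension of that space. $\circ\,dW$, $\circ\,dB$ denote Stratonovich integrals. Points of $\mathbb R^{2d}$ are written $(P,Q)$, $P,Q\in\mathbb R^d$; for $\phi:\mathbb R^{2d}\to\mathbb R^d$, $\frac{\partial\phi}{\partial P},\frac{\partial\phi}{\partial Q}$ are $d\times d$ Jacobians, $(\frac{\partial\phi}{\partial P})_{ij}=\partial\phi_i/\partial P_j$. The functions $H_0,H_1,H_2$ are regarded as functions of $(U_P,U_Q)$ with $(P,Q)=(P_t,Q_t)$ as time-dependent random parameters; $\frac{\partial H_i}{\partial U_P},\frac{\partial H_i}{\partial U_Q}$ are gradients in those variables. *)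

(* Defs.v *)
From HB Require Import structures.
From mathcomp Require Export all_boot all_order all_algebra.
From mathcomp Require Export all_classical all_reals all_analysis.
Set Implicit Arguments.
Unset Strict Implicit.
Unset Printing Implicit Defensive.
Export Order.TTheory GRing.Theory Num.Theory.
Export numFieldNormedType.Exports.
Open Scope classical_set_scope.
Open Scope ring_scope.

Notation phase R d := ('cV[R]_d * 'cV[R]_d)%type.

Section PhaseSpace.
Context {R : realType} {d : nat}.

Definition eP (j : 'I_d) : phase R d := (delta_mx j ord0, 0).
Definition eQ (j : 'I_d) : phase R d := (0, delta_mx j ord0).
Definition ebasis (i : 'I_d + 'I_d) : phase R d :=
  match i with inl j => eP j | inr j => eQ j end.

Definition gradP (h : phase R d -> R) (x : phase R d) : 'cV[R]_d :=
  \col_j 'D_(eP j) h x.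
Definition gradQ (h : phase R d -> R) (x : phase R d) : 'cV[R]_d :=
  \col_j 'D_(eQ j) h x.

Definition jacP (phi : phase R d -> 'cV[R]_d) (x : phase R d) : 'M[R]_d :=
  \matrix_(i, j) 'D_(eP j) (fun y => phi y i ord0) x.
Definition jacQ (phi : phase R d -> 'cV[R]_d) (x : phase R d) : 'M[R]_d :=
  \matrix_(i, j) 'D_(eQ j) (fun y => phi y i ord0) x.

Fixpoint Ck (k : nat) (phi : phase R d -> 'cV[R]_d) : Prop :=
  continuous phi /\
  if k is k'.+1 then
    forall i, (forall x : phase R d, derivable phi x (ebasis i)) /\ Ck k' ('D_(ebasis i) phi)
  else True.

(* All the partial derivatives of order k of phi, i.e. the entries of D^k phi,
   grow at most polynomially. *)
Fixpoint Dk_poly_growth (k : nat) (phi : phase R d -> 'cV[R]_d) : Prop :=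
  if k is k'.+1 then forall i, Dk_poly_growth k' ('D_(ebasis i) phi)
  else exists (c : R) (m : nat), forall x, `|phi x| <= c * (1 + `|x| ^+ m).

(* The Hamiltonian that is quadratic in u = (U_P, U_Q), with parameter
   x = (P, Q): H_0 is obtained from (f, g) and H_1 from (a, b). *)
Definition quadratic_hamiltonian (f g : phase R d -> 'cV[R]_d)
    (x u : phase R d) : R :=
  2^-1 * (u.1^T *m jacP g x *m u.1) ord0 ord0
  - (u.2^T *m jacP f x *m u.1) ord0 ord0
  - 2^-1 * (u.2^T *m jacQ f x *m u.2) ord0 ord0.

(* H_2, linear in u = (U_P, U_Q). *)
Definition linear_hamiltonian (theta : R) (a b : phase R d -> 'cV[R]_d)
    (x u : phase R d) : R :=
  (2 * theta - 1) / Num.sqrt 2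
    * (u.1^T *m (jacP b x *m a x - jacQ b x *m b x)) ord0 ord0
  - (2 * theta - 1) / Num.sqrt 2
    * (u.2^T *m (jacP a x *m a x - jacQ a x *m b x)) ord0 ord0.

End PhaseSpace.

(* The knots of the partition 0 < s_1 < ... < s_n = T given by
   s = [:: s_1; ...; s_n] (see itv_partition), with knot s 0 = 0. *)
Definition knot {R : realType} (s : seq R) (k : nat) : R := nth 0 (0 :: s) k.

Definition mesh {R : realType} (s : seq R) : R :=
  \big[Num.max/0]_(k < size s) (knot s k.+1 - knot s k).

Section Processes.
Context {R : realType} {disp : measure_display} {Omega : measurableType disp}.
Variable P : probability Omega R.

Definition process := R -> Omega -> R.
Definition vprocess (d : nat) := R -> Omega -> 'cV[R]_d.

Definition incr (X : process) (s t : R) : Omega -> R := fun w => X t w - X s w.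

Definition sigma_measurable (G : set (set Omega)) (X : Omega -> R) : Prop :=
  forall Y : set R, measurable Y -> G (X @^-1` Y).

Definition complete_filtration (T : R) (F : R -> set (set Omega)) : Prop :=
  [/\ measure_is_complete P,
      forall t : R, 0 <= t <= T -> sigma_algebra setT (F t),
      forall t : R, 0 <= t <= T -> F t `<=` measurable,
      forall s t : R, 0 <= s -> s <= t -> t <= T -> F s `<=` F t &
      forall N : set Omega, P.-negligible N -> F 0 N].

Variables (F : R -> set (set Omega)) (T : R).

Definition adapted (X : process) : Prop :=
  forall t : R, 0 <= t <= T -> sigma_measurable (F t) (X t).

Definition ae_continuous (X : process) : Prop :=
  {ae P, forall w, {within `[0, T], continuous (X ^~ w)}}.

(* The second parameter of normal_prob is the standard deviation. *)
Definition brownian (W : process) : Prop :=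
  [/\ adapted W, ae_continuous W, {ae P, forall w, W 0 w = 0} &
      forall s t : R, 0 <= s -> s < t -> t <= T ->
        (forall Y : set R, measurable Y ->
           P (incr W s t @^-1` Y) = normal_prob 0 (Num.sqrt (t - s)) Y) /\
        (forall (A : set Omega) (Y : set R), F s A -> measurable Y ->
           P (A `&` incr W s t @^-1` Y) = (P A * P (incr W s t @^-1` Y))%E)].

Definition sigma_of (X : process) : set (set Omega) :=
  <<s [set A | exists (t : R) (Y : set R),
         [/\ 0 <= t <= T, measurable Y & A = X t @^-1` Y] ] >>.

Definition independent_processes (X Z : process) : Prop :=
  forall A B, sigma_of X A -> sigma_of Z B -> P (A `&` B) = (P A * P B)%E.

(* Convergence to 0 in probability of nonnegative variables. The events
   {eps <= Y n} are only required to be covered by measurable ones of vanishing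
   probability, since P is unspecified on nonmeasurable sets; for measurable
   Y n this is the usual notion. *)
Definition cvg_in_prob0 (Y : nat -> Omega -> \bar R) : Prop :=
  forall eps : R, 0 < eps -> exists A : nat -> set Omega,
    [/\ forall n, measurable (A n),
        forall n, [set w | (eps%:E <= Y n w)%E] `<=` A n &
        P (A n) @[n --> \oo] --> 0%E].

(* sum_k xi_k 1_{(s_k, s_{k+1}]}, with xi_k bounded and F_{s_k}-measurable. *)
Record simple_process := SimpleProcess {
  sp_part : seq R ;
  sp_val : nat -> Omega -> R ;
  sp_partP : itv_partition 0 T sp_part ;
  sp_meas : forall k, (k < size sp_part)%N ->
    sigma_measurable (F (knot sp_part k)) (sp_val k) ;
  sp_bounded : forall k, exists c : R, forall w, `|sp_val k w| <= c }.

Definition sp_eval (Phi : simple_process) : process := fun t w =>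
  let s := sp_part Phi in
  \sum_(k < size s) sp_val Phi k w *+ (knot s k < t <= knot s k.+1)%R.

Definition sp_integral (M : process) (Phi : simple_process) : process :=
  fun t w => let s := sp_part Phi in
  \sum_(k < size s) sp_val Phi k w *
     incr M (Num.min (knot s k) t) (Num.min (knot s k.+1) t) w.

(* I is the Ito integral of X with respect to the Brownian motion M: the
   continuous adapted process which is the limit in probability of the integrals
   of simple processes converging to X in L^2([0, T]) in probability. The last
   requirement makes int_0^T X^2 dt finite almost surely. *)
Definition ito_integral (M X I : process) : Prop :=
  [/\ adapted X, {ae P, forall w, measurable_fun `[0, T] (X ^~ w)},
      adapted I, ae_continuous I &
      exists Phi : nat -> simple_process,
        cvg_in_prob0 (fun n w => (\int[lebesgue_measure]_(t in `[0%R, T])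
                                   ((sp_eval (Phi n) t w - X t w) ^+ 2)%R%:E)%E)
        /\ forall t : R, 0 <= t <= T ->
           cvg_in_prob0 (fun n w => `|sp_integral M (Phi n) t w - I t w|%:E)].

(* C is the quadratic covariation [X, Z]: the limit in probability of the sums
   of products of increments along partitions with vanishing mesh, having (as
   the bracket of continuous semimartingales does) continuous paths of bounded
   variation. *)
Definition covariation (X Z C : process) : Prop :=
  {ae P, forall w, {within `[0, T], continuous (C ^~ w)} /\
                   bounded_variation 0 T (C ^~ w)} /\
  forall pi : nat -> seq R, (forall n, itv_partition 0 T (pi n)) ->
    mesh (pi n) @[n --> \oo] --> 0 ->
    forall t : R, 0 <= t <= T ->
    cvg_in_prob0 (fun n w =>
      `| \sum_(k < size (pi n))
           incr X (Num.min (knot (pi n) k) t) (Num.min (knot (pi n) k.+1) t) w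
         * incr Z (Num.min (knot (pi n) k) t) (Num.min (knot (pi n) k.+1) t) w
         - C t w |%:E).

(* int X o dM = int X dM + [X, M] / 2; existence of [X, M] is all that is used
   of the semimartingale property of X. *)
Definition stratonovich_integral (M X S : process) : Prop :=
  exists I C : process, [/\ ito_integral M X I, covariation X M C &
    {ae P, forall w, forall t : R, 0 <= t <= T -> S t w = I t w + 2^-1 * C t w}].

Definition time_integral (X A : process) : Prop :=
  {ae P, forall w,
     (@lebesgue_measure R).-integrable `[0, T] (fun t : R => (X t w)%:E) /\
     forall t : R, 0 <= t <= T ->
       A t w = Rintegral (@lebesgue_measure R) `[0, t] (X ^~ w)}.

Definition coord (d : nat) (X : vprocess d) (i : 'I_d) : process :=
  fun t w => X t w i ord0.

(* The continuous adapted process Z starts from z0 and satisfies on [0, T]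
     dZ = alpha dt + sum_k beta_k dM_k,
   where stoch = [:: (M_0, beta_0); ...] and the k-th stochastic integral is
   understood in the sense of J (ito_integral or stratonovich_integral). *)
Definition satisfies_sde (J : process -> process -> process -> Prop) (d : nat)
    (z0 : 'cV[R]_d) (Z alpha : vprocess d) (stoch : seq (process * vprocess d))
    : Prop :=
  (forall i, adapted (coord Z i) /\ ae_continuous (coord Z i)) /\
  exists (A : vprocess d) (S : 'I_(size stoch) -> vprocess d),
    [/\ forall i, time_integral (coord alpha i) (coord A i),
        forall k i, let: (M, beta) := tnth (in_tuple stoch) k in
          J M (coord beta i) (coord (S k) i) &
        {ae P, forall w, forall t : R, 0 <= t <= T ->
           Z t w = z0 + A t w + \sum_k S k t w}].

Definition ito_sde := satisfies_sde ito_integral.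
Definition stratonovich_sde := satisfies_sde stratonovich_integral.

End Processes.

(* Main.v *)
(* Since f = -H_Q and g = H_P, the Jacobian of (f, g) is Hamiltonian (f_Q and g_P
   are symmetric and g_Q = -f_P^T), so that the gradients of H_0, H_1 and H_2 in
   (U_P, U_Q) are f_P U_P + f_Q U_Q and its analogues for (a, b), that is, the
   integrands of the Ito equations. It remains to see that [psi(X), B] = 0 for
   the noise coefficient psi, and that [G, W] = int rho dt for the dW-integrand
   G_i = sum_l D_l sigma_i(X) U_l with sigma = (a, b), where
     rho_i = sum_l (sum_m D_m D_l sigma_i sigma_m) U_l
             + sum_l D_l sigma_i sum_m D_m sigma_l U_m
   is twice the difference of the Ito and Stratonovich drifts.
   No semimartingale theory is needed: along a sequence of grids a path f is
   called controlled by (w, b) if the sum of the squares of df - w dW - b dB tends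
   to 0. Such paths are stable under products and composition with C^1 maps, and
   sum df dW tends to int w dt as soon as, on blocks of intervals, the sums of
   dW^2 - dt, dB^2 - dt and dB dW tend to 0. These sums, and the errors
   sum (dI - w dW)^2 for an Ito integral I of a continuous w, tend to 0 in
   probability with the mesh; hence, along fast subsequences, almost surely. *)

From HB Require Import structures.
Require Import Defs.
From mathcomp Require Import all_boot all_order all_algebra.
From mathcomp Require Import all_classical all_reals all_analysis.
From mathcomp Require Import measurable_realfun ring lra.
Import Order.TTheory GRing.Theory Num.Theory.
Import numFieldNormedType.Exports.
Set Implicit Arguments. Unset Strict Implicit. Unset Printing Implicit Defensive.
Local Open Scope classical_set_scope.
Local Open Scope ring_scope.

(** * Moments of the normal law *)

(** [covariation] quantifies over every sequence of partitions, whereas almost sure convergence is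
    available along fast ones only. Each error is therefore shown small in probability uniformly
    over the partitions of small mesh ([mesh_cvg0]); a countable family of such errors vanishes
    almost surely at once along fast sequences, and sequences given in advance are reached by
    contradiction. The blocks of length 1/M serve to insert a random continuous weight of which no
    moment is known: it is nearly constant on a short block, so countably many unweighted sums
    control all weighted ones. The drift, and the unknown bracket hidden in each Stratonovich
    integral of (P, Q), have paths of bounded variation and so join the terms negligible in the
    square mean. The error of an Ito integral comes without moments too, the simple processes
    converging in probability only: its energy is cut off before the isometry is applied, on a
    common refinement of two partitions. *)

Section NormalMoments.
Context {R : realType}.
Local Notation mu := (@lebesgue_measure R).

(** The Radon-Nikodym derivative of the normal law and its density have the same integral over every
    measurable set, hence agree almost everywhere. *)
Lemma integral_normal_prob (s : R) (f : R -> R) :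
  measurable_fun setT f -> (forall x, 0 <= f x) ->
  (\int[normal_prob 0 s]_x (f x)%:E = \int[mu]_x (f x * normal_pdf 0 s x)%:E)%E.
Proof.
move=> mf f0; have dom := normal_prob_dominates 0 s.
have f0' (x : R) : (0 <= (f x)%:E)%E by rewrite lee_fin.
have mf' : measurable_fun setT (fun x : R => (f x)%:E) by exact/measurable_EFinP.
rewrite -(Radon_Nikodym_SigmaFinite.change_of_variables dom f0')//.
under [in RHS]eq_integral do rewrite EFinM.
apply: ae_eq_integral => //.
- apply: emeasurable_funM => //; apply: (measurable_int mu).
  exact: Radon_Nikodym_SigmaFinite.f_integrable.
- by apply: emeasurable_funM => //; apply/measurable_EFinP; exact: measurable_normal_pdf.
- apply: ae_eqe_mul2l => /=.
  apply: integral_ae_eq => //=.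
  + exact: Radon_Nikodym_SigmaFinite.f_integrable.
  + by apply/measurable_EFinP; exact: measurable_normal_pdf.
  + by move=> E _ mE; rewrite -Radon_Nikodym_SigmaFinite.f_integral.
Qed.

Let c : R := Num.sqrt (pi *+ 2).

Let peakE (r : R) : 0 < r -> normal_peak r = (c * r)^-1.
Proof.
move=> r0; rewrite /normal_peak -mulrnAr sqrtrM ?sqr_ge0// sqrtr_sqr ger0_norm ?ltW//.
by rewrite mulrC.
Qed.

Let c0 : 0 < c. Proof. by rewrite sqrtr_gt0 pmulrn_lgt0// pi_gt0. Qed.

Lemma integral_normal_fun0 (r : R) : 0 < r ->
  (\int[mu]_x (normal_fun 0 r x)%:E = (c * r)%:E)%E.
Proof.
move=> r0; have r00 : r != 0 by rewrite gt_eqF.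
have := integral_normal_pdf 0 r; rewrite normal_pdfE//.
under eq_integral do rewrite EFinM.
rewrite ge0_integralZl//; last 3 first.
- by apply/measurable_EFinP; exact: measurable_normal_fun.
- by move=> x _; rewrite lee_fin normal_fun_ge0.
- by rewrite lee_fin normal_peak_ge0.
rewrite peakE//; set I := (\int[mu]_x _)%E => h.
have cr0 : c * r != 0 by rewrite mulf_neq0// gt_eqF.
by rewrite -[RHS]mule1 -h muleA -EFinM mulfV// mul1e.
Qed.

Let M (r : R) := (\int[mu]_x (x ^+ 2 * normal_fun 0 r x)%:E)%E.

Let m2 (r : R) : measurable_fun setT (fun x : R => (x ^+ 2 * normal_fun 0 r x)).
Proof. by apply: measurable_funM; [exact: measurable_funX|exact: measurable_normal_fun]. Qed.

(** Convexity of the exponential: the bounds are 1 + x <= exp x at x = z - y and at x = y - z,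
    multiplied by exp(-z) and exp(-y). *)
Let expR_slope (y z : R) : y <= z ->
  (z - y) * expR (- z) <= expR (- y) - expR (- z) <= (z - y) * expR (- y).
Proof.
move=> yz; apply/andP; split.
  rewrite -[X in _ <= X - _](_ : expR (- z) * expR (z - y) = _); last first.
    by rewrite -expRD addrA addNr add0r.
  rewrite -[X in _ <= _ - X]mulr1 -mulrBr mulrC ler_wpM2l ?expR_ge0//.
  by rewrite lerBrDl expR_ge1Dx.
rewrite -[X in _ - X <= _](_ : expR (- y) * expR (y - z) = _); last first.
  by rewrite -expRD addrA addNr add0r.
rewrite -[X in X - _ <= _]mulr1 -mulrBr mulrC ler_wpM2r ?expR_ge0//.
by rewrite lerBlDr -lerBlDl (le_trans _ (expR_ge1Dx _))// opprB addrC.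
Qed.

(** x^2 [w r s] is the exponent of the Gaussian of deviation s minus that of the Gaussian of
    deviation r. *)
Let w (r s : R) := (r^-1 ^+ 2 - s^-1 ^+ 2) / 2.

(* Comparing the Gaussians of deviations r < s pointwise and integrating bounds
   their second moments by the difference of their masses; then s tends to r. *)
Let sandwich (r s : R) : 0 < r -> r < s ->
  ((w r s)%:E * M r <= (c * (s - r))%:E /\ (c * (s - r))%:E <= (w r s)%:E * M s)%E.
Proof.
move=> r0 rs; have s0 : 0 < s by exact: lt_trans rs.
have w0 : 0 <= w r s.
  rewrite divr_ge0// subr_ge0 lerXn2r// ?nnegrE ?invr_ge0 ?(ltW r0) ?(ltW s0)//.
  by rewrite lef_pV2 ?posrE// ltW.
have E (t x : R) : normal_fun 0 t x = expR (- (x ^+ 2 * (t^-1 ^+ 2 / 2))).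
  rewrite /normal_fun subr0 -mulr_natr invfM exprVn; congr expR.
  by rewrite mulNr mulrA.
have key (x : R) : w r s * (x ^+ 2 * normal_fun 0 r x) <= normal_fun 0 s x - normal_fun 0 r x <=
   w r s * (x ^+ 2 * normal_fun 0 s x).
  have xz : x ^+ 2 * (s^-1 ^+ 2 / 2) <= x ^+ 2 * (r^-1 ^+ 2 / 2).
    rewrite ler_wpM2l ?sqr_ge0// -subr_ge0 -mulrBl -/(w r s)//.
  have := expR_slope xz; rewrite -!E -mulrBr -mulrBl -/(w r s).
  by rewrite ![x^+2 * w r s]mulrC !mulrA.
have mE (t : R) : measurable_fun setT (fun x => (normal_fun 0 t x)%:E).
  by apply/measurable_EFinP; exact: measurable_normal_fun.
have mM (t : R) : measurable_fun setT (fun x : R => (x ^+ 2 * normal_fun 0 t x)%:E).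
  by apply/measurable_EFinP; exact: m2.
have M0 (t x : R) : (0 <= (x ^+ 2 * normal_fun 0 t x)%:E)%E.
  by rewrite lee_fin mulr_ge0 ?sqr_ge0 ?normal_fun_ge0.
have N0 (t x : R) : (0 <= (normal_fun 0 t x)%:E)%E by rewrite lee_fin normal_fun_ge0.
have wM (t : R) : ((w r s)%:E * M t = \int[mu]_x ((w r s)%:E * (x ^+ 2 * normal_fun 0 t x)%:E))%E.
  rewrite ge0_integralZl//; first exact: mM.
have mW (t : R) : measurable_fun setT (fun x : R => ((w r s)%:E * (x ^+ 2 * normal_fun 0 t x)%:E))%E.
  exact: measurable_funeM.
have W0 (t x : R) : (0 <= (w r s)%:E * (x ^+ 2 * normal_fun 0 t x)%:E)%E.
  by apply: mule_ge0; [rewrite lee_fin|exact: M0].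
have sE t : (\int[mu]_x ((w r s)%:E * (x ^+ 2 * normal_fun 0 t x)%:E + (normal_fun 0 r x)%:E) =
   \int[mu]_x ((w r s)%:E * (x ^+ 2 * normal_fun 0 t x)%:E) + \int[mu]_x (normal_fun 0 r x)%:E)%E.
  rewrite ge0_integralD//; do 1?[exact: mW|exact: mE|move=> x _; exact: W0|move=> x _; exact: N0].
have cE : (c * (s - r))%:E = ((c * s)%:E - (c * r)%:E)%E by rewrite mulrBr.
split.
- rewrite cE leeBrDr// wM -(integral_normal_fun0 r0) -(integral_normal_fun0 s0).
  rewrite -sE; apply: ge0_le_integral => //.
  + by move=> x _; rewrite adde_ge0.
  + by apply: emeasurable_funD; [exact: mW|exact: mE].
  + exact: mE.
  + move=> x _; rewrite -EFinM -EFinD lee_fin -lerBrDr.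
    by have /andP[] := key x.
- rewrite cE leeBlDr// wM -(integral_normal_fun0 r0) -(integral_normal_fun0 s0).
  rewrite -sE; apply: ge0_le_integral => //.
  + exact: mE.
  + by apply: emeasurable_funD; [exact: mW|exact: mE].
  + move=> x _; rewrite -EFinM -EFinD lee_fin -lerBlDr.
    by have /andP[] := key x.
Qed.

Let ME (r : R) : 0 < r -> M r = (c * r ^+ 3)%:E.
Proof.
move=> r0.
have wE s t : 0 < s -> 0 < t -> w s t = (t - s) * (s + t) / (2 * (s ^+ 2 * t ^+ 2)).
  by move=> s0 t0; rewrite /w; field; rewrite !gt_eqF.
have M0 : (0 <= M r)%E.
  by apply: integral_ge0 => x _; rewrite lee_fin mulr_ge0 ?sqr_ge0 ?normal_fun_ge0.
have Mfin : M r \is a fin_num.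
  rewrite ge0_fin_numE//.
  (* With s = 2r the weight [w] is positive, so an infinite moment would make the left-hand side of
     the sandwich infinite. *)
  have [+ _] := @sandwich r (r + r) r0 (ltr_pwDr r0 (lexx _)).
  have w0 : 0 < w r (r + r).
    by rewrite wE ?addr_gt0// addrK divr_gt0// !(mulr_gt0, exprn_gt0, addr_gt0)//.
  case: (M r) M0 => [x| |]//; first by rewrite ltry.
  by rewrite gt0_muley ?lte_fin// leye_eq.
rewrite -(fineK Mfin); congr EFin; set m := fine (M r).
(* The sandwich gives m <= 2 c r^2 s^2 / (r + s), and 2r <= r + s; the lower bound below is
   symmetric. *)
have up s : r < s -> m <= c * r * s ^+ 2.
  move=> rs; have s0 := lt_trans r0 rs.
  have [+ _] := sandwich r0 rs; rewrite -(fineK Mfin) -EFinM lee_fin -/m wE//.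
  rewrite -ler_pdivlMl; last by rewrite divr_gt0 ?mulr_gt0 ?exprn_gt0 ?subr_gt0// addr_gt0.
  move=> /le_trans; apply.
  rewrite [leLHS](_ : _ = c * s ^+ 2 * (2 * r ^+ 2) / (r + s)); last first.
    field; do ?[apply/andP; split]; rewrite ?gt_eqF ?mulr_gt0 ?subr_gt0 ?addr_gt0//.
  rewrite ler_pdivrMr ?addr_gt0//.
  rewrite -subr_ge0 (_ : _ - _ = c * s ^+ 2 * r * (s - r)); last by ring.
  by rewrite !mulr_ge0 ?sqr_ge0 ?subr_ge0 ?ltW.
have lo s : 0 < s -> s < r -> c * r * s ^+ 2 <= m.
  move=> s0 sr.
  have [_ +] := sandwich s0 sr; rewrite -(fineK Mfin) -EFinM lee_fin -/m wE//.
  rewrite -ler_pdivrMl; last by rewrite divr_gt0 ?mulr_gt0 ?exprn_gt0 ?subr_gt0// addr_gt0.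
  apply: le_trans.
  rewrite [leRHS](_ : _ = c * s ^+ 2 * (2 * r ^+ 2) / (s + r)); last first.
    field; do ?[apply/andP; split]; rewrite ?gt_eqF ?mulr_gt0 ?subr_gt0 ?addr_gt0//.
  rewrite ler_pdivlMr ?addr_gt0//.
  rewrite -subr_ge0 (_ : _ - _ = c * s ^+ 2 * r * (r - s)); last by ring.
  by rewrite !mulr_ge0 ?sqr_ge0 ?subr_ge0 ?ltW.
have cr0 : 0 < c * r by rewrite mulr_gt0.
(* The limit s -> r is an order argument: q <= s^2 for all s > r and s^2 <= q for all s in (0, r).
   If sqrt q differed from r, the midpoint of the two would violate one of these. *)
pose q := m / (c * r); have mE : m = c * r * q by rewrite mulrC divfK// gt_eqF.
have q0 : 0 <= q by rewrite divr_ge0 ?(ltW cr0)// fine_ge0.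
have upq s : r < s -> q <= s ^+ 2 by move=> /up; rewrite mE ler_pM2l.
have loq s : 0 < s -> s < r -> s ^+ 2 <= q by move=> ? /lo; rewrite mE ler_pM2l//; apply.
rewrite mE exprS mulrA; congr (_ * _).
pose t := Num.sqrt q; have qE : q = t ^+ 2 by rewrite sqr_sqrtr.
have t0 : 0 <= t by rewrite sqrtr_ge0.
rewrite qE; congr (_ ^+ 2); apply/eqP; rewrite eq_le; apply/andP; split.
- rewrite leNgt; apply/negP => rt; have := @upq ((r + t) / 2).
  by rewrite midf_lt// => /(_ isT); rewrite qE leNgt ltr_pXn2r// ?nnegrE ?midf_lt//
    ?divr_ge0 ?addr_ge0 ?(ltW r0).
- rewrite leNgt; apply/negP => tr; have := @loq ((t + r) / 2).
  rewrite midf_lt// divr_gt0 ?ltr_wpDl// => /(_ isT isT).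
  by rewrite qE leNgt ltr_pXn2r// ?nnegrE ?midf_lt// divr_ge0 ?addr_ge0 ?(ltW r0).
Qed.

Lemma normal_prob_moment2 (s : R) : 0 < s ->
  (\int[normal_prob 0 s]_x (x ^+ 2)%:E = (s ^+ 2)%:E)%E.
Proof.
move=> s0; rewrite integral_normal_prob//; last by move=> x; rewrite exprn_even_ge0.
rewrite normal_pdfE ?gt_eqF//.
under eq_integral do rewrite mulrCA EFinM.
rewrite ge0_integralZl//; last 3 first.
- by apply/measurable_EFinP; exact: m2.
- by move=> x _; rewrite lee_fin mulr_ge0 ?sqr_ge0 ?normal_fun_ge0.
- by rewrite lee_fin normal_peak_ge0.
rewrite -/(M s) ME// peakE// -EFinM; congr EFin; field.
by rewrite !gt_eqF.
Qed.

(* The factor x^4 is absorbed by replacing the deviation s by sqrt 2 s. *)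
Lemma normal_prob_moment4 (s : R) : 0 < s ->
  (\int[normal_prob 0 s]_x (x ^+ 4)%:E <= (64 * s ^+ 4)%:E)%E.
Proof.
move=> s0; rewrite integral_normal_prob//; last by move=> x; rewrite exprn_even_ge0.
pose r := Num.sqrt 2 * s.
have s2 : 0 < Num.sqrt 2 :> R by rewrite sqrtr_gt0.
have r0 : 0 < r by rewrite mulr_gt0.
have r2 : r ^+ 2 = 2 * s ^+ 2 by rewrite exprMn sqr_sqrtr.
apply: (@le_trans _ _ (\int[mu]_x ((64 * s ^+ 4)%:E * (normal_pdf 0 r x)%:E)%E))%E.
  apply: ge0_le_integral => //.
  - by move=> x _; rewrite lee_fin mulr_ge0 ?exprn_even_ge0 ?normal_pdf_ge0.
  - apply/measurable_EFinP; apply: measurable_funM; first exact: measurable_funX.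
    exact: measurable_normal_pdf.
  - by apply: measurable_funeM; apply/measurable_EFinP; exact: measurable_normal_pdf.
  move=> x _; rewrite -EFinM lee_fin !normal_pdfE ?gt_eqF//.
  rewrite !peakE// /normal_fun !subr0 r2.
  (* With y = x^2 / (4 s^2) the two exponents are -2y and -y, while x^4 = 16 s^4 y^2 and y^2 <= 2
     exp y. The change of peak costs sqrt 2 <= 2, whence 64 = 16 * 2 * 2. *)
  pose y := x ^+ 2 / (2 * s ^+ 2 *+ 2).
  have y0 : 0 <= y.
    by apply: divr_ge0; [exact: sqr_ge0|rewrite pmulrn_lge0// mulr_ge0// sqr_ge0].
  rewrite (_ : - x ^+ 2 / (s ^+ 2 *+ 2) = - y + - y); last first.
    by rewrite /y; field; rewrite gt_eqF.
  rewrite mulNr -/y expRD.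
  have xE : x ^+ 4 = 16 * s ^+ 4 * y ^+ 2 by rewrite /y; field; rewrite gt_eqF.
  have ey : y ^+ 2 <= 2 * expR y.
    have := @expR_ge1Dxn _ y 1 y0; rewrite (_ : 2`!%:R = 2) // => h.
    rewrite mulrC -ler_pdivrMr// (le_trans _ h)//.
    by rewrite lerDr.
  rewrite xE /r; clearbody y; rewrite [leLHS](_ : _ =
     (s ^+ 4 / (c * s) * expR (- y)) * (16 * (y ^+ 2 * expR (-y)))); last by ring.
  rewrite [leRHS](_ : _ = (s ^+ 4 / (c * s) * expR (- y)) * (64 / Num.sqrt 2)); last first.
    by field; rewrite !gt_eqF.
  apply: ler_wpM2l.
    by rewrite !mulr_ge0 ?invr_ge0 ?mulr_ge0 ?expR_ge0 ?exprn_ge0 ?(ltW c0) ?(ltW s0).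
  have e2 : y ^+ 2 * expR (- y) <= 2.
    by rewrite expRN ler_pdivrMr ?expR_gt0.
  apply: (@le_trans _ _ (16 * 2)); first by rewrite ler_pM2l.
  rewrite ler_pdivlMr//.
  have : Num.sqrt 2 <= 2 :> R.
    have : Num.sqrt 2 ^+ 2 = 2 :> R by rewrite sqr_sqrtr.
    by nra.
  lra.
rewrite ge0_integralZl//; last 3 first.
- by apply/measurable_EFinP; exact: measurable_normal_pdf.
- by move=> x _; rewrite lee_fin normal_pdf_ge0.
- by rewrite lee_fin mulr_ge0 ?exprn_ge0 ?ltW.
by rewrite integral_normal_pdf mule1.
Qed.
End NormalMoments.

(** * Products of independent variables *)

Section Independence.
Context {R : realType} {disp : measure_display} {Omega : measurableType disp}.
Variable P : probability Omega R.
Implicit Types X Y : Omega -> R.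

(** Rectangles determine the law of (X, Y), which by independence is the product of the two laws;
    Tonelli gives the integrability of the product and Fubini factors its expectation. *)
Lemma indep_expectation X Y :
  measurable_fun setT X -> measurable_fun setT Y ->
  P.-integrable setT (EFin \o X) -> P.-integrable setT (EFin \o Y) ->
  (forall A B : set R, measurable A -> measurable B ->
     P (X @^-1` A `&` Y @^-1` B) = (P (X @^-1` A) * P (Y @^-1` B))%E) ->
  P.-integrable setT (EFin \o (fun w => X w * Y w)) /\
  \int[P]_w (X w * Y w) = (\int[P]_w X w) * (\int[P]_w Y w).
Proof.
move=> mX mY iX iY XY.
have mZ : measurable_fun setT (fun w => (X w, Y w)) by exact: measurable_fun_pair.
pose X' : {mfun Omega >-> R} := HB.pack X (isMeasurableFun.Build _ _ _ _ _ mX).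
pose Y' : {mfun Omega >-> R} := HB.pack Y (isMeasurableFun.Build _ _ _ _ _ mY).
pose Z : {mfun Omega >-> (R * R)%type} := HB.pack (fun w => (X w, Y w)) (isMeasurableFun.Build _ _ _ _ _ mZ).
pose m1 := distribution P X'. pose m2 := distribution P Y'. pose m := distribution P Z.
have mE : forall S : set (R * R), measurable S -> (m1 \x m2)%E S = m S.
  apply: product_measure_unique => A B mA mB.
  by rewrite /m /m1 /m2 /distribution /pushforward/= -XY.
pose f (z : R * R) := (z.1 * z.2)%:E.
have mf : measurable_fun setT f.
  apply/measurable_EFinP; apply: measurable_funM; [exact: measurable_fst|exact: measurable_snd].
have i1 : m1.-integrable setT EFin.
  by apply: integrable_pushforward => //; exact/measurable_EFinP.
have i2 : m2.-integrable setT EFin.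
  by apply: integrable_pushforward => //; exact/measurable_EFinP.
have if12 : (m1 \x m2)%E.-integrable setT f.
  apply/integrable12ltyP => //.
  have E (x : R) : (\int[m2]_y `|f (x, y)| = `|x%:E| * \int[m2]_y `|y%:E|)%E.
    under eq_integral => y _ do rewrite /f /= normrM EFinM.
    by rewrite ge0_integralZl//; apply/measurable_EFinP; exact: normr_measurable.
  under eq_integral => x _ do rewrite E.
  rewrite ge0_integralZr//; last 2 first.
  - apply: measurableT_comp => //; exact/measurable_EFinP.
  - exact: integral_ge0.
  have /integrableP[_ h1] := i1; have /integrableP[_ h2] := i2.
  by apply: lte_mul_pinfty => //; [exact: integral_ge0|rewrite ge0_fin_numE//; exact: integral_ge0].
have fm h : (\int[m]_z h z = \int[m1 \x m2]_z h z)%E.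
  by apply: eq_measure_integral => S mS _; apply/esym; exact: mE.
have iXY : P.-integrable setT (EFin \o (fun w => X w * Y w)).
  apply/integrableP; split; first by apply/measurable_EFinP; exact: measurable_funM.
  rewrite [ltLHS](_ : _ = \int[m]_z `|f z|)%E; last first.
    by rewrite ge0_integral_pushforward//; exact: measurableT_comp.
  by rewrite fm; have /integrableP[] := if12.
split => //.
have -> : \int[P]_w (X w * Y w) = fine (\int[m]_z f z)%E.
  by rewrite /Rintegral; congr fine; rewrite [RHS]integral_pushforward.
rewrite fm -integral12_prod_meas1//.
have E (x : R) : (\int[m2]_y f (x, y) = x%:E * \int[m2]_y y%:E)%E.
  under eq_integral => y _ do rewrite /f /= EFinM.
  by rewrite integralZl.
rewrite /fubini_F; under eq_integral => x _ do rewrite E.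
have i2E : (\int[m2]_y y%:E)%E = (\int[P]_w Y w)%:E.
  rewrite integral_pushforward//= /Rintegral fineK//; exact: integrable_fin_num.
rewrite i2E integralZr//.
have -> : (\int[m1]_x x%:E)%E = (\int[P]_w X w)%:E.
  rewrite integral_pushforward//= /Rintegral fineK//; exact: integrable_fin_num.
by rewrite -EFinM.
Qed.
End Independence.
Section NormalMean.
Context {R : realType}.
Variable s : R.
Hypothesis s0 : 0 < s.
Local Notation nu := (normal_prob 0 s).
Local Notation mu := (@lebesgue_measure R).

Lemma integrable_normal_prob_id : nu.-integrable setT (fun x : R => x%:E).
Proof.
apply: (@le_integrable _ _ _ nu setT measurableT _ (fun x : R => (1 + x ^+ 2)%:E)).
- exact/measurable_EFinP.
- move=> x _ /=; rewrite lee_fin [leRHS]ger0_norm ?addr_ge0 ?sqr_ge0//.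
  rewrite -subr_ge0 (_ : _ - _ = (`|x| - 2^-1) ^+ 2 + 3 / 4); last first.
    by rewrite -(real_normK (num_real x)); field.
  by rewrite addr_ge0 ?sqr_ge0// divr_ge0.
apply: (@integrableD _ _ _ nu setT measurableT (cst 1%E) (fun x : R => (x ^+ 2)%:E)).
  by apply: finite_measure_integrable_cst.
apply/integrableP; split.
  by apply/measurable_EFinP; exact: measurable_funX.
under eq_integral do rewrite gee0_abs ?lee_fin ?sqr_ge0//.
by rewrite normal_prob_moment2// ltry.
Qed.

(** The density is even and Lebesgue measure is invariant under reflection. *)
Lemma normal_prob_opp (A : set R) : measurable A ->
  pushforward nu (-%R : R -> measurableTypeR R) A = nu A.
Proof.
move=> mA; rewrite /pushforward /normal_prob.
transitivity (\int[pushforward mu (-%R : R -> measurableTypeR R)]_(x in A) (normal_pdf 0 s x)%:E)%E.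
  rewrite ge0_integral_pushforward//; first last.
  - by move=> x _; rewrite lee_fin normal_pdf_ge0.
  - by apply/measurable_EFinP/measurable_funTS; exact: measurable_normal_pdf.
  - apply: eq_integral => x _; congr EFin.
    by rewrite !normal_pdfE ?gt_eqF// /normal_fun !subr0 sqrrN.
by apply: eq_measure_integral => //= B mB BA; exact: lebesgue_measureN.
Qed.

(** By reflection the mean equals its opposite. *)
Lemma normal_prob_mean : \int[nu]_x x = 0.
Proof.
suff : \int[nu]_x x = - \int[nu]_x x by lra.
rewrite -mulN1r -RintegralZl//; last exact: integrable_normal_prob_id.
rewrite /Rintegral; congr fine.
transitivity (\int[pushforward nu (-%R : R -> measurableTypeR R)]_x x%:E)%E.
  by apply: eq_measure_integral => B mB _; apply/esym/normal_prob_opp.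
rewrite integral_pushforward//; first by apply: eq_integral => x _; rewrite mulN1r.
rewrite (_ : EFin \o _ = fun x => (-1)%:E * x%:E)%E; last by apply/funext => x; rewrite mulN1e.
exact: (@integrableZl _ _ _ nu setT measurableT (-1) _ integrable_normal_prob_id).
Qed.
End NormalMean.

(** * Variables measurable for a given sigma-algebra of events *)

Section SigmaMeasurable.
Context {R : realType} {disp : measure_display} {Omega : measurableType disp}.
Variable G : set (set Omega).
Hypothesis sG : sigma_algebra setT G.
Local Notation GT := (g_sigma_algebraType G).
Implicit Types X Y : Omega -> R.

(** Passing to the measurable type generated by [G] makes the closure properties of measurable
    functions available for [G]. *)
Lemma sigma_measurableP X :
  sigma_measurable G X <-> measurable_fun (setT : set GT) (X : GT -> R).
Proof.
have GE : <<s G >> = G by exact: sigma_algebra_id.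
split=> [mX _ Y mY|mX Y mY].
  by rewrite setTI; change (<<s G >> (X @^-1` Y)); rewrite GE; exact: mX.
have := mX measurableT Y mY; rewrite setTI.
by change (<<s G >> (X @^-1` Y) -> G (X @^-1` Y)); rewrite GE.
Qed.

Lemma sigma_measurable_cst (c : R) : sigma_measurable G (fun=> c).
Proof. by apply/sigma_measurableP; exact: measurable_cst. Qed.

Lemma sigma_measurableD X Y : sigma_measurable G X -> sigma_measurable G Y ->
  sigma_measurable G (fun w => X w + Y w).
Proof.
move=> /sigma_measurableP mX /sigma_measurableP mY; apply/sigma_measurableP.
exact: measurable_funD.
Qed.

Lemma sigma_measurableB X Y : sigma_measurable G X -> sigma_measurable G Y ->
  sigma_measurable G (fun w => X w - Y w).
Proof.
move=> /sigma_measurableP mX /sigma_measurableP mY; apply/sigma_measurableP.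
exact: measurable_funB.
Qed.

Lemma sigma_measurableM X Y : sigma_measurable G X -> sigma_measurable G Y ->
  sigma_measurable G (fun w => X w * Y w).
Proof.
move=> /sigma_measurableP mX /sigma_measurableP mY; apply/sigma_measurableP.
exact: measurable_funM.
Qed.

Lemma sigma_measurable_sum (I : Type) (r : seq I) (p : pred I) (X : I -> Omega -> R) :
  (forall i, p i -> sigma_measurable G (X i)) ->
  sigma_measurable G (fun w => \sum_(i <- r | p i) X i w).
Proof.
move=> mX; elim: r => [|i r ih].
  by under eq_fun do rewrite big_nil; exact: sigma_measurable_cst.
have [pi|npi] := boolP (p i); last by under eq_fun do rewrite big_cons (negbTE npi).
by under eq_fun do rewrite big_cons pi; apply: sigma_measurableD => //; exact: mX.
Qed.

Lemma sigma_measurable_comp X (h : R -> R) : measurable_fun setT h ->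
  sigma_measurable G X -> sigma_measurable G (fun w => h (X w)).
Proof.
move=> mh mX Y mY.
have := mX _ (mh measurableT Y mY).
by rewrite setTI.
Qed.

(** This is the indicator by which the energy of an integrand is cut off later. *)
Lemma sigma_measurable_le X (c : R) :
  sigma_measurable G X -> sigma_measurable G (fun w => ((X w <= c)%R)%:R : R).
Proof.
apply: (@sigma_measurable_comp _ (fun x : R => ((x <= c)%R)%:R : R)).
rewrite (_ : (fun x => _) = \1_(`]-oo, c]%classic)); first exact: measurable_indic.
by apply/funext => x; rewrite indicE mem_setE in_itv.
Qed.

Lemma sigma_measurable_measurable X : G `<=` measurable ->
  sigma_measurable G X -> measurable_fun setT X.
Proof. by move=> Gm mX _ Y mY; rewrite setTI; apply: Gm; exact: mX. Qed.

End SigmaMeasurable.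

(** * Square integrable variables and orthogonal sums *)

Section SquareIntegrable.
Context {R : realType} {disp : measure_display} {Omega : measurableType disp}.
Variable P : probability Omega R.
Implicit Types X Y : Omega -> R.

Definition integrable_rv X := P.-integrable setT (EFin \o X).

Definition sq_integrable X :=
  measurable_fun setT X /\ integrable_rv (fun w => X w ^+ 2).

Lemma integrable_rv_measurable X : integrable_rv X -> measurable_fun setT X.
Proof. by move=> /measurable_int/measurable_EFinP. Qed.

Lemma integrable_rvD X Y : integrable_rv X -> integrable_rv Y ->
  integrable_rv (fun w => X w + Y w).
Proof. by move=> iX iY; exact: (integrableD measurableT iX iY). Qed.

Lemma integrable_rvZ (c : R) X : integrable_rv X -> integrable_rv (fun w => c * X w).
Proof. by move=> iX; exact: (integrableZl measurableT c iX). Qed.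

Lemma integrable_rv_cst (c : R) : integrable_rv (fun=> c).
Proof. exact: finite_measure_integrable_cst. Qed.

Lemma integrable_rv_sum (I : Type) (r : seq I) (p : pred I) (X : I -> Omega -> R) :
  (forall i, p i -> integrable_rv (X i)) ->
  integrable_rv (fun w => \sum_(i <- r | p i) X i w).
Proof.
move=> mX; elim: r => [|i r ih].
  by under eq_fun do rewrite big_nil; exact: integrable_rv_cst.
have [pi|npi] := boolP (p i); last by under eq_fun do rewrite big_cons (negbTE npi).
by under eq_fun do rewrite big_cons pi; apply: integrable_rvD => //; exact: mX.
Qed.

Lemma le_integrable_rv X Y : measurable_fun setT X -> integrable_rv Y ->
  (forall w, `|X w| <= Y w) -> integrable_rv X.
Proof.
move=> mX iY XY; apply: (le_integrable measurableT _ _ iY).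
  exact/measurable_EFinP.
move=> w _ /=; rewrite lee_fin (le_trans (XY w))//.
by rewrite ger0_norm// (le_trans _ (XY w)).
Qed.

Lemma sq_integrableM X Y : sq_integrable X -> sq_integrable Y ->
  integrable_rv (fun w => X w * Y w).
Proof.
move=> [mX iX] [mY iY]; apply: (le_integrable_rv _ (integrable_rvD iX iY)).
  exact: measurable_funM.
move=> w; rewrite normrM -[X w ^+ 2]real_normK ?num_real// -[Y w ^+ 2]real_normK ?num_real//.
have := sqr_ge0 (`|X w| - `|Y w|); have := mulr_ge0 (normr_ge0 (X w)) (normr_ge0 (Y w)).
nra.
Qed.

Lemma sq_integrable_integrable X : sq_integrable X -> integrable_rv X.
Proof.
move=> sX; have s1 : sq_integrable (fun=> 1).
  by split => //; exact: integrable_rv_cst.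
by have := sq_integrableM sX s1; under eq_fun do rewrite mulr1.
Qed.

Lemma sq_integrableD X Y : sq_integrable X -> sq_integrable Y ->
  sq_integrable (fun w => X w + Y w).
Proof.
move=> sX sY; have [mX iX] := sX; have [mY iY] := sY.
split; first exact: measurable_funD.
under eq_fun do rewrite sqrrD -mulr_natl.
by apply: integrable_rvD => //; apply: integrable_rvD => //;
  apply: integrable_rvZ; exact: sq_integrableM.
Qed.

Lemma sq_integrable0 : sq_integrable (fun=> 0).
Proof. by split => //; exact: integrable_rv_cst. Qed.

Lemma sq_integrable_sum (I : Type) (r : seq I) (p : pred I) (X : I -> Omega -> R) :
  (forall i, p i -> sq_integrable (X i)) ->
  sq_integrable (fun w => \sum_(i <- r | p i) X i w).
Proof.
move=> mX; elim: r => [|i r ih].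
  by under eq_fun do rewrite big_nil; exact: sq_integrable0.
have [pi|npi] := boolP (p i); last by under eq_fun do rewrite big_cons (negbTE npi).
by under eq_fun do rewrite big_cons pi; apply: sq_integrableD => //; exact: mX.
Qed.

Lemma expectation_sum (N : nat) (X : nat -> Omega -> R) :
  (forall i, (i < N)%N -> integrable_rv (X i)) ->
  \int[P]_w (\sum_(i < N) X i w) = \sum_(i < N) \int[P]_w X i w.
Proof.
elim: N => [|N ih] iX.
  under eq_Rintegral do rewrite big_ord0.
  by rewrite big_ord0 Rintegral_cst// mul0r.
under eq_Rintegral do rewrite big_ord_recr/=.
rewrite big_ord_recr/= RintegralD ?ih//; last exact: iX.
  by move=> i iN; apply: iX; rewrite ltnW.
by apply: integrable_rv_sum => i _; apply: iX; exact: (ltnW (ltn_ord i)).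
Qed.

(** Pythagoras in L^2, by induction: the cross term of the last summand with the sum of the others
    has expectation 0. *)
Lemma expectation_sq_sum_orthogonal (N : nat) (X : nat -> Omega -> R) :
  (forall i, (i < N)%N -> sq_integrable (X i)) ->
  (forall i j, (i < j < N)%N -> \int[P]_w (X i w * X j w) = 0) ->
  \int[P]_w (\sum_(i < N) X i w) ^+ 2 = \sum_(i < N) \int[P]_w (X i w ^+ 2).
Proof.
elim: N => [|N ih] sX oX.
  under eq_Rintegral do rewrite big_ord0 expr0n/=.
  by rewrite big_ord0 Rintegral_cst// mul0r.
under eq_Rintegral do rewrite big_ord_recr/= sqrrD -mulr_natl.
have sS : sq_integrable (fun w => \sum_(i < N) X i w).
  by apply: sq_integrable_sum => i _; apply: sX; exact: (ltnW (ltn_ord i)).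
have sN := sX N (ltnSn _).
have iSN := integrable_rvZ 2 (sq_integrableM sS sN).
rewrite RintegralD//; last 2 first.
- by apply: integrable_rvD => //; exact: sS.2.
- exact: sN.2.
rewrite RintegralD//; last exact: sS.2.
rewrite RintegralZl//; last exact: sq_integrableM.
under [X in 2 * X]eq_Rintegral do rewrite mulr_suml.
rewrite (expectation_sum (X := fun i w => X i w * X N w)); last first.
  by move=> i iN; apply: sq_integrableM => //; apply: sX; rewrite ltnW.
rewrite [X in 2 * X]big1 ?mulr0 ?addr0; last by move=> i _; rewrite oX// ltn_ord /=.
rewrite big_ord_recr/= ih//.
- by move=> i iN; apply: sX; rewrite ltnW.
- by move=> i j /andP[ij jN]; apply: oX; rewrite ij ltnW.
Qed.

Lemma measurable_superlevel X (d : R) :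
  measurable_fun setT X -> measurable [set w | (d <= X w)%R].
Proof.
move=> mX; rewrite (_ : [set _ | _] = X @^-1` `[d, +oo[%classic).
  by rewrite -[X in measurable X]setTI; exact: mX.
by apply/seteqP; split=> w /=; rewrite in_itv/= andbT.
Qed.

Lemma markov_ge0 X (e d : R) : 0 < d -> integrable_rv X -> (forall w, 0 <= X w) ->
  \int[P]_w X w <= e -> (P [set w | (d <= X w)%R] <= (e / d)%:E)%E.
Proof.
move=> d0 iX X0 Xe; have mX := integrable_rv_measurable iX.
have mS : measurable [set w | (d <= X w)%R].
  exact: measurable_superlevel.
rewrite mulrC EFinM lee_pdivlMl//.
have -> : (d%:E * P [set w | (d <= X w)%R] = \int[P]_(w in [set w | (d <= X w)%R]) (cst d%:E) w)%E.
  by rewrite integral_cst.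
apply: (@le_trans _ _ (\int[P]_w (X w)%:E)%E).
  apply: (@le_trans _ _ (\int[P]_(w in [set w | (d <= X w)%R]) (X w)%:E)%E).
    apply: ge0_le_integral => //.
    - by move=> w _; rewrite lee_fin ltW.
    - by move: mX => /measurable_EFinP; exact: measurable_funTS.
  apply: ge0_subset_integral => //; first exact/measurable_EFinP.
  by move=> w _; rewrite lee_fin.
by rewrite -[leLHS]fineK ?lee_fin//; exact: integrable_fin_num.
Qed.

End SquareIntegrable.
Section NormalLaw.
Context {R : realType} {disp : measure_display} {Omega : measurableType disp}.
Variable P : probability Omega R.
Variables (X : Omega -> R) (m sg : R).
Local Notation nu := (normal_prob m sg).
Hypothesis mX : measurable_fun setT X.
Hypothesis XE : forall Y : set R, measurable Y -> P (X @^-1` Y) = nu Y.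

Lemma normal_expectation_ge0 (h : R -> R) : measurable_fun setT h -> (forall x, 0 <= h x) ->
  (\int[P]_w (h (X w))%:E = \int[nu]_x (h x)%:E)%E.
Proof.
move=> mh h0; have mX' : measurable_fun setT (X : Omega -> measurableTypeR R) by exact: mX.
pose X' : {mfun Omega >-> measurableTypeR R} :=
  HB.pack (X : Omega -> measurableTypeR R) (isMeasurableFun.Build _ _ _ _ _ mX').
transitivity (\int[distribution P X']_x (h x)%:E)%E; last first.
  by apply: eq_measure_integral => A mA _; exact: XE.
rewrite ge0_integral_pushforward//; first exact/measurable_EFinP.
by move=> x _; rewrite lee_fin.
Qed.

Lemma normal_expectation (h : R -> R) : measurable_fun setT h ->
  nu.-integrable setT (EFin \o h) ->
  integrable_rv P (fun w => h (X w)) /\ \int[P]_w h (X w) = \int[nu]_x h x.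
Proof.
move=> mh ih; have iX : integrable_rv P (fun w => h (X w)).
  apply/integrableP; split; first by apply/measurable_EFinP; exact: measurableT_comp.
  under eq_integral do rewrite /=.
  rewrite (normal_expectation_ge0 (h := fun x => `|h x|))//; last exact: measurableT_comp.
  by have /integrableP[] := ih.
split=> //.
have mX' : measurable_fun setT (X : Omega -> measurableTypeR R) by exact: mX.
pose X' : {mfun Omega >-> measurableTypeR R} :=
  HB.pack (X : Omega -> measurableTypeR R) (isMeasurableFun.Build _ _ _ _ _ mX').
rewrite /Rintegral; congr fine.
transitivity (\int[distribution P X']_x (h x)%:E)%E; last first.
  by apply: eq_measure_integral => A mA _; exact: XE.
by rewrite integral_pushforward//; exact/measurable_EFinP.
Qed.

End NormalLaw.

Lemma expectation_cst {R : realType} {disp : measure_display} {Omega : measurableType disp}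
  (P : probability Omega R) (c : R) : \int[P]_(_ in setT) c = c.
Proof.
rewrite Rintegral_cst//.
by have -> := congr1 fine (@probability_setT _ _ _ P); rewrite mulr1.
Qed.

(** * Increments of a Brownian motion *)

Section Brownian.
Context {R : realType} {disp : measure_display} {Omega : measurableType disp}.
Variables (P : probability Omega R) (F : R -> set (set Omega)) (T : R).
Hypothesis cF : complete_filtration P T F.

Lemma filtration_algebra t : 0 <= t <= T -> sigma_algebra setT (F t).
Proof. by case: cF => _ + _ _ _; apply. Qed.

Lemma filtration_measurable t : 0 <= t <= T -> F t `<=` measurable.
Proof. by case: cF => _ _ + _ _; apply. Qed.

Lemma adapted_measurable X t : adapted F T X -> 0 <= t <= T -> measurable_fun setT (X t).
Proof.
move=> aX tT; apply: (sigma_measurable_measurable (filtration_measurable tT)).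
exact: aX.
Qed.

Lemma sigma_measurable_filtration (X : Omega -> R) s t :
  sigma_measurable (F s) X -> 0 <= s -> s <= t -> t <= T -> sigma_measurable (F t) X.
Proof.
by case: cF => _ _ _ + _ => FF mX s0 st tT Y mY; apply: (FF _ _ s0 st tT); exact: mX.
Qed.

Lemma adapted_filtration X s t : adapted F T X ->
  0 <= s -> s <= t -> t <= T -> sigma_measurable (F t) (X s).
Proof.
move=> aX s0 st tT; apply: (sigma_measurable_filtration _ s0 st tT).
by apply: aX; rewrite s0 (le_trans st).
Qed.

Section Increments.
Variable W : R -> Omega -> R.
Hypothesis bW : brownian P F T W.

Lemma brownian_adapted : adapted F T W. Proof. by case: bW. Qed.

Lemma incr_measurable s t : 0 <= s <= T -> 0 <= t <= T -> measurable_fun setT (incr W s t).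
Proof.
by move=> sT tT; apply: measurable_funB; apply: adapted_measurable => //; exact: brownian_adapted.
Qed.

Lemma incr_sigma_measurable s t u : 0 <= s -> s <= t -> t <= u -> u <= T ->
  sigma_measurable (F u) (incr W s t).
Proof.
move=> s0 st tu uT; have u0 : 0 <= u <= T by rewrite uT andbT (le_trans s0)// (le_trans st).
apply: (sigma_measurableB (filtration_algebra u0)).
  by apply: (adapted_filtration brownian_adapted _ _ uT) => //; exact: le_trans st.
by apply: (adapted_filtration brownian_adapted _ _ uT) => //; exact: le_trans tu.
Qed.

(** [brownian] speaks of s < t only, so s = t is treated apart: stopping a partition produces such
    degenerate increments. The constant 64 is that of [normal_prob_moment4] at the deviation sqrt (t
    - s). *)
Lemma incr_moments s t : 0 <= s -> s <= t -> t <= T ->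
  [/\ sq_integrable P (incr W s t), \int[P]_w incr W s t w = 0,
      \int[P]_w (incr W s t w ^+ 2) = t - s,
      sq_integrable P (fun w => incr W s t w ^+ 2) &
      \int[P]_w (incr W s t w ^+ 2) ^+ 2 <= 64 * (t - s) ^+ 2].
Proof.
move=> s0; rewrite le_eqVlt => /predU1P[<- sT|st tT].
  have -> : incr W s s = fun=> 0 by apply/funext => w; rewrite /incr subrr.
  have i0 : \int[P]_w 0 = 0 :> R by rewrite Rintegral_cst// mul0r.
  rewrite subrr !expr0n/= mulr0; split => //.
  - exact: sq_integrable0.
  - exact: sq_integrable0.
  - by rewrite i0.
have sT : 0 <= s <= T by rewrite s0 ltW// (lt_le_trans st).
have tT' : 0 <= t <= T by rewrite tT andbT ltW// (le_lt_trans s0).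
have mX := incr_measurable sT tT'.
have [_ _ _ /(_ s t s0 st tT)[law _]] := bW.
set sg := Num.sqrt (t - s) in law.
have sg0 : 0 < sg by rewrite sqrtr_gt0 subr_gt0.
have sg2 : sg ^+ 2 = t - s by rewrite sqr_sqrtr// subr_ge0 ltW.
have E h := @normal_expectation_ge0 _ _ _ P _ _ _ mX law h.
have E2 : (\int[P]_w (incr W s t w ^+ 2)%:E = (t - s)%:E)%E.
  rewrite (E (fun x => x ^+ 2))//; last by move=> x; exact: sqr_ge0.
  by rewrite normal_prob_moment2// sg2.
have E4 : (\int[P]_w ((incr W s t w ^+ 2) ^+ 2)%:E <= (64 * (t - s) ^+ 2)%:E)%E.
  rewrite (E (fun x => (x ^+ 2) ^+ 2))//; last by move=> x; exact: sqr_ge0.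
    under eq_integral do rewrite -exprM.
    by rewrite (le_trans (normal_prob_moment4 sg0))// lee_fin -sg2 -exprM.
  by apply: measurable_funX; exact: measurable_funX.
have m2 : measurable_fun setT (fun w => incr W s t w ^+ 2) by exact: measurable_funX.
have m4 : measurable_fun setT (fun w => (incr W s t w ^+ 2) ^+ 2) by exact: measurable_funX.
have i2 : integrable_rv P (fun w => incr W s t w ^+ 2).
  apply/integrableP; split; first exact/measurable_EFinP.
  by under eq_integral do rewrite gee0_abs ?lee_fin ?sqr_ge0//; rewrite E2 ltry.
have i4 : integrable_rv P (fun w => (incr W s t w ^+ 2) ^+ 2).
  apply/integrableP; split; first exact/measurable_EFinP.
  under eq_integral do rewrite gee0_abs ?lee_fin ?sqr_ge0//.
  by rewrite (le_lt_trans E4)// ltry.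
split => //.
- have [_ ->] := normal_expectation (h := id) mX law (@measurable_id _ _ _) (integrable_normal_prob_id sg0).
  exact: normal_prob_mean.
- by rewrite /Rintegral E2.
- rewrite -lee_fin /Rintegral fineK//; exact: integrable_fin_num.
Qed.

(** For s < t a Borel function of the increment is independent of F_s; for s = t it is a
    constant. *)
Lemma incr_independent s t (X : Omega -> R) (h : R -> R) : 0 <= s -> s <= t -> t <= T ->
  sigma_measurable (F s) X -> integrable_rv P X -> measurable_fun setT h ->
  integrable_rv P (fun w => h (incr W s t w)) ->
  integrable_rv P (fun w => X w * h (incr W s t w)) /\
  \int[P]_w (X w * h (incr W s t w)) = \int[P]_w X w * \int[P]_w h (incr W s t w).
Proof.
move=> s0; rewrite le_eqVlt => /predU1P[<- sT mX iX mh ih|st tT mX iX mh ih].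
  have E : incr W s s = fun=> 0 by apply/funext => w; rewrite /incr subrr.
  rewrite !E; split.
    by under eq_fun do rewrite mulrC; exact: integrable_rvZ.
  by rewrite RintegralZr// expectation_cst.
have sT : 0 <= s <= T by rewrite s0 ltW// (lt_le_trans st).
apply: indep_expectation => //.
- exact: integrable_rv_measurable iX.
- exact: integrable_rv_measurable ih.
move=> A B mA mB; have [_ _ _ /(_ s t s0 st tT)[_ ind]] := bW.
have -> : (fun w => h (incr W s t w)) @^-1` B = incr W s t @^-1` (h @^-1` B) by [].
apply: ind; first exact: mX.
by rewrite -[X in measurable X]setTI; exact: mh.
Qed.

End Increments.
End Brownian.

(** * Brownian brackets along partitions *)

(** Knots beyond t are moved to t: a partition of [0, T] becomes one of [0, t] with as many
    intervals, some possibly degenerate. The sums in [covariation] and [sp_integral] have this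
    shape. *)
Definition stopped {R : realType} (s : seq R) (t : R) (k : nat) : R := Num.min (knot s k) t.

Section StoppedKnots.
Context {R : realType}.
Variables (T t : R) (s : seq R).
Hypothesis (t0T : 0 <= t <= T) (sP : itv_partition 0 T s).
Local Notation p := (stopped s t).

Lemma knot_bounds k : 0 <= knot s k <= T.
Proof.
have T0 : 0 <= T by case/andP: t0T => /le_trans; apply.
have [ks|ks] := ltnP k (size s).+1; last first.
  by rewrite /knot nth_default// lexx T0.
rewrite /knot (set_nth_default T)//.
by rewrite itv_partition_nth_ge// itv_partition_nth_le.
Qed.

Lemma knot_ltS k : (k < size s)%N -> knot s k < knot s k.+1.
Proof. by move=> ks; case: sP => /(pathP 0)/(_ k ks). Qed.

Lemma knot_size : knot s (size s) = T.
Proof. by rewrite /knot (itv_partition_nth_size _ sP). Qed.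

Lemma mesh_knot k : (k < size s)%N -> knot s k.+1 - knot s k <= mesh s.
Proof. by move=> ks; rewrite /mesh (le_bigmax _ _ (Ordinal ks)). Qed.

Lemma stopped0 : p 0 = 0.
Proof. by rewrite /stopped /knot/= min_l//; case/andP: t0T. Qed.

Lemma stopped_size : p (size s) = t.
Proof. by rewrite /stopped knot_size min_r//; case/andP: t0T. Qed.

Lemma stopped_ge0 k : 0 <= p k.
Proof.
by rewrite le_min; have /andP[-> _] := knot_bounds k; case/andP: t0T.
Qed.

Lemma stopped_le k : p k <= t. Proof. by rewrite ge_min lexx orbT. Qed.

Lemma stopped_leT k : p k <= T.
Proof. by rewrite (le_trans (stopped_le k))//; case/andP: t0T. Qed.

Lemma stopped_in k : 0 <= p k <= T. Proof. by rewrite stopped_ge0 stopped_leT. Qed.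

Lemma stopped_leS k : (k < size s)%N -> p k <= p k.+1.
Proof. by move=> ks; rewrite le_min2// ltW// knot_ltS. Qed.

Lemma stopped_le2 j k : (j <= k <= size s)%N -> p j <= p k.
Proof.
elim: k j => [|k ih] j; first by rewrite leqn0 => /andP[/eqP ->].
rewrite leq_eqVlt => /andP[/predU1P[->//|jk] ks].
by rewrite (le_trans (ih j _) (stopped_leS ks))// -ltnS jk ltnW.
Qed.

Lemma stopped_mesh k : (k < size s)%N -> p k.+1 - p k <= mesh s.
Proof.
move=> ks; apply: le_trans (mesh_knot ks); have := ltW (knot_ltS ks).
rewrite /stopped; set x := knot _ _; set y := knot _ _ => xy.
have [xt|tx] := leP x t; have [yt|ty] := leP y t => //.
- by rewrite lerD2r ltW.
- by have := lt_le_trans tx (le_trans xy yt); rewrite ltxx.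
- by rewrite subrr subr_ge0.
Qed.

Lemma sum_stopped : \sum_(k < size s) (p k.+1 - p k) = t.
Proof.
by rewrite -(big_mkord xpredT (fun k => p k.+1 - p k)) telescope_sumr// stopped0 stopped_size subr0.
Qed.

Lemma sum_stopped_sq : \sum_(k < size s) (p k.+1 - p k) ^+ 2 <= mesh s * T.
Proof.
have T0 : t <= T by case/andP: t0T.
have m0 : 0 <= mesh s by exact: bigmax_ge_id.
apply: (@le_trans _ _ (\sum_(k < size s) (mesh s * (p k.+1 - p k)))).
  apply: ler_sum => k _; rewrite expr2 ler_wpM2r ?stopped_mesh//.
  by rewrite subr_ge0 stopped_leS.
by rewrite -mulr_sumr sum_stopped ler_wpM2l.
Qed.

End StoppedKnots.

Section MeshConvergence.
Context {R : realType} {disp : measure_display} {Omega : measurableType disp}.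
Variables (P : probability Omega R) (T : R).

(** Convergence to 0 in probability as the mesh tends to 0, uniformly over partitions; a single e
    bounds both the value and the probability. The exceptional event only has to contain the bad
    set, so [Y s] may be nonmeasurable. *)
Definition mesh_cvg0 (Y : seq R -> Omega -> R) : Prop :=
  forall e : R, 0 < e -> exists2 d : R, 0 < d &
    forall s, itv_partition 0 T s -> mesh s < d ->
      exists A : set Omega, [/\ measurable A, (P A <= e%:E)%E &
        forall w, ~ A w -> `|Y s w| < e].

Definition integral_error (M w I : R -> Omega -> R) t (s : seq R) o : R :=
  \sum_(k < size s) (incr I (stopped s t k) (stopped s t k.+1) o -
    w (stopped s t k) o * incr M (stopped s t k) (stopped s t k.+1) o) ^+ 2.

Definition approximates_integral M w I :=
  forall t, 0 <= t <= T -> mesh_cvg0 (integral_error M w I t).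

Variables (t : R) (t0T : 0 <= t <= T).
Local Notation p := (stopped ^~ t).

(** Second moment method: orthogonality gives E S^2 <= C sum dp^2 <= C T mesh, and Markov's
    inequality concludes. Keeping only the intervals selected by [c] preserves orthogonality, which
    is what sums over blocks require. *)
Lemma mesh_cvg0_orthogonal (D : seq R -> nat -> Omega -> R) (C : R) (c : seq R -> nat -> bool) :
  0 <= C ->
  (forall s, itv_partition 0 T s -> forall k, (k < size s)%N -> sq_integrable P (D s k)) ->
  (forall s, itv_partition 0 T s -> forall j k, (j < k < size s)%N ->
     \int[P]_w (D s j w * D s k w) = 0) ->
  (forall s, itv_partition 0 T s -> forall k, (k < size s)%N ->
     \int[P]_w (D s k w ^+ 2) <= C * (p s k.+1 - p s k) ^+ 2) ->
  mesh_cvg0 (fun s w => \sum_(k < size s | c s k) D s k w).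
Proof.
move=> C0 sD oD DC e e0.
have T0 : 0 <= T by case/andP: t0T => /le_trans; apply.
pose K := C * T + 1; have K0 : 0 < K by rewrite ltr_wpDl// mulr_ge0.
(* Markov's inequality at the level e^2 bounds the probability by C T mesh / e^2, which is at most e
   when mesh < e^3 / K. *)
exists (e ^+ 3 / K); first by rewrite divr_gt0// exprn_gt0.
move=> s sP ms.
pose X k w := D s k w *+ c s k.
have XE w : \sum_(k < size s | c s k) D s k w = \sum_(k < size s) X k w.
  by rewrite big_mkcond/=; apply: eq_bigr => k _; rewrite /X; case: (c s k).
have sX k : (k < size s)%N -> sq_integrable P (X k).
  by rewrite /X; case: (c s k) => ks; [exact: sD|exact: sq_integrable0].
have sS : sq_integrable P (fun w => \sum_(k < size s) X k w).
  by apply: sq_integrable_sum => k _; exact: sX.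
have ES : \int[P]_w (\sum_(k < size s) X k w) ^+ 2 <= C * (mesh s * T).
  rewrite expectation_sq_sum_orthogonal//; last first.
    move=> i j ij; rewrite /X; case: (c s i); case: (c s j);
      rewrite ?mulr0n; under eq_Rintegral do rewrite ?mul0r ?mulr0; rewrite ?expectation_cst//.
    exact: oD.
  apply: (@le_trans _ _ (C * \sum_(k < size s) (p s k.+1 - p s k) ^+ 2)); last first.
    by rewrite ler_wpM2l// (sum_stopped_sq t0T sP).
  rewrite mulr_sumr; apply: ler_sum => k _; rewrite /X; case: (c s k); first exact: DC.
  under eq_Rintegral do rewrite mulr0n expr0n/=.
  by rewrite expectation_cst mulr_ge0 ?sqr_ge0.
have S0 w : 0 <= (\sum_(k < size s) X k w) ^+ 2 by exact: sqr_ge0.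
have e20 : 0 < e ^+ 2 by rewrite exprn_gt0.
exists [set w | (e ^+ 2 <= (\sum_(k < size s) X k w) ^+ 2)%R]; split.
- by apply: measurable_superlevel; apply: measurable_funX; exact: sS.1.
- apply: le_trans (markov_ge0 e20 sS.2 S0 ES) _; rewrite lee_fin ler_pdivrMr//.
  rewrite -exprS mulrCA; apply: (@le_trans _ _ (mesh s * K)).
    rewrite ler_wpM2l ?lerDl//; exact: bigmax_ge_id.
  by rewrite ltW// -ltr_pdivlMr.
- move=> w /negP; rewrite -ltNge => h.
  rewrite XE -ltr_sqr ?nnegrE ?(ltW e0)//.
  by rewrite real_normK ?num_real.
Qed.

End MeshConvergence.
Section BrownianBrackets.
Context {R : realType} {disp : measure_display} {Omega : measurableType disp}.
Variables (P : probability Omega R) (F : R -> set (set Omega)) (T : R).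
Hypothesis cF : complete_filtration P T F.
Variables (t : R) (t0T : 0 <= t <= T) (c : seq R -> nat -> bool).
Local Notation p := (stopped ^~ t).

(** The variables dW^2 - dt are centred and independent of the past, hence orthogonal; their second
    moment is E dW^4 - dt^2 <= 64 dt^2. *)
Lemma brownian_quadratic_variation W : brownian P F T W ->
  mesh_cvg0 P T (fun s w => \sum_(k < size s | c s k)
    (incr W (p s k) (p s k.+1) w ^+ 2 - (p s k.+1 - p s k))).
Proof.
move=> bW; pose D s k w := incr W (p s k) (p s k.+1) w ^+ 2 - (p s k.+1 - p s k).
have M s (sP : itv_partition 0 T s) k (ks : (k < size s)%N) :=
  incr_moments cF bW (stopped_ge0 t0T sP k) (stopped_leS t sP ks) (stopped_leT s t0T k.+1).
have sD s : itv_partition 0 T s -> forall k, (k < size s)%N -> sq_integrable P (D s k).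
  move=> sP k ks; have [_ _ _ s4 _] := M s sP k ks.
  apply: sq_integrableD => //.
  by split => //; exact: integrable_rv_cst.
apply: (@mesh_cvg0_orthogonal _ _ _ P T t t0T D 64 c) => //.
- move=> s sP j k /andP[jk ks].
  have js := ltn_trans jk ks.
  have [_ _ e2 s4 _] := M s sP k ks.
  have p0 := stopped_ge0 t0T sP k; have pS := stopped_leS t sP ks; have pT := stopped_leT s t0T k.+1.
  have jS : p s j.+1 <= p s k by apply: (stopped_le2 t sP); rewrite jk ltnW.
  have kT : 0 <= p s k <= T by rewrite p0 stopped_leT.
  have mDj : sigma_measurable (F (p s k)) (D s j).
    apply: (sigma_measurableB (filtration_algebra cF kT)); last first.
      exact: sigma_measurable_cst (filtration_algebra cF kT) _.
    apply: (sigma_measurable_comp (h := fun x => x ^+ 2)); first exact: measurable_funX.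
    apply: (incr_sigma_measurable cF bW); first exact: (stopped_ge0 t0T sP).
    - exact: (stopped_leS t sP js).
    - exact: jS.
    - by case/andP: kT.
  have [_ ->] := incr_independent bW p0 pS pT mDj (sq_integrable_integrable (sD s sP j js))
    (h := fun x => x ^+ 2 - (p s k.+1 - p s k)) (measurable_funB (measurable_funX _ (@measurable_id _ _ _)) (@measurable_cst _ _ _ _ _ _))
    (sq_integrable_integrable (sD s sP k ks)).
  rewrite [X in _ * X](_ : _ = 0) ?mulr0// RintegralB//; last 2 first.
  - exact: sq_integrable_integrable s4.
  - exact: integrable_rv_cst.
  by rewrite e2 expectation_cst subrr.
- move=> s sP k ks.
  have [s2 _ e2 s4 e4] := M s sP k ks.
  pose X := incr W (p s k) (p s k.+1); set d := p s k.+1 - p s k.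
  have -> : (fun w => D s k w ^+ 2) = (fun w => ((X w ^+ 2) ^+ 2 + (- 2 * d) * X w ^+ 2) + d ^+ 2).
    by apply/funext => w; rewrite /D -/d -/X; ring.
  have i2 : integrable_rv P (fun w => - 2 * d * X w ^+ 2) by apply: integrable_rvZ; exact: s2.2.
  have i4 : integrable_rv P (fun w => (X w ^+ 2) ^+ 2) := s4.2.
  rewrite RintegralD//; last 2 first.
  - exact: integrable_rvD.
  - exact: integrable_rv_cst.
  rewrite RintegralD// RintegralZl//; last exact: s2.2.
  rewrite expectation_cst e2 -/d.
  have := e4; rewrite -/X -/d.
  have := sqr_ge0 d; lra.
Qed.

Lemma sigma_of_incr (X : R -> Omega -> R) u v : 0 <= u <= T -> 0 <= v <= T ->
  sigma_measurable (sigma_of T X) (incr X u v).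
Proof.
move=> uT vT; have sA : sigma_algebra setT (sigma_of (Omega := Omega) T X) by exact: smallest_sigma_algebra.
apply: (sigma_measurableB sA) => Y mY; apply: sub_sigma_algebra.
- by exists v, Y; split.
- by exists u, Y; split.
Qed.

(** Independence of the two processes factors E (dB_j dB_k dW_j dW_k). For j < k the factor E (dW_j
    dW_k) vanishes, dW_k being centred and independent of the past; for j = k the product is dt^2,
    whence the constant 1. *)
Lemma independent_brownian_covariation B W : brownian P F T B -> brownian P F T W ->
  independent_processes P T B W ->
  mesh_cvg0 P T (fun s w => \sum_(k < size s | c s k)
    (incr B (p s k) (p s k.+1) w * incr W (p s k) (p s k.+1) w)).
Proof.
move=> bB bW iBW; pose b s k := incr B (p s k) (p s k.+1); pose x s k := incr W (p s k) (p s k.+1).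
have MB s (sP : itv_partition 0 T s) k (ks : (k < size s)%N) :=
  incr_moments cF bB (stopped_ge0 t0T sP k) (stopped_leS t sP ks) (stopped_leT s t0T k.+1).
have MW s (sP : itv_partition 0 T s) k (ks : (k < size s)%N) :=
  incr_moments cF bW (stopped_ge0 t0T sP k) (stopped_leS t sP ks) (stopped_leT s t0T k.+1).
have sA X : sigma_algebra setT (sigma_of (Omega := Omega) T X) by exact: smallest_sigma_algebra.
have pin s (sP : itv_partition 0 T s) k := stopped_in t0T sP k.
have ind s (sP : itv_partition 0 T s) j k (js : (j < size s)%N) (ks : (k < size s)%N) :
  integrable_rv P (fun w => b s j w * b s k w) -> integrable_rv P (fun w => x s j w * x s k w) ->
  integrable_rv P (fun w => (b s j w * b s k w) * (x s j w * x s k w)) /\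
  \int[P]_w ((b s j w * b s k w) * (x s j w * x s k w)) =
  (\int[P]_w (b s j w * b s k w)) * (\int[P]_w (x s j w * x s k w)).
  move=> ib ix; apply: indep_expectation => //.
  - exact: integrable_rv_measurable ib.
  - exact: integrable_rv_measurable ix.
  move=> A A' mA mA'; apply: iBW.
  - apply: (sigma_measurableM (sA B)) A mA; apply: sigma_of_incr; exact: pin.
  - apply: (sigma_measurableM (sA W)) A' mA'; apply: sigma_of_incr; exact: pin.
apply: (@mesh_cvg0_orthogonal _ _ _ P T t t0T (fun s k w => b s k w * x s k w) 1 c) => //.
- move=> s sP k ks; have [sb _ _ _ _] := MB s sP k ks; have [sx _ _ _ _] := MW s sP k ks.
  split; first by apply: measurable_funM; [exact: sb.1|exact: sx.1].
  have [] := ind s sP k k ks ks (sq_integrableM sb sb) (sq_integrableM sx sx).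
  by under eq_fun do rewrite mulrACA -expr2.
- move=> s sP j k /andP[jk ks]; have js := ltn_trans jk ks.
  have [sbj _ _ _ _] := MB s sP j js; have [sxj _ _ _ _] := MW s sP j js.
  have [sbk _ _ _ _] := MB s sP k ks; have [sxk e1 _ _ _] := MW s sP k ks.
  have [_] := ind s sP j k js ks (sq_integrableM sbj sbk) (sq_integrableM sxj sxk).
  under eq_Rintegral do rewrite mulrACA.
  move=> ->.
  have p0 := stopped_ge0 t0T sP k; have pS := stopped_leS t sP ks; have pT := stopped_leT s t0T k.+1.
  have mxj : sigma_measurable (F (p s k)) (x s j).
    apply: (incr_sigma_measurable cF bW); first exact: (stopped_ge0 t0T sP).
    - exact: (stopped_leS t sP js).
    - by apply: (stopped_le2 t sP); rewrite jk ltnW.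
    - exact: (stopped_leT s t0T).
  have [_ ->] := incr_independent bW p0 pS pT mxj (sq_integrable_integrable sxj)
    (h := fun x => x) (@measurable_id _ _ _) (sq_integrable_integrable sxk).
  by rewrite e1 !mulr0.
- move=> s sP k ks; have [sb _ eb _ _] := MB s sP k ks; have [sx _ ex _ _] := MW s sP k ks.
  have [_] := ind s sP k k ks ks (sq_integrableM sb sb) (sq_integrableM sx sx).
  under eq_Rintegral do rewrite mulrACA -expr2.
  move=> ->; under eq_Rintegral do rewrite -expr2.
  rewrite eb; under eq_Rintegral do rewrite -expr2.
  by rewrite ex mul1r -expr2.
Qed.

End BrownianBrackets.

(** * Block sums of integrals of step processes *)

Section StepIntegral.
Context {R : realType} {disp : measure_display} {Omega : measurableType disp}.
Variables (P : probability Omega R) (F : R -> set (set Omega)) (T : R).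
Hypothesis cF : complete_filtration P T F.
Variable W : R -> Omega -> R.
Hypothesis bW : brownian P F T W.
Variables (p : nat -> R) (N : nat).
Hypothesis pT : forall m, (m <= N)%N -> 0 <= p m <= T.
Hypothesis pS : forall m, (m < N)%N -> p m <= p m.+1.
Variable X : nat -> Omega -> R.
Hypothesis mX : forall m, (m < N)%N -> sigma_measurable (F (p m)) (X m).
Hypothesis X0 : forall m, (m < N)%N -> p m = p m.+1 -> X m = fun=> 0.
Variables (e d : R) (K : nat) (kappa : nat -> nat).
Hypotheses (e0 : 0 < e) (d0 : 0 < d).
Hypothesis kappaK : forall m, (m < N)%N -> (kappa m < K)%N.

Let dp m := p m.+1 - p m.
Let dW m := incr W (p m) (p m.+1).
(** Energy up to and including the current interval: [X m] is known at the left end p_m, hence so is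
    [S m], and cutting off by it keeps the integrand measurable there. *)
Let S m w := \sum_(i < m.+1) X i w ^+ 2 * dp i.
(* Stopping the integrand when its energy exceeds e makes it square integrable. *)
Let Y m w := X m w * ((S m w <= e)%R)%:R.

Let dp_ge0 m : (m < N)%N -> 0 <= dp m.
Proof. by move=> mN; rewrite subr_ge0 pS. Qed.

Let p_le i m : (i <= m <= N)%N -> p i <= p m.
Proof.
elim: m i => [|m ih] i; first by rewrite leqn0 => /andP[/eqP ->].
rewrite leq_eqVlt => /andP[/predU1P[->//|im] mN].
by rewrite (le_trans (ih i _) (pS mN))// -ltnS im ltnW.
Qed.

Let mXj i m : (i <= m < N)%N -> sigma_measurable (F (p m)) (X i).
Proof.
move=> /andP[im mN]; have iN := leq_ltn_trans im mN.
have /andP[pi0 _] := pT (ltnW iN); have /andP[_ pmT] := pT (ltnW mN).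
by apply: (sigma_measurable_filtration cF (mX iN) pi0 _ pmT); rewrite p_le// im ltnW.
Qed.

Let algF m : (m < N)%N -> sigma_algebra setT (F (p m)).
Proof. by move=> mN; apply: (filtration_algebra cF); exact: pT (ltnW mN). Qed.

Let sqrM : measurable_fun (setT : set R) (fun x : R => x ^+ 2).
Proof. exact: measurable_funX. Qed.

Let mY m : (m < N)%N -> sigma_measurable (F (p m)) (Y m).
Proof.
move=> mN; apply: (sigma_measurableM (algF mN)); first exact: mX.
apply: sigma_measurable_le; apply: (sigma_measurable_sum (algF mN)) => i _.
apply: (sigma_measurableM (algF mN)); last exact: (sigma_measurable_cst (algF mN)).
apply: (sigma_measurable_comp sqrM); apply: mXj.
by rewrite mN andbT -ltnS ltn_ord.
Qed.

Let S_ge m w : (m < N)%N -> X m w ^+ 2 * dp m <= S m w.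
Proof.
move=> mN; rewrite /S big_ord_recr/= lerDr; apply: sumr_ge0 => i _.
by rewrite mulr_ge0 ?sqr_ge0// dp_ge0// (ltn_trans (ltn_ord i)).
Qed.

(** On an interval of positive length X_m^2 dp_m <= S_m <= e wherever Y_m is not cut to 0; on a
    degenerate interval X_m = 0 by [X0]. *)
Let Ybd m : (m < N)%N -> exists2 c, 0 <= c & forall w, `|Y m w| <= c.
Proof.
move=> mN; have := dp_ge0 mN; rewrite le_eqVlt => /predU1P[h|h].
  exists 0 => // w; rewrite /Y X0// ?mul0r ?normr0//.
  by move/eqP: h; rewrite eq_sym subr_eq0 => /eqP.
exists (Num.sqrt (e / dp m)); first exact: sqrtr_ge0.
move=> w; rewrite /Y; have [Se|] := boolP (S m w <= e); last first.
  by rewrite mulr0 normr0 sqrtr_ge0.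
rewrite mulr1 -sqrtr_sqr ler_wsqrtr// ler_pdivlMr//.
exact: le_trans (S_ge w mN) Se.
Qed.

(** If S_n <= e, the terms are compared one by one with those of S_n; otherwise the n-th term is 0
    and the induction hypothesis applies. *)
Let Ysum w : \sum_(m < N) Y m w ^+ 2 * dp m <= e.
Proof.
have H n : (n <= N)%N -> \sum_(m < n) Y m w ^+ 2 * dp m <= e.
  elim: n => [|n ih nN]; first by rewrite big_ord0 ltW.
  have [Se|Se] := boolP (S n w <= e); last first.
    by rewrite big_ord_recr/= /Y (negbTE Se) mulr0 expr0n mul0r addr0 ih// ltnW.
  apply: le_trans Se; apply: ler_sum => i _.
  have iN : (i < N)%N by rewrite (leq_ltn_trans _ nN)// -ltnS ltn_ord.
  rewrite ler_wpM2r ?dp_ge0// /Y; case: (S i w <= e); rewrite ?mulr1//.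
  by rewrite mulr0 expr0n sqr_ge0.
exact: H.
Qed.

Let X_eqY w : \sum_(m < N) X m w ^+ 2 * dp m <= e -> forall m, (m < N)%N -> Y m w = X m w.
Proof.
move=> Xe m mN; rewrite /Y (_ : S m w <= e) ?mulr1//.
apply: le_trans Xe; rewrite /S.
rewrite (big_ord_widen N (fun i => X i w ^+ 2 * dp i) mN) big_mkcond/=.
apply: ler_sum => i _; case: ifP => // _.
by rewrite mulr_ge0 ?sqr_ge0 ?dp_ge0.
Qed.

Let M m (mN : (m < N)%N) :
  [/\ sq_integrable P (dW m), \int[P]_w dW m w = 0 & \int[P]_w (dW m w ^+ 2) = dp m].
Proof.
have /andP[p0 _] := pT (ltnW mN); have /andP[_ pT1] := pT mN.
by have [] := incr_moments cF bW p0 (pS mN) pT1.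
Qed.

Let Ymeas m : (m < N)%N -> measurable_fun setT (Y m).
Proof.
move=> mN; apply: (sigma_measurable_measurable (filtration_measurable cF (pT (ltnW mN)))).
exact: mY.
Qed.

Let YbdI m Z : (m < N)%N -> integrable_rv P Z -> integrable_rv P (fun w => Y m w * Z w).
Proof.
move=> mN iZ; have [c c0 Yc] := Ybd mN.
have iZn : integrable_rv P (fun w => c * `|Z w|).
  by apply: integrable_rvZ; have := integrable_norm iZ.
apply: (le_integrable_rv _ iZn).
  by apply: measurable_funM; [exact: Ymeas|exact: integrable_rv_measurable iZ].
by move=> w; rewrite normrM ler_wpM2r.
Qed.

Let Y2 m : (m < N)%N -> integrable_rv P (fun w => Y m w ^+ 2).
Proof.
move=> mN; rewrite (_ : (fun w => _) = (fun w => Y m w * (Y m w * 1))); last first.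
  by apply/funext => w; rewrite mulr1 expr2.
by apply: YbdI => //; apply: YbdI => //; exact: integrable_rv_cst.
Qed.

Let Z m w := Y m w * dW m w.

Let Zsq m : (m < N)%N -> sq_integrable P (Z m) /\
  \int[P]_w (Z m w ^+ 2) = \int[P]_w (Y m w ^+ 2) * dp m.
Proof.
move=> mN; have [sW _ eW] := M mN.
have /andP[p0 _] := pT (ltnW mN); have /andP[_ pT1] := pT mN.
have mY2 : sigma_measurable (F (p m)) (fun w => Y m w ^+ 2).
  exact: (sigma_measurable_comp sqrM (mY mN)).
have [i1 e1] := incr_independent bW p0 (pS mN) pT1 mY2 (Y2 mN) sqrM sW.2.
have E : (fun w => Z m w ^+ 2) = (fun w => Y m w ^+ 2 * incr W (p m) (p m.+1) w ^+ 2).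
  by apply/funext => w; rewrite /Z exprMn.
rewrite E; split; last by rewrite e1 -eW.
split; last by rewrite E.
by apply: measurable_funM; [exact: Ymeas|exact: sW.1].
Qed.

(** Y_j Y_i dW_i is known at p_j and integrable, the Y being bounded; dW_j is centred and
    independent of it. *)
Let Zorth i j : (i < j < N)%N -> \int[P]_w (Z i w * Z j w) = 0.
Proof.
move=> /andP[ij jN]; have iN := ltn_trans ij jN.
have [sWi _ _] := M iN; have [sWj ej _] := M jN.
have /andP[pi0 _] := pT (ltnW iN).
have /andP[p0 pjT] := pT (ltnW jN); have /andP[_ pT1] := pT jN.
pose V w := Y j w * (Y i w * dW i w).
have mV : sigma_measurable (F (p j)) V.
  apply: (sigma_measurableM (algF jN)); first exact: mY.
  apply: (sigma_measurableM (algF jN)).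
    by apply: (sigma_measurable_filtration cF (mY iN) pi0 _ pjT); rewrite p_le// (ltnW ij) (ltnW jN).
  by apply: (incr_sigma_measurable cF bW pi0 (pS iN) _ pjT); rewrite p_le// ij (ltnW jN).
have iV : integrable_rv P V by apply: YbdI => //; apply: YbdI => //; exact: sq_integrable_integrable.
have [_ h] := incr_independent bW p0 (pS jN) pT1 mV iV (h := id) (@measurable_id _ _ _)
  (sq_integrable_integrable sWj).
rewrite -[RHS](mulr0 (\int[P]_w V w)) -ej -h; apply: eq_Rintegral => w _.
by rewrite /V /Z /dW /=; ring.
Qed.

(** [kappa] assigns each interval to one of K blocks. The isometry on every block and the
    disjointness of the blocks give E V <= e, whatever K is, and Markov's inequality applies. Where
    the energy of X is at most e the cut-off is inactive, so V is computed with X itself. *)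
Lemma step_integral_blocks : exists A : set Omega, [/\ measurable A, (P A <= (e / d)%:E)%E &
  forall w, ~ A w -> \sum_(m < N) X m w ^+ 2 * dp m <= e ->
    \sum_(k < K) (\sum_(m < N | kappa m == k) X m w * dW m w) ^+ 2 < d].
Proof.
pose Zk (k m : nat) w := Z m w *+ (kappa m == k).
have sZk k m : (m < N)%N -> sq_integrable P (Zk k m).
  by rewrite /Zk => mN; case: eqP => _; [have [] := Zsq mN|exact: sq_integrable0].
pose V w := \sum_(k < K) (\sum_(m < N) Zk k m w) ^+ 2.
have iV : integrable_rv P V.
  apply: integrable_rv_sum => k _.
  have h : sq_integrable P (fun w => \sum_(m < N) Zk k m w).
    by apply: sq_integrable_sum => m _; exact: sZk.
  exact: h.2.
have V0 w : 0 <= V w by apply: sumr_ge0 => k _; exact: sqr_ge0.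
have EV : \int[P]_w V w <= e.
  rewrite /V (expectation_sum (X := fun k w => (\sum_(m < N) Zk k m w) ^+ 2)); last first.
    move=> k _; have h : sq_integrable P (fun w => \sum_(m < N) Zk k m w).
      by apply: sq_integrable_sum => m _; exact: sZk.
    exact: h.2.
  under eq_bigr => k _.
    rewrite expectation_sq_sum_orthogonal; last 2 first.
    - by move=> m mN; exact: sZk.
    - move=> i j ij; rewrite /Zk; case: eqP => _; case: eqP => _; rewrite ?mulr0n ?mulr1n;
        first exact: Zorth.
      + by under eq_Rintegral do rewrite mulr0; rewrite expectation_cst.
      + by under eq_Rintegral do rewrite mul0r; rewrite expectation_cst.
      + by under eq_Rintegral do rewrite mul0r; rewrite expectation_cst.
    over.
  rewrite exchange_big/=.
  rewrite (eq_bigr (fun m : 'I_N => \int[P]_w (Y m w ^+ 2 * dp m))); last first.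
    move=> m _; rewrite (bigD1 (Ordinal (kappaK (ltn_ord m))))//= big1 ?addr0.
      rewrite /Zk eqxx; under eq_Rintegral do rewrite mulr1n.
      rewrite (Zsq (ltn_ord m)).2 RintegralZr//; exact: (Y2 (ltn_ord m)).
    move=> k /negP km; rewrite /Zk (_ : (kappa m == k) = false).
      by under eq_Rintegral do rewrite mulr0n expr0n/=; rewrite expectation_cst.
    by apply/negP => /eqP h; apply: km; apply/eqP/val_inj.
  have iY m : (m < N)%N -> integrable_rv P (fun w => Y m w ^+ 2 * dp m).
    by move=> mN; under eq_fun do rewrite mulrC; apply: integrable_rvZ; exact: Y2.
  rewrite -(expectation_sum (X := fun m w => Y m w ^+ 2 * dp m))//.
  rewrite -[leRHS](expectation_cst P); apply: le_Rintegral => //.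
  - by apply: (integrable_rv_sum (P := P)) => m _; exact: iY.
  - exact: integrable_rv_cst.
exists [set w | (d <= V w)%R]; split.
- by apply: measurable_superlevel; exact: integrable_rv_measurable iV.
- exact: markov_ge0 d0 iV V0 EV.
- move=> w /negP; rewrite -ltNge => Vd Xe; apply: le_lt_trans Vd.
  rewrite /V; apply: ler_sum => k _.
  rewrite le_eqVlt; apply/orP; left; apply/eqP; congr (_ ^+ 2).
  rewrite big_mkcond/=; apply: eq_bigr => m _.
  by rewrite /Zk /Z (X_eqY Xe)//; case: eqP.
Qed.

End StepIntegral.

(** * Controlled paths *)

Section UniformContinuity.
Context {R : realType}.
Variable T : R.

Lemma within_continuousM (f g : R -> R) (A : set R) :
  {within A, continuous f} -> {within A, continuous g} ->
  {within A, continuous (fun x => f x * g x)}.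
Proof. by move=> cf cg x; exact: (cvgM (cf x) (cg x)). Qed.

Lemma within_continuous_sum (A : set R) (V : normedModType R) (I : Type) (r : seq I) (f : I -> R -> V) :
  (forall i, {within A, continuous (f i)}) ->
  {within A, continuous (fun x => \sum_(i <- r) f i x)}.
Proof.
move=> cf; elim: r => [|i r ih].
  by under eq_fun do rewrite big_nil; move=> x; exact: cvg_cst.
under eq_fun do rewrite big_cons.
exact: (within_continuousD (cf i) ih).
Qed.

Lemma within_continuous_comp2 (U V : normedModType R) (A : set R) (f : R -> U) (h : U -> V) :
  {within A, continuous f} -> continuous h -> {within A, continuous (h \o f)}.
Proof. by move=> cf ch; apply: within_continuous_comp => // x _; exact: ch. Qed.

(** Uniform continuity of h near the path. The compactness is that of [0, T], V being an arbitrary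
    normed space; d is the parameter of a near covering. *)
Lemma continuous_near_path (V : normedModType R) (X : R -> V) (h : V -> R) :
  {within `[0, T], continuous X} -> continuous h ->
  forall e, 0 < e -> exists2 d, 0 < d &
    forall s z, 0 <= s <= T -> `|z - X s| < d -> `|h z - h (X s)| < e.
Proof.
move=> /subspace_continuousP cX ch e e0.
have /near_covering_withinP /(_ _ _ (fun d s => forall z, `|z - X s| < d -> `|h z - h (X s)| < e)
  (at_right_proper_filter (0 : R))) : near_covering (`[0, T] : set R).
  by apply/compact_near_coveringP; exact: segment_compact.
have e2 : 0 < e / 2 by rewrite divr_gt0.
case=> [x xT|d /= d0 H]; last first.
  exists (d / 2); first by rewrite divr_gt0.
  move=> s z sT; apply: (H (d / 2)) => //=.
  - by rewrite sub0r normrN gtr0_norm ?divr_gt0// ltr_pdivrMr// ltr_pMr// ltr1n.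
  - by rewrite divr_gt0.
have /cvgrPdist_lt/(_ _ e2) := ch (X x).
move=> /nbhs_normP[r /= r0 hr].
have r2 : 0 < r / 2 by rewrite divr_gt0.
have := cX x xT => /cvgrPdist_lt/(_ _ r2); rewrite near_withinE.
move=> nX; near=> x' d => x'T z zd.
have nX' : x' \in `[0, T] -> `|X x - X x'| < r / 2 by near: x'.
have Xx' := nX' x'T.
have dr : d < r / 2 by near: d; exact: nbhs_right_lt.
have h1 : `|h (X x) - h z| < e / 2.
  apply: hr; rewrite /= (le_lt_trans (ler_distD (X x') _ _))// [ltRHS]splitr ltrD//.
  by rewrite distrC (lt_trans zd).
have h2 : `|h (X x) - h (X x')| < e / 2.
  by apply: hr; rewrite /= (lt_le_trans Xx')// ler_pdivrMr// ler_pMr// ler1n.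
by rewrite (le_lt_trans (ler_distD (h (X x)) _ _))// [ltRHS]splitr ltrD// distrC.
Unshelve. all: by end_near.
Qed.

Lemma within_uniform_continuous (f : R -> R) :
  {within `[0, T], continuous f} ->
  forall e, 0 < e -> exists2 d, 0 < d &
    forall u v, 0 <= u <= T -> 0 <= v <= T -> `|u - v| < d -> `|f u - f v| < e.
Proof.
move=> /subspace_continuousP cf e e0.
have /near_covering_withinP /(_ _ _ (fun d u => forall v, 0 <= v <= T -> `|u - v| < d -> `|f u - f v| < e)
  (at_right_proper_filter (0 : R))) : near_covering (`[0, T] : set R).
  by apply/compact_near_coveringP; exact: segment_compact.
have e2 : 0 < e / 2 by rewrite divr_gt0.
case=> [x xT|d /= d0 H]; last first.
  exists (d / 2); first by rewrite divr_gt0.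
  move=> u v uT vT; apply: (H (d / 2)) => //=.
  - by rewrite sub0r normrN gtr0_norm ?divr_gt0// ltr_pdivrMr// ltr_pMr// ltr1n.
  - by rewrite divr_gt0.
have := cf x xT => /cvgrPdist_lt/(_ _ e2); rewrite near_withinE.
move=> /nbhs_normP[r /= r0 hr].
have r2 : 0 < r / 2 by rewrite divr_gt0.
near=> x' d => x'T v vT vd.
have xx' : `|x - x'| < r / 2 by near: x'; exact: cvgr_dist_lt.
have dr : d < r / 2 by near: d; exact: nbhs_right_lt.
have h1 : `|f x - f v| < e / 2.
  apply: hr; last by rewrite in_itv.
  by rewrite /= (le_lt_trans (ler_distD x' _ _))// [ltRHS]splitr ltrD// (lt_trans vd).
have h2 : `|f x - f x'| < e / 2.
  by apply: hr => //; rewrite /= (lt_le_trans xx')// ler_pdivrMr// ler_pMr// ler1n.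
by rewrite (le_lt_trans (ler_distD (f x) _ _))// [ltRHS]splitr ltrD// distrC.
Unshelve. all: by end_near.
Qed.

Lemma within_continuous_bounded (f : R -> R) :
  {within `[0, T], continuous f} -> exists2 K, 0 < K & forall u, 0 <= u <= T -> `|f u| <= K.
Proof.
move=> cf; have [T0|T0] := leP 0 T; last first.
  by exists 1 => // u /andP[u0 uT]; have := le_lt_trans (le_trans u0 uT) T0; rewrite ltxx.
have := compact_bounded (continuous_compact cf (@segment_compact _ 0 T)).
move=> [M [_ /(_ (M + 1)) H]]; exists (`|M| + 1); first by rewrite ltr_wpDl.
move=> u uT; apply: (le_trans (H _ (f u) _)); first by rewrite ltrDl.
- by exists u.
- by rewrite lerD2r ler_norm.
Qed.

Lemma uniform_continuous_within (f : R -> R) :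
  (forall u e, 0 <= u <= T -> 0 < e -> exists2 d, 0 < d &
    forall v, 0 <= v <= T -> `|u - v| < d -> `|f u - f v| < e) ->
  {within `[0, T], continuous f}.
Proof.
move=> H; apply/subspace_continuousP => x xT; apply/cvgrPdist_lt => e e0.
have [d d0 hd] := H x e xT e0.
rewrite near_withinE; apply/nbhs_normP; exists d => //= y xy yT; exact: hd.
Qed.

End UniformContinuity.

Lemma cvg_sumr {R : realType} {T : Type} {F : set_system T} {FF : Filter F} (I : Type) (r : seq I)
  (f : I -> T -> R) (a : I -> R) : (forall i, f i x @[x --> F] --> a i) ->
  \sum_(i <- r) f i x @[x --> F] --> \sum_(i <- r) a i.
Proof.
move=> fa; elim: r => [|i r ih].
  by under eq_fun do rewrite big_nil; rewrite big_nil; exact: cvg_cst.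
under eq_fun do rewrite big_cons.
by rewrite big_cons; exact: cvgD.
Qed.

Section RiemannSum.
Context {R : realType}.
Variable T : R.
Local Notation mu := (@lebesgue_measure R).
Variable f : R -> R.
Hypothesis cf : {within `[0, T], continuous f}.

Lemma integrable_subitv (u v : itv_bound R) : (BLeft 0 <= u)%O -> (v <= BRight T)%O ->
  mu.-integrable [set` Interval u v] (EFin \o f).
Proof.
move=> u0 vT; apply: (@integrableS _ _ _ mu `[0, T]) => //.
  by apply: subset_itvScc.
exact: continuous_compact_integrable (@segment_compact _ _ _) cf.
Qed.

Lemma integral_increment u v : 0 <= u -> u <= v -> v <= T ->
  \int[mu]_(x in `[0, v]) f x - \int[mu]_(x in `[0, u]) f x = \int[mu]_(x in `]u, v]) f x.
Proof.
move=> u0 uv vT; apply: Rintegral_itvB; rewrite ?bnd_simp//.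
by apply: integrable_subitv; rewrite bnd_simp.
Qed.

Lemma integrable_itv_cst u v (c : R) : mu.-integrable `]u, v] (EFin \o (fun=> c)).
Proof.
apply: (@integrableS _ _ _ mu `[u, v]) => //.
  exact: subset_itv_oc_cc.
apply: continuous_compact_integrable; first exact: segment_compact.
by move=> x; exact: cvg_cst.
Qed.

Lemma Rintegral_itv_cst u v (c : R) : u <= v -> \int[mu]_(x in `]u, v]) c = c * (v - u).
Proof.
move=> uv; rewrite Rintegral_cst//; congr (_ * _).
suff : mu `]u, v] = (v - u)%:E by move/(congr1 fine).
rewrite lebesgue_measure_itv/= lte_fin.
have [uv'|vu] := ltP u v; first by rewrite -EFinB.
by congr EFin; apply/esym/eqP; rewrite subr_eq0 eq_le uv vu.
Qed.

Lemma integral_increment_le K u v : 0 <= u -> u <= v -> v <= T ->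
  (forall x, u <= x <= v -> `|f x| <= K) ->
  `|\int[mu]_(x in `[0, v]) f x - \int[mu]_(x in `[0, u]) f x| <= K * (v - u).
Proof.
move=> u0 uv vT fK; rewrite integral_increment//.
have fi : mu.-integrable `]u, v] (EFin \o f).
  by apply: integrable_subitv; rewrite bnd_simp.
apply: (le_trans (le_normr_Rintegral _ fi)) => //.
rewrite -Rintegral_itv_cst//; apply: le_Rintegral => //.
- by have := integrable_norm fi.
- exact: integrable_itv_cst.
- by move=> x /=; rewrite in_itv/= => /andP[ux xv]; apply: fK; rewrite (ltW ux).
Qed.

Lemma integral_increment_approx e u v : 0 <= u -> u <= v -> v <= T ->
  (forall x, u <= x <= v -> `|f x - f u| <= e) ->
  `|\int[mu]_(x in `[0, v]) f x - \int[mu]_(x in `[0, u]) f x - f u * (v - u)| <= e * (v - u).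
Proof.
move=> u0 uv vT fK; rewrite integral_increment//.
have fi : mu.-integrable `]u, v] (EFin \o f).
  by apply: integrable_subitv; rewrite bnd_simp.
rewrite -!Rintegral_itv_cst// -RintegralB//; last exact: integrable_itv_cst.
have fci : mu.-integrable `]u, v] (EFin \o (fun x => f x - f u)).
  exact: (integrableB _ fi (integrable_itv_cst u v (f u))).
apply: (le_trans (le_normr_Rintegral _ fci)) => //.
apply: le_Rintegral => //.
- by have := integrable_norm fci.
- exact: integrable_itv_cst.
- by move=> x /=; rewrite in_itv/= => /andP[ux xv]; apply: fK; rewrite (ltW ux).
Qed.

End RiemannSum.

(** * Sums along a sequence of grids *)

Section Grid.
Context {R : realType}.
Variables (T t : R) (N : nat -> nat) (p : nat -> nat -> R).
Local Notation mu := (@lebesgue_measure R).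

(** Knots may coincide, so that stopped partitions qualify. The grid ends at t, but knots are
    located in [0, T], the interval on which the paths are continuous. *)
Definition fine_grid := [/\ forall n, p n 0%N = 0, forall n, p n (N n) = t,
  forall n k, (k <= N n)%N -> 0 <= p n k <= T,
  forall n k, (k < N n)%N -> p n k <= p n k.+1 &
  forall d, 0 < d -> \forall n \near \oo, forall k, (k < N n)%N -> p n k.+1 - p n k < d].
Hypothesis pP : fine_grid.

Definition vanishing (D : nat -> nat -> R) :=
  forall e, 0 < e -> \forall n \near \oo, \sum_(k < N n) D n k ^+ 2 < e.

Definition square_bounded (D : nat -> nat -> R) :=
  exists K, \forall n \near \oo, \sum_(k < N n) D n k ^+ 2 <= K.

Definition grid_incr (f : R -> R) (n k : nat) : R := f (p n k.+1) - f (p n k).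
Local Notation d := grid_incr.

Let pT n k : (k <= N n)%N -> 0 <= p n k <= T. Proof. by case: pP => _ _ + _ _; apply. Qed.
Let pS n k : (k < N n)%N -> p n k <= p n k.+1. Proof. by case: pP => _ _ _ + _; apply. Qed.

Lemma grid_sum n : \sum_(k < N n) (p n k.+1 - p n k) = t.
Proof.
case: pP => p0 pt _ _ _.
by rewrite -(big_mkord xpredT (fun k => p n k.+1 - p n k)) telescope_sumr// p0 pt subr0.
Qed.

Lemma vanishingD D E : vanishing D -> vanishing E -> vanishing (fun n k => D n k + E n k).
Proof.
move=> vD vE e e0; have e4 : 0 < e / 4 by rewrite divr_gt0.
near=> n.
apply: (@le_lt_trans _ _ (2 * \sum_(k < N n) D n k ^+ 2 + 2 * \sum_(k < N n) E n k ^+ 2)).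
  rewrite !mulr_sumr -big_split/=; apply: ler_sum => k _.
  by have := sqr_ge0 (D n k - E n k); lra.
have : \sum_(k < N n) D n k ^+ 2 < e / 4 by near: n; exact: vD.
have : \sum_(k < N n) E n k ^+ 2 < e / 4 by near: n; exact: vE.
lra.
Unshelve. all: by end_near.
Qed.

Lemma vanishing_small D E : square_bounded D ->
  (forall e, 0 < e -> \forall n \near \oo, forall k, (k < N n)%N -> `|E n k| <= e * `|D n k|) ->
  vanishing E.
Proof.
move=> [K DK] ED e e0.
pose K1 := `|K| + 1; have K10 : 0 < K1 by rewrite ltr_wpDl.
pose r := Num.sqrt (e / (2 * K1)).
have r2 : r ^+ 2 = e / (2 * K1) by rewrite sqr_sqrtr// divr_ge0 ?mulr_ge0 ?(ltW e0) ?(ltW K10).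
have r0 : 0 < r by rewrite sqrtr_gt0 divr_gt0 ?mulr_gt0.
near=> n.
have hK : \sum_(k < N n) D n k ^+ 2 <= K by near: n.
have hE : forall k, (k < N n)%N -> `|E n k| <= r * `|D n k| by near: n; exact: ED.
apply: (@le_lt_trans _ _ (r ^+ 2 * \sum_(k < N n) D n k ^+ 2)).
  rewrite mulr_sumr; apply: ler_sum => k _.
  rewrite -(real_normK (num_real (E n k))) -(real_normK (num_real (D n k))) -exprMn.
  by rewrite lerXn2r ?nnegrE ?mulr_ge0 ?hE// ltW.
apply: (@le_lt_trans _ _ (r ^+ 2 * K1)).
  by rewrite ler_wpM2l ?sqr_ge0// (le_trans hK)// (le_trans (ler_norm _))// lerDl.
rewrite r2 -mulrA invfM -mulrA mulVf ?gt_eqF// mulr1.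
by rewrite ltr_pdivrMr// ltr_pMr// ltr1n.
Unshelve. all: by end_near.
Qed.

Lemma vanishing_le D E M : vanishing D ->
  (forall n k, (k < N n)%N -> `|E n k| <= M * `|D n k|) -> vanishing E.
Proof.
move=> vD ED e e0.
pose M1 := `|M| + 1; have M10 : 0 < M1 by rewrite ltr_wpDl.
have r0 : 0 < e / M1 ^+ 2 by rewrite divr_gt0 ?exprn_gt0.
near=> n.
have hD : \sum_(k < N n) D n k ^+ 2 < e / M1 ^+ 2 by near: n; exact: vD.
apply: (@le_lt_trans _ _ (M1 ^+ 2 * \sum_(k < N n) D n k ^+ 2)); last first.
  by rewrite mulrC -ltr_pdivlMr// exprn_gt0.
rewrite mulr_sumr; apply: ler_sum => k _.
rewrite -(real_normK (num_real (E n k))) -(real_normK (num_real (D n k))) -exprMn.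
rewrite lerXn2r ?nnegrE ?mulr_ge0 ?(ltW M10)//.
rewrite (le_trans (ED n k _))// ler_wpM2r//.
by rewrite (le_trans (ler_norm _))// lerDl.
Unshelve. all: by end_near.
Qed.

Lemma vanishing_square_bounded D : vanishing D -> square_bounded D.
Proof. by move=> vD; exists 1; apply: filterS (vD 1 ltr01) => n /ltW. Qed.

Lemma square_boundedD D E : square_bounded D -> square_bounded E ->
  square_bounded (fun n k => D n k + E n k).
Proof.
move=> [K DK] [L EL]; exists (2 * K + 2 * L); near=> n.
have hK : \sum_(k < N n) D n k ^+ 2 <= K by near: n.
have hL : \sum_(k < N n) E n k ^+ 2 <= L by near: n.
apply: (@le_trans _ _ (2 * \sum_(k < N n) D n k ^+ 2 + 2 * \sum_(k < N n) E n k ^+ 2)); last lra.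
rewrite !mulr_sumr -big_split/=; apply: ler_sum => k _.
by have := sqr_ge0 (D n k - E n k); lra.
Unshelve. all: by end_near.
Qed.

Lemma square_bounded_le D E M : square_bounded D ->
  (forall n k, (k < N n)%N -> `|E n k| <= M * `|D n k|) -> square_bounded E.
Proof.
move=> [K DK] ED; exists (M ^+ 2 * K); near=> n.
have hK : \sum_(k < N n) D n k ^+ 2 <= K by near: n.
apply: (@le_trans _ _ (M ^+ 2 * \sum_(k < N n) D n k ^+ 2)); last by rewrite ler_wpM2l ?sqr_ge0.
rewrite mulr_sumr; apply: ler_sum => k _.
rewrite -(real_normK (num_real (E n k))) -(real_normK (num_real (D n k))) -exprMn.
rewrite lerXn2r ?nnegrE ?ED//.
exact: le_trans (ED n k _).
Unshelve. all: by end_near.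
Qed.

Lemma vanishing_sum_mul D E : vanishing D -> square_bounded E ->
  \sum_(k < N n) D n k * E n k @[n --> \oo] --> 0.
Proof.
move=> vD [K EK]; apply/cvgrPdist_lt => e e0.
pose K1 := `|K| + 1; have K10 : 0 < K1 by rewrite ltr_wpDl.
(* Young's inequality with weight l, 2 |D E| <= D^2 / l + l E^2; the choice l K1 = e balances the
   two sums. *)
pose l := e / K1; have l0 : 0 < l by rewrite divr_gt0.
have le0 : 0 < l * e by rewrite mulr_gt0.
near=> n; rewrite sub0r normrN.
have hK : \sum_(k < N n) E n k ^+ 2 <= K by near: n.
have hD : \sum_(k < N n) D n k ^+ 2 < l * e by near: n; exact: vD.
apply: (le_lt_trans (ler_norm_sum _ _ _)).
apply: (@le_lt_trans _ _ (2^-1 * (l^-1 * \sum_(k < N n) D n k ^+ 2 + l * \sum_(k < N n) E n k ^+ 2))).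
  rewrite !mulr_sumr -big_split/= mulr_sumr; apply: ler_sum => k _.
  rewrite normrM -(real_normK (num_real (E n k))) -(real_normK (num_real (D n k))).
  rewrite -subr_ge0 (_ : _ - _ = 2^-1 * l^-1 * (`|D n k| - l * `|E n k|) ^+ 2); last first.
    by field; rewrite gt_eqF.
  apply: mulr_ge0; last exact: sqr_ge0.
  by rewrite divr_ge0 ?invr_ge0// ltW.
have h1 : l^-1 * \sum_(k < N n) D n k ^+ 2 < e by rewrite mulrC ltr_pdivrMr// mulrC.
have h2 : l * \sum_(k < N n) E n k ^+ 2 <= e.
  rewrite mulrC -ler_pdivlMr// /l invf_div mulrCA divff ?gt_eqF// mulr1.
  by rewrite (le_trans hK)// (le_trans (ler_norm _))// lerDl.
lra.
Unshelve. all: by end_near.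
Qed.

Lemma grid_incr_small (f : R -> R) : {within `[0, T], continuous f} ->
  forall e, 0 < e -> \forall n \near \oo, forall k, (k < N n)%N -> `|d f n k| < e.
Proof.
move=> cf e e0; have [r r0 fr] := within_uniform_continuous cf e0.
case: pP => _ _ _ _ /(_ r r0); apply: filterS => n H k kN.
apply: fr; [exact: pT|exact/pT/ltnW|].
by rewrite ger0_norm ?subr_ge0 ?pS ?H.
Qed.

Lemma riemann_sum_cvg (f : R -> R) : {within `[0, T], continuous f} ->
  \sum_(k < N n) f (p n k) * (p n k.+1 - p n k) @[n --> \oo] -->
  \int[mu]_(x in `[0, t]) f x.
Proof.
move=> cf; case: pP => p0 pt _ _ mesh0; apply/cvgrPdist_lt => e e0.
have t0 : 0 <= t by rewrite -(pt 0%N); have /andP[] := @pT 0%N (N 0%N) (leqnn _).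
pose K := t + 1; have K0 : 0 < K by rewrite ltr_wpDl.
have eK : 0 < e / K by rewrite divr_gt0.
have [r r0 fr] := within_uniform_continuous cf eK.
have := mesh0 r r0; apply: filterS => n H.
pose C u := \int[mu]_(x in `[0, u]) f x.
have -> : \int[mu]_(x in `[0, t]) f x = \sum_(k < N n) (C (p n k.+1) - C (p n k)).
  rewrite -(big_mkord xpredT (fun k => C (p n k.+1) - C (p n k))) telescope_sumr// p0 pt.
  by rewrite /C set_itv1 Rintegral_set1 subr0.
rewrite -sumrB (le_lt_trans (ler_norm_sum _ _ _))//.
apply: (@le_lt_trans _ _ (\sum_(k < N n) (e / K * (p n k.+1 - p n k)))).
  apply: ler_sum => k _; apply: (integral_increment_approx cf).
  - by have /andP[] := pT (ltnW (ltn_ord k)).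
  - exact: pS.
  - by have /andP[] := pT (ltn_ord k).
  - move=> x /andP[ux xv]; apply/ltW/fr.
    + have /andP[_ h] := pT (ltn_ord k); have /andP[h' _] := pT (ltnW (ltn_ord k)).
      by rewrite (le_trans h')//= (le_trans xv).
    + exact: pT (ltnW (ltn_ord k)).
    + rewrite ger0_norm ?subr_ge0//; apply: le_lt_trans (H k (ltn_ord k)).
      by rewrite lerD2r.
rewrite -mulr_sumr grid_sum mulrAC ltr_pdivrMr// ltr_pM2l//.
by rewrite ltrDl.
Qed.

(** Freezing f at the left ends of the time blocks [i/M, (i+1)/M) leaves finitely many block sums of
    D, each tending to 0. The replacement costs at most the oscillation of f over a length 1/M times
    the bound on sum |D|. *)
Lemma weighted_sum_cvg0 (D : nat -> nat -> R) (f : R -> R) :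
  {within `[0, T], continuous f} ->
  (exists K, \forall n \near \oo, \sum_(k < N n) `|D n k| <= K) ->
  (forall M i : nat, \sum_(k < N n | Num.truncn (p n k * M%:R) == i) D n k @[n --> \oo] --> 0) ->
  \sum_(k < N n) f (p n k) * D n k @[n --> \oo] --> 0.
Proof.
move=> cf [K DK] D0; apply/cvgrPdist_lt => e e0.
pose K1 := `|K| + 1; have K10 : 0 < K1 by rewrite ltr_wpDl.
have eK : 0 < e / 2 / K1 by rewrite !divr_gt0.
have [r r0 fr] := within_uniform_continuous cf eK.
pose M := (Num.truncn r^-1).+1.
have M0 : 0 < M%:R :> R by rewrite ltr0n.
have Mr : M%:R^-1 < r by rewrite invf_plt ?posrE// truncnS_gt.
(* L blocks cover [0, T], as truncn (p M) <= truncn (T M) < L for every knot p. *)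
pose L := (Num.truncn (T * M%:R)).+1.
have S0 : \sum_(i < L) f (i%:R / M%:R) *
    (\sum_(k < N n | Num.truncn (p n k * M%:R) == i) D n k) @[n --> \oo] --> 0.
  have := @cvg_sumr _ _ \oo _ _ (index_enum 'I_L) (fun i n => f (i%:R / M%:R) *
    (\sum_(k < N n | Num.truncn (p n k * M%:R) == i) D n k)) (fun i => f (i%:R / M%:R) * 0).
  rewrite [X in _ --> X]big1; last by move=> i _; rewrite mulr0.
  by apply=> i; apply: cvgM; [exact: cvg_cst|exact: D0].
have e2 : 0 < e / 2 by rewrite divr_gt0.
move/cvgrPdist_lt : S0 => /(_ _ e2) S0.
near=> n; rewrite sub0r normrN.
have hK : \sum_(k < N n) `|D n k| <= K by near: n.
have : `|0 - \sum_(i < L) f (i%:R / M%:R) *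
    (\sum_(k < N n | Num.truncn (p n k * M%:R) == i) D n k)| < e / 2 by near: n.
rewrite sub0r normrN.
have -> : \sum_(i < L) f (i%:R / M%:R) *
    (\sum_(k < N n | Num.truncn (p n k * M%:R) == i) D n k) =
    \sum_(k < N n) f ((Num.truncn (p n k * M%:R))%:R / M%:R) * D n k.
  under eq_bigr do rewrite mulr_sumr big_mkcond/=.
  rewrite exchange_big/=; apply: eq_bigr => k _.
  have kL : (Num.truncn (p n k * M%:R) < L)%N.
    have /andP[h1 h2] := pT (ltnW (ltn_ord k)).
    by rewrite /L ltnS le_truncn// ler_wpM2r.
  rewrite (bigD1 (Ordinal kL))//= eqxx big1 ?addr0// => i /negP ik.
  by case: ifPn => // /eqP h; exfalso; apply: ik; apply/eqP/val_inj; rewrite /= h.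
move=> h.
rewrite -[X in `|X|](subrK (\sum_(k < N n) f ((Num.truncn (p n k * M%:R))%:R / M%:R) * D n k)).
rewrite (le_lt_trans (ler_normD _ _))// [ltRHS]splitr ler_ltD//.
rewrite -sumrB (le_trans (ler_norm_sum _ _ _))//.
apply: (@le_trans _ _ (\sum_(k < N n) e / 2 / K1 * `|D n k|)).
  apply: ler_sum => k _; rewrite -mulrBl normrM ler_wpM2r//.
  have /andP[h1 h2] := pT (ltnW (ltn_ord k)).
  have /andP[t1 t2] : (Num.truncn (p n k * M%:R))%:R <= p n k * M%:R < (Num.truncn (p n k * M%:R)).+1%:R.
    by apply: truncn_itv; rewrite mulr_ge0.
  have q1 : (Num.truncn (p n k * M%:R))%:R / M%:R <= p n k by rewrite ler_pdivrMr.
  have q2 : p n k < (Num.truncn (p n k * M%:R))%:R / M%:R + M%:R^-1.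
    by rewrite -[X in _ + X]mul1r -mulrDl ltr_pdivlMr// natr1.
  apply/ltW/fr; rewrite ?h1//.
  - by rewrite divr_ge0//= (le_trans q1).
  - rewrite ger0_norm ?subr_ge0//; apply: lt_trans Mr.
    by rewrite ltrBlDl.
rewrite -mulr_sumr mulrAC ler_pdivrMr// ler_wpM2l ?ltW//.
by rewrite (le_lt_trans hK)// (le_lt_trans (ler_norm _))// ltrDl.
Unshelve. all: by end_near.
Qed.

End Grid.

(** * First-order expansion with directional derivatives *)

Section DirectionalTaylor.
Context {R : realType} {V : normedModType R}.
Implicit Types (h : V -> R) (e x : V).

Lemma is_derive_line h e x (s : R) : derivable h (x + s *: e) e ->
  is_derive s 1 (fun r : R => h (x + r *: e)) ('D_e h (x + s *: e)).
Proof.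
move=> dh.
have E : (fun r => r^-1 *: (h (x + (r *: 1 + s) *: e) - h (x + s *: e))) =
    (fun r => r^-1 *: (h (r *: e + (x + s *: e)) - h (x + s *: e))).
  apply/funext => r; congr (_ *: (h _ - _)).
  by rewrite [_ *: 1]mulr1 scalerDl addrCA.
apply: DeriveDef.
  by rewrite /derivable /= E.
by rewrite /derive /= E.
Qed.

Lemma line_mean_value h e : (forall x, derivable h x e) -> forall x (c : R),
  exists2 r, `|r| <= `|c| & h (x + c *: e) - h x = 'D_e h (x + r *: e) * c.
Proof.
move=> dh x c; pose g (r : R) := h (x + r *: e).
have dg (r : R) : is_derive r 1 g ('D_e h (x + r *: e)) by exact: is_derive_line.
have cg : continuous g.
  by move=> r; apply: differentiable_continuous; apply/derivable1_diffP; exact: (@ex_derive _ _ _ _ _ _ _ (dg r)).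
have g0 : g 0 = h x by rewrite /g scale0r addr0.
have [c0|c0] := leP 0 c.
  have [r] := @MVT_segment _ g (fun r => 'D_e h (x + r *: e)) _ _ c0 (fun r _ => dg r) (continuous_subspaceT cg).
  rewrite in_itv/= g0 subr0 => /andP[r0 rc] E; exists r => //.
  by rewrite !ger0_norm.
have [r] := @MVT_segment _ g (fun r => 'D_e h (x + r *: e)) _ _ (ltW c0) (fun r _ => dg r) (continuous_subspaceT cg).
rewrite in_itv/= g0 sub0r => /andP[rc r0] E; exists r.
  by rewrite !ler0_norm ?lerN2// ltW.
by apply: oppr_inj; rewrite opprB E mulrN.
Qed.

(** The displacements are added one at a time and the mean value theorem is applied along each
    direction; all intermediate points stay within the radius of the hypothesis. *)
Lemma taylor_sum (I : Type) (e : I -> V) h (x : V) (c : I -> R) (eps : R) (r : seq I) :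
  (forall i x, derivable h x (e i)) ->
  (forall i z, `|z - x| <= \sum_(j <- r) `|c j| * `|e j| ->
     `|'D_(e i) h z - 'D_(e i) h x| <= eps) ->
  `|h (x + \sum_(i <- r) c i *: e i) - h x - \sum_(i <- r) 'D_(e i) h x * c i| <=
    eps * \sum_(i <- r) `|c i|.
Proof.
move=> dh; elim: r => [|a r ih] H.
  by rewrite !big_nil addr0 !subrr normr0 mulr0.
rewrite !big_cons.
have [] := line_mean_value (dh a) (x + \sum_(i <- r) c i *: e i) (c a).
move=> q qc; rewrite -addrA [_ + c a *: e a]addrC => E.
set S := \sum_(i <- r) _ *: _ in E *.
rewrite (_ : _ - _ = (h (x + (c a *: e a + S)) - h (x + S) - 'D_(e a) h x * c a) +
  (h (x + S) - h x - \sum_(i <- r) 'D_(e i) h x * c i)); last by ring.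
rewrite mulrDr (le_trans (ler_normD _ _))// lerD//.
  rewrite E -mulrBl normrM ler_wpM2r// H// big_cons.
  rewrite (_ : _ - x = q *: e a + S); last by rewrite addrC !addrA addNr add0r addrC.
  rewrite (le_trans (ler_normD _ _))// lerD//.
    by rewrite normrZ ler_wpM2r.
  rewrite (le_trans (ler_norm_sum _ _ _))//; apply: ler_sum => i _.
  by rewrite normrZ.
apply: ih => i z zx; apply: H; rewrite big_cons (le_trans zx)// lerDr.
by rewrite mulr_ge0.
Qed.

End DirectionalTaylor.

Section Controlled.
Context {R : realType}.
Variables (T t : R) (N : nat -> nat) (p : nat -> nat -> R).
Hypothesis pP : fine_grid T t N p.
Local Notation d := (grid_incr p).
Variables W B : R -> R.
Hypotheses (sW : square_bounded N (d W)) (sB : square_bounded N (d B)).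

(* First-order expansion of the increments of f along the grids in terms of
   those of W and B, with an error that is negligible in the square mean. *)
Definition controlled (f w b : R -> R) :=
  [/\ {within `[0, T], continuous f}, {within `[0, T], continuous w},
      {within `[0, T], continuous b} &
      vanishing N (fun n k => d f n k - w (p n k) * d W n k - b (p n k) * d B n k)].

Let pT n k : (k <= N n)%N -> 0 <= p n k <= T. Proof. by case: pP => _ _ + _ _; apply. Qed.
Let pS n k : (k < N n)%N -> p n k <= p n k.+1. Proof. by case: pP => _ _ _ + _; apply. Qed.

Lemma square_bounded_mul (f : R -> R) D : {within `[0, T], continuous f} ->
  square_bounded N D -> square_bounded N (fun n k => f (p n k) * D n k).
Proof.
move=> cf sD; have [K K0 fK] := within_continuous_bounded cf.
apply: (square_bounded_le (M := K) sD) => n k kN.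
by rewrite normrM ler_wpM2r// fK// pT// ltnW.
Qed.

Lemma vanishing_mul (f : R -> R) D : {within `[0, T], continuous f} ->
  vanishing N D -> vanishing N (fun n k => f (p n k) * D n k).
Proof.
move=> cf sD; have [K K0 fK] := within_continuous_bounded cf.
apply: (vanishing_le (M := K) sD) => n k kN.
by rewrite normrM ler_wpM2r// fK// pT// ltnW.
Qed.

Lemma eq_vanishing (D E : nat -> nat -> R) : (forall n k, D n k = E n k) -> vanishing N D -> vanishing N E.
Proof. by move=> DE vD e /vD; apply: filterS => n; under eq_bigr do rewrite DE. Qed.

Lemma vanishing0 : vanishing N (fun _ _ => 0 : R).
Proof. by move=> e e0; apply: nearW => n; rewrite big1// => k _; rewrite expr0n. Qed.

Lemma vanishing_sum (I : Type) (r : seq I) (D : I -> nat -> nat -> R) :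
  (forall i, vanishing N (D i)) -> vanishing N (fun n k => \sum_(i <- r) D i n k).
Proof.
move=> vD; elim: r => [|i r ih].
  by apply: eq_vanishing vanishing0 => n k; rewrite big_nil.
by apply: eq_vanishing (vanishingD (vD i) ih) => n k; rewrite big_cons.
Qed.

Lemma square_bounded_sum (I : Type) (r : seq I) (D : I -> nat -> nat -> R) :
  (forall i, square_bounded N (D i)) -> square_bounded N (fun n k => \sum_(i <- r) D i n k).
Proof.
move=> vD; elim: r => [|i r ih].
  exists 0; apply: nearW => n; rewrite big1// => k _; rewrite big_nil expr0n//.
have [K H] := square_boundedD (vD i) ih; exists K.
by apply: filterS H => n; under [X in _ -> X <= _]eq_bigr do rewrite big_cons.
Qed.

Lemma controlled_square_bounded f w b : controlled f w b -> square_bounded N (d f).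
Proof.
case=> cf cw cb v.
have := square_boundedD (square_boundedD (vanishing_square_bounded v)
  (square_bounded_mul cw sW)) (square_bounded_mul cb sB).
move=> [K H]; exists K; apply: filterS H => n.
rewrite (eq_bigr (fun k : 'I_(N n) => d f n k ^+ 2))// => k _.
by congr (_ ^+ 2); ring.
Qed.

Lemma controlledD f w b f' w' b' : controlled f w b -> controlled f' w' b' ->
  controlled (fun x => f x + f' x) (fun x => w x + w' x) (fun x => b x + b' x).
Proof.
case=> cf cw cb v [cf' cw' cb' v']; split; try exact: within_continuousD.
apply: eq_vanishing (vanishingD v v') => n k; rewrite /grid_incr; ring.
Qed.

Lemma controlled0 : controlled (fun=> 0) (fun=> 0) (fun=> 0).
Proof.
by split; try (by move=> x; exact: cvg_cst); apply: eq_vanishing vanishing0 => n k;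
  rewrite /grid_incr subrr !mul0r !subr0.
Qed.

Lemma controlled_sum (I : Type) (r : seq I) (f w b : I -> R -> R) :
  (forall i, controlled (f i) (w i) (b i)) ->
  controlled (fun x => \sum_(i <- r) f i x) (fun x => \sum_(i <- r) w i x)
    (fun x => \sum_(i <- r) b i x).
Proof.
move=> H; elim: r => [|i r ih].
  have E (g : I -> R -> R) : (fun x : R => \sum_(i <- [::]) g i x) = fun=> 0.
    by apply/funext => x; rewrite big_nil.
  by rewrite !E; exact: controlled0.
have E (g : I -> R -> R) : (fun x : R => \sum_(j <- i :: r) g j x) = (fun x => g i x + \sum_(j <- r) g j x).
  by apply/funext => x; rewrite big_cons.
by rewrite !E; exact: controlledD.
Qed.

(** d(f f') = f' df + f df' + df df', where the last term is negligible: df tends to 0 uniformly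
    while sum df'^2 stays bounded. *)
Lemma controlledM f w b f' w' b' : controlled f w b -> controlled f' w' b' ->
  controlled (fun x => f x * f' x) (fun x => f' x * w x + f x * w' x)
    (fun x => f' x * b x + f x * b' x).
Proof.
move=> cf1 cf2; have sf' := controlled_square_bounded cf2; have := cf2; have := cf1.
case=> cf cw cb v [cf' cw' cb' v']; split.
- exact: within_continuousM.
- by apply: within_continuousD; exact: within_continuousM.
- by apply: within_continuousD; exact: within_continuousM.
have v1 := vanishingD (vanishing_mul cf' v) (vanishing_mul cf v').
have v2 : vanishing N (fun n k => d f n k * d f' n k).
  apply: (vanishing_small sf') => e e0; apply: filterS (grid_incr_small pP cf e0) => n H k kN.
  by rewrite normrM ler_wpM2r// ltW// H.
apply: eq_vanishing (vanishingD v1 v2) => n k; rewrite /grid_incr; ring.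
Qed.

(** sum df^2 <= max |df| sum |df|. *)
Lemma vanishing_variation f (K : R) : {within `[0, T], continuous f} ->
  (forall n, \sum_(k < N n) `|d f n k| <= K) -> vanishing N (d f).
Proof.
move=> cf fK e e0; pose K1 := `|K| + 1; have K10 : 0 < K1 by rewrite ltr_wpDl.
have eK : 0 < e / K1 by rewrite divr_gt0.
apply: filterS (grid_incr_small pP cf eK) => n H.
apply: (@le_lt_trans _ _ (e / K1 * \sum_(k < N n) `|d f n k|)).
  rewrite mulr_sumr; apply: ler_sum => k _.
  by rewrite -(real_normK (num_real (d f n k))) expr2 ler_wpM2r// ltW// H.
rewrite mulrAC ltr_pdivrMr// ltr_pM2l//.
by rewrite (le_lt_trans (fK n))// (le_lt_trans (ler_norm _))// ltrDl.
Qed.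

Lemma grid_variation_lipschitz f (K : R) :
  (forall u v, 0 <= u -> u <= v -> v <= T -> `|f v - f u| <= K * (v - u)) ->
  forall n, \sum_(k < N n) `|d f n k| <= K * t.
Proof.
move=> fK n; rewrite -(grid_sum pP n) mulr_sumr; apply: ler_sum => k _.
apply: fK; last by have /andP[] := pT (ltn_ord k).
- by have /andP[] := pT (ltnW (ltn_ord k)).
- exact: pS.
Qed.

Lemma grid_variation_monotone f : {in `[0, T] &, {homo f : x y / x <= y}} ->
  forall n, \sum_(k < N n) `|d f n k| = f t - f 0.
Proof.
move=> fm n; case: pP => p0 pt _ _ _.
have -> : f t - f 0 = f (p n (N n)) - f (p n 0%N) by rewrite p0 pt.
rewrite -(telescope_sumr (fun k => f (p n k)))// big_mkord; apply: eq_bigr => k _.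
rewrite ger0_norm// subr_ge0 fm ?in_itv/=; [by []|exact: pT (ltnW (ltn_ord k))|exact: pT (ltn_ord k)|exact: pS].
Qed.

(** Jordan decomposition: f is the difference of its positive and negative variations, whose
    increments telescope. *)
Lemma grid_variation_bounded f : bounded_variation 0 T f ->
  exists K, forall n, \sum_(k < N n) `|d f n k| <= K.
Proof.
move=> bf; have E := bounded_variation_pos_neg_tvE bf.
have m1 := fine_neg_tv_nondecreasing bf.
have m2 := fine_neg_tv_nondecreasing (bounded_variationN bf).
pose g1 := fine \o neg_tv 0 f; pose g2 := fine \o pos_tv 0 f.
exists ((g2 t - g2 0) + (g1 t - g1 0)) => n.
rewrite -(grid_variation_monotone m1 n) -(grid_variation_monotone m2 n) -big_split/=.
apply: ler_sum => k _.
have i1 : p n k \in `[0, T] by rewrite in_itv/=; exact: pT (ltnW (ltn_ord k)).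
have i2 : p n k.+1 \in `[0, T] by rewrite in_itv/=; exact: pT (ltn_ord k).
rewrite [in leLHS]/grid_incr (E _ i1) (E _ i2)/=.
rewrite (_ : _ - _ = d g2 n k - d g1 n k); last by rewrite /grid_incr/= /g1 /g2 /=; ring.
by rewrite (le_trans (ler_normB _ _)).
Qed.

(** Once the increments are small, the remainder of the first-order expansion of the C^1 map h is at
    most eps sum_i |dx_i|, whose squares have a bounded sum. The second-order term of Ito's formula
    is thus hidden in the error. *)
Lemma controlled_comp (I : finType) (V : normedModType R) (e : I -> V) (h : V -> R)
  (X : R -> V) (x w b : I -> R -> R) :
  {within `[0, T], continuous X} -> continuous h ->
  (forall u v, X v = X u + \sum_i (x i v - x i u) *: e i) ->
  (forall i y, derivable h y (e i)) -> (forall i, continuous ('D_(e i) h)) ->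
  (forall i, controlled (x i) (w i) (b i)) ->
  controlled (h \o X) (fun s => \sum_i 'D_(e i) h (X s) * w i s)
    (fun s => \sum_i 'D_(e i) h (X s) * b i s).
Proof.
move=> cX ch XE dh cdh cx.
have cD i : {within `[0, T], continuous (fun s => 'D_(e i) h (X s))}.
  exact: (within_continuous_comp2 cX (cdh i)).
split.
- exact: within_continuous_comp2.
- by apply: within_continuous_sum => i; apply: within_continuousM => //; have [] := cx i.
- by apply: within_continuous_sum => i; apply: within_continuousM => //; have [] := cx i.
have v1 : vanishing N (fun n k => \sum_i 'D_(e i) h (X (p n k)) *
    (d (x i) n k - w i (p n k) * d W n k - b i (p n k) * d B n k)).
  by apply: vanishing_sum => i; apply: (vanishing_mul (cD i)); have [] := cx i.
have v2 : vanishing N (fun n k => d (h \o X) n k - \sum_i 'D_(e i) h (X (p n k)) * d (x i) n k).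
  have sx : square_bounded N (fun n k => \sum_i `|d (x i) n k|).
    apply: square_bounded_sum => i.
    apply: (square_bounded_le (M := 1) (controlled_square_bounded (cx i))) => n k kN.
    by rewrite normr_id mul1r.
  apply: (vanishing_small sx) => eps eps0.
  have near_dh i : \forall n \near \oo, forall k, (k < N n)%N -> forall z,
      `|z - X (p n k)| <= \sum_j `|d (x j) n k| * `|e j| ->
      `|'D_(e i) h z - 'D_(e i) h (X (p n k))| <= eps.
    have [r r0 H] := continuous_near_path cX (cdh i) eps0.
    (* Increments below r / L keep every intermediate point within r of the path. *)
    pose L := \sum_j `|e j| + 1.
    have L0 : 0 < L by rewrite ltr_wpDl// sumr_ge0.
    have rL : 0 < r / L by rewrite divr_gt0.
    have : \forall n \near \oo, forall j, forall k, (k < N n)%N -> `|d (x j) n k| < r / L.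
      apply: filter_forall => j; apply: (grid_incr_small pP) => //.
      by have [] := cx j.
    apply: filterS => n Hn k kN z zX; apply/ltW/H; first by apply: pT; exact: ltnW.
    apply: (le_lt_trans zX); apply: (@le_lt_trans _ _ (\sum_j r / L * `|e j|)).
      by apply: ler_sum => j _; rewrite ler_wpM2r// ltW// Hn.
    rewrite -mulr_sumr mulrAC ltr_pdivrMr// ltr_pM2l//.
    by rewrite /L ltrDl.
  have near_all : \forall n \near \oo, forall i, forall k, (k < N n)%N -> forall z : V,
      `|z - X (p n k)| <= \sum_j `|d (x j) n k| * `|e j| ->
      `|'D_(e i) h z - 'D_(e i) h (X (p n k))| <= eps by apply: filter_forall.
  apply: filterS near_all => n Hn k kN.
  rewrite [`|\sum_i _|]ger0_norm ?sumr_ge0//.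
  rewrite [d (h \o X) n k]/grid_incr/= (XE (p n k) (p n k.+1)).
  by apply: taylor_sum => // i z; exact: Hn.
apply: eq_vanishing (vanishingD v2 v1) => n k.
rewrite !mulr_suml (_ : \sum_i 'D_(e i) h (X (p n k)) * (_ - _ - _) =
  \sum_i 'D_(e i) h (X (p n k)) * d (x i) n k -
  \sum_i 'D_(e i) h (X (p n k)) * w i (p n k) * d W n k -
  \sum_i 'D_(e i) h (X (p n k)) * b i (p n k) * d B n k); first by ring.
by rewrite -!sumrB; apply: eq_bigr => i _; ring.
Qed.

End Controlled.

Section ControlledBracket.
Context {R : realType}.
Variables (T t : R) (N : nat -> nat) (p : nat -> nat -> R).
Hypothesis pP : fine_grid T t N p.
Local Notation d := (grid_incr p).
Local Notation mu := (@lebesgue_measure R).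

Definition block_cvg0 (D : nat -> nat -> R) := forall M i : nat,
  \sum_(k < N n | Num.truncn (p n k * M%:R) == i) D n k @[n --> \oo] --> 0.

Definition bracket_time (X : R -> R) :=
  block_cvg0 (fun n k => d X n k ^+ 2 - (p n k.+1 - p n k)).

Let dp_ge0 n k : (k < N n)%N -> 0 <= p n k.+1 - p n k.
Proof. by case: pP => _ _ _ + _ => pS kN; rewrite subr_ge0 pS. Qed.

(** For M = 0 every knot lies in the block 0, since truncn 0 = 0. *)
Lemma block_cvg0_total D : block_cvg0 D -> \sum_(k < N n) D n k @[n --> \oo] --> 0.
Proof.
move=> /(_ 0%N 0%N); rewrite (_ : (fun n => _) = (fun n => \sum_(k < N n) D n k))//.
by apply/funext => n; apply: eq_bigl => k; rewrite mulr0 truncn0.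
Qed.

Lemma bracket_time_square_bounded X : bracket_time X -> square_bounded N (d X).
Proof.
move=> /block_cvg0_total/cvgrPdist_lt/(_ _ ltr01) H; exists (t + 1).
apply: filterS H => n; rewrite sub0r normrN sumrB (grid_sum pP) => H.
have := ler_norm (\sum_(i < N n) d X n i ^+ 2 - t); lra.
Qed.

(** df dW splits as w dt + w (dW^2 - dt) + b dB dW + (df - w dW - b dB) dW: a Riemann sum, two
    weighted sums handled by blocks, and the product of a negligible family with a square-bounded
    one. *)
Lemma controlled_bracket (W B f w b : R -> R) :
  bracket_time W -> bracket_time B -> block_cvg0 (fun n k => d B n k * d W n k) ->
  controlled T N p W B f w b ->
  \sum_(k < N n) d f n k * d W n k @[n --> \oo] --> \int[mu]_(x in `[0, t]) w x.
Proof.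
move=> bW bB bBW [cf cw cb v].
have sW := bracket_time_square_bounded bW; have sB := bracket_time_square_bounded bB.
have t0 n : t = \sum_(k < N n) (p n k.+1 - p n k) by rewrite (grid_sum pP).
have h1 : \sum_(k < N n) w (p n k) * (d W n k ^+ 2 - (p n k.+1 - p n k)) @[n --> \oo] --> 0.
  apply: (weighted_sum_cvg0 (D := fun n k => d W n k ^+ 2 - (p n k.+1 - p n k)) pP cw _ bW).
  have [K sWK] := sW; exists (K + t).
  apply: filterS sWK => n H; rewrite [t](t0 n).
  apply: (le_trans _ (lerD H (lexx _))); rewrite -big_split/=; apply: ler_sum => k _.
  rewrite (le_trans (ler_normB _ _))// ger0_norm ?sqr_ge0// ger0_norm// dp_ge0//.
have h2 : \sum_(k < N n) b (p n k) * (d B n k * d W n k) @[n --> \oo] --> 0.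
  apply: (weighted_sum_cvg0 (D := fun n k => d B n k * d W n k) pP cb _ bBW).
  have [K sWK] := sW; have [L sBL] := sB.
  exists (L + K); near=> n.
  have hK : \sum_(k < N n) d W n k ^+ 2 <= K by near: n.
  have hL : \sum_(k < N n) d B n k ^+ 2 <= L by near: n.
  apply: (le_trans _ (lerD hL hK)); rewrite -big_split/=; apply: ler_sum => k _.
  rewrite normrM -(real_normK (num_real (d W n k))) -(real_normK (num_real (d B n k))).
  have := sqr_ge0 (`|d B n k| - `|d W n k|).
  have := mulr_ge0 (normr_ge0 (d B n k)) (normr_ge0 (d W n k)); nra.
have h3 := vanishing_sum_mul v sW.
have h4 := riemann_sum_cvg pP cw.
rewrite -[X in _ --> X]addr0 -[X in _ --> X + _]addr0 -[X in _ --> X + _ + _]addr0.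
rewrite (_ : (fun n => _) = (fun n => (\sum_(k < N n) w (p n k) * (p n k.+1 - p n k) +
  \sum_(k < N n) w (p n k) * (d W n k ^+ 2 - (p n k.+1 - p n k))) +
  \sum_(k < N n) b (p n k) * (d B n k * d W n k) +
  \sum_(k < N n) (d f n k - w (p n k) * d W n k - b (p n k) * d B n k) * d W n k)); last first.
  by apply/funext => n; rewrite -!big_split/=; apply: eq_bigr => k _; ring.
by apply: cvgD => //; apply: cvgD => //; apply: cvgD.
Unshelve. all: by end_near.
Qed.

Lemma controlledC (W B f w b : R -> R) :
  controlled T N p W B f w b -> controlled T N p B W f b w.
Proof.
case=> cf cw cb v; split=> //.
by apply: eq_vanishing v => n k; ring.
Qed.

Lemma controlled_bracketr (W B f w b : R -> R) :
  bracket_time W -> bracket_time B -> block_cvg0 (fun n k => d B n k * d W n k) ->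
  controlled T N p W B f w b ->
  \sum_(k < N n) d f n k * d B n k @[n --> \oo] --> \int[mu]_(x in `[0, t]) b x.
Proof.
move=> bW bB bBW /controlledC; apply: controlled_bracket => // M i.
by have := bBW M i; under eq_fun do under eq_bigr do rewrite mulrC.
Qed.

End ControlledBracket.

(** * Convergence in probability along partitions *)

Section ConvergenceInProbability.
Context {R : realType} {disp : measure_display} {Omega : measurableType disp}.
Variable P : probability Omega R.

(** The limsup of the events is null, and P (F n) is at most the probability of the union of all
    later events, which decreases to that of the limsup. *)
Lemma null_sup_cvg0 (F : nat -> set Omega) (N0 : set Omega) :
  (forall n, measurable (F n)) -> P.-negligible N0 ->
  (forall w, ~ N0 w -> \forall n \near \oo, ~ F n w) ->
  P (F n) @[n --> \oo] --> 0%E.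
Proof.
move=> mF [N1 [mN1 PN1 N01]] H.
have c := lim_sup_set_cvg P F mF.
have L0 : P (lim_sup_set F) = 0%E.
  apply: (subset_measure0 _ mN1 _ PN1).
    by apply: bigcap_measurable => // k _; apply: bigcup_measurable => j _; exact: mF.
  move=> w Fw; apply: N01; apply: contrapT => /H [m _ Hm].
  by have [j /= mj Fj] := Fw m I; exact: (Hm j mj Fj).
rewrite -L0.
apply: (squeeze_cvge (f := fun=> 0%E) (h := fun n => P (\bigcup_(k >= n) F k))); last first.
- apply: c; apply: (le_lt_trans (probability_le1 P _)); last exact: ltry.
  by apply: bigcup_measurable => j _; exact: mF.
- by rewrite L0; exact: cvg_cst.
- apply: nearW => n; rewrite measure_ge0/=; apply: le_measure; rewrite ?inE//.
    by apply: bigcup_measurable => j _; exact: mF.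
  by move=> w Fw; exists n => /=.
Qed.

Lemma measurable_suplevel_norm (X : Omega -> R) (e : R) : measurable_fun setT X ->
  measurable [set w | (e <= `|X w|)%R].
Proof. by move=> mX; apply: measurable_superlevel; exact: measurableT_comp. Qed.

(** Set to 0 on the null set, C is a pointwise limit of measurable functions; completeness of P
    transfers measurability to C itself. *)
Lemma ae_cvg_measurable (Z : nat -> Omega -> R) (C : Omega -> R) :
  measure_is_complete P -> (forall n, measurable_fun setT (Z n)) ->
  {ae P, forall w, Z n w @[n --> \oo] --> C w} -> measurable_fun setT C.
Proof.
move=> Pc mZ [N0 [mN0 PN0 N0C]].
pose C' w := C w * \1_(~` N0) w.
have mC' : measurable_fun setT C'.
  apply: (measurable_fun_cvg (h := fun n w => Z n w * \1_(~` N0) w)).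
    move=> n; apply: measurable_funM; first exact: mZ.
    by apply: measurable_indic; exact: measurableC.
  move=> w _; rewrite /C'; have [wN|wN] := pselect (N0 w).
    have -> : \1_(~` N0) w = 0 :> R by rewrite indicE memNset.
    by rewrite mulr0; under eq_fun do rewrite mulr0; exact: cvg_cst.
  apply: cvgM; last exact: cvg_cst.
  by apply: contrapT => h; apply: wN; exact: N0C.
suff h : measurable_fun setT (EFin \o C) by exact/measurable_EFinP.
apply: (ae_measurable_fun Pc (f := EFin \o C')); last exact/measurable_EFinP.
exists N0; split => // w /= h; apply: contrapT => wN; apply: h => _.
by rewrite /C' indicE mem_set//= mulr1.
Qed.

End ConvergenceInProbability.

Section MeshInProbability.
Context {R : realType} {disp : measure_display} {Omega : measurableType disp}.
Variables (P : probability Omega R) (T : R).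
Hypothesis Pc : measure_is_complete P.
Variables (I : countType) (Y : I -> seq R -> Omega -> R).
Hypothesis Y0 : forall i, mesh_cvg0 P T (Y i).

Let half_pow_gt0 n : 0 < 2^-1 ^+ n :> R. Proof. by rewrite exprn_gt0. Qed.

(** [dl n] serves at once the finitely many indices of code at most n, with the tolerance 2^-n. A
    code that belongs to no index gets the harmless value 1. *)
Let fast_modulus : exists dl : nat -> R, (forall n, 0 < dl n) /\
  forall n i s, (pickle i <= n)%N -> itv_partition 0 T s -> mesh s < dl n ->
  exists A : set Omega, [/\ measurable A, (P A <= (2^-1 ^+ n)%:E)%E &
    forall w, ~ A w -> `|Y i s w| < 2^-1 ^+ n].
Proof.
have /choice[dd ddP] : forall ni : nat * I, exists d : R, 0 < d /\
    forall s, itv_partition 0 T s -> mesh s < d ->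
      exists A : set Omega, [/\ measurable A, (P A <= (2^-1 ^+ ni.1)%:E)%E &
        forall w, ~ A w -> `|Y ni.2 s w| < 2^-1 ^+ ni.1].
  by move=> [n i]; have [d d0 H] := Y0 i (half_pow_gt0 n); exists d; split.
pose c n k := if unpickle k is Some i then dd (n, i) else 1.
have c0 n k : 0 < c n k.
  by rewrite /c; case: (unpickle k) => // i; have [] := ddP (n, i).
exists (fun n => \big[Num.min/1]_(k < n.+1) c n k); split.
  by move=> n; apply: lt_bigmin.
move=> n i s ni sP ms; have [_ H] := ddP (n, i); apply: H => //.
apply: (lt_le_trans ms); apply: (le_trans (bigmin_le_cond _ (j := inord (pickle i)) _ _)) => //.
by rewrite inordK// /c pickleK.
Qed.

(** Borel-Cantelli for each index separately: its exceptional events have probability at most 2^-n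
    for n >= [pickle i] and are taken empty before. The countable union of the null sets is null. *)
Let fast_ae (dl : nat -> R) (tau : nat -> seq R) :
  (forall n i s, (pickle i <= n)%N -> itv_partition 0 T s -> mesh s < dl n ->
  exists A : set Omega, [/\ measurable A, (P A <= (2^-1 ^+ n)%:E)%E &
    forall w, ~ A w -> `|Y i s w| < 2^-1 ^+ n]) ->
  (forall n, itv_partition 0 T (tau n)) -> (forall n, mesh (tau n) < dl n) ->
  {ae P, forall w, forall i, Y i (tau n) w @[n --> \oo] --> 0}.
Proof.
move=> H tP tm.
suff h : {ae P, forall w, forall k : nat, if unpickle k is Some i then Y i (tau n) w @[n --> \oo] --> 0 else True}.
  by apply: filterS h => w h i; have := h (pickle i); rewrite pickleK.
apply: ae_foralln => k; case E : (unpickle k) => [i|]; last exact: aeW.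
have /choice[A AP] : forall n, exists A : set Omega, [/\ measurable A, (P A <= (2^-1 ^+ n)%:E)%E &
    (pickle i <= n)%N -> forall w, ~ A w -> `|Y i (tau n) w| < 2^-1 ^+ n].
  move=> n; have [ni|ni] := leqP (pickle i) n.
    by have [A [mA PA YA]] := H n i (tau n) ni (tP n) (tm n); exists A; split.
  by exists set0; split => //; rewrite measure0 lee_fin ltW.
have mA n : measurable (A n) by have [] := AP n.
have L0 : P (lim_sup_set A) = 0%E.
  apply: lim_sup_set_cvg0 => //.
  apply: (@le_lt_trans _ _ (\sum_(n <oo) (2^-1 ^+ n : R)%:E)%E).
    by apply: lee_nneseries => n *; [exact: measure_ge0|have [] := AP n].
  have -> : (\sum_(n <oo) (2^-1 ^+ n : R)%:E)%E = (\sum_(n <oo) (geometric 1 2^-1 n : R)%:E)%E.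
    by apply: eq_eseriesr => n _; rewrite /geometric/= mul1r.
  have /cvg_lim : (\sum_(0 <= k < n) (geometric 1 2^-1 k : R)%:E)%E @[n --> \oo] --> ((1 * (1 - 2^-1)^-1 : R)%:E).
    under eq_fun do rewrite sumEFin.
    apply: cvg_EFin; first exact: nearW.
    by apply: cvg_geometric_series; rewrite ger0_norm// invf_lt1// ltr1n.
  by move=> -> //; rewrite ltry.
exists (lim_sup_set A); split => //.
  by apply: bigcap_measurable => // j _; apply: bigcup_measurable => l _; exact: mA.
move=> w /= Yw; apply: contrapT => wA; apply: Yw.
have [m Hm] : exists m, forall n, (m <= n)%N -> ~ A n w.
  apply: contrapT => h; apply: wA => m _; apply: contrapT => h'; apply: h; exists m => n mn An.
  by apply: h'; exists n.
apply/cvgrPdist_lt => e e0.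
have h2 : 2^-1 ^+ n @[n --> \oo] --> (0 : R).
  by apply: cvg_expr; rewrite ger0_norm// invf_lt1// ltr1n.
move/cvgrPdist_lt : h2 => /(_ e e0) h2.
near=> n; rewrite sub0r normrN.
have nm : (m <= n)%N by near: n; exact: nbhs_infty_ge.
have ni : (pickle i <= n)%N by near: n; exact: nbhs_infty_ge.
have [_ _ /(_ ni w (Hm n nm)) Yn] := AP n.
apply: (lt_trans Yn).
have : `|0 - 2^-1 ^+ n| < e :> R by near: n.
by rewrite sub0r normrN ger0_norm.
Unshelve. all: by end_near.
Qed.

Variables (Z : seq R -> Omega -> R) (C : Omega -> R).
Hypothesis mZ : forall s, itv_partition 0 T s -> measurable_fun setT (Z s).
Hypothesis YZ : {ae P, forall w, forall tau : nat -> seq R,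
  (forall n, itv_partition 0 T (tau n)) -> mesh (tau n) @[n --> \oo] --> 0 ->
  (forall i, Y i (tau n) w @[n --> \oo] --> 0) -> Z (tau n) w @[n --> \oo] --> C w}.

(* Along partitions whose meshes decrease fast enough every Y i tends to 0
   almost surely, by Borel-Cantelli, so that pathwise arguments apply; failure of
   the conclusion would be witnessed by such a sequence. *)
Lemma mesh_cvg_in_prob (pi : nat -> seq R) :
  (forall n, itv_partition 0 T (pi n)) -> mesh (pi n) @[n --> \oo] --> 0 ->
  cvg_in_prob0 P (fun n w => `|Z (pi n) w - C w|%:E).
Proof.
move=> piP pi0; have [dl [dl0 dlP]] := fast_modulus.
(* The second bound 1/(n+1) makes the meshes of a fast sequence tend to 0, as [YZ] requires. *)
pose ep n := Num.min (dl n) (n.+1%:R^-1 : R).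
have ep0 n : 0 < ep n by rewrite lt_min dl0 invr_gt0 ltr0n.
have fast (tau : nat -> seq R) : (forall n, itv_partition 0 T (tau n)) ->
    (forall n, mesh (tau n) < ep n) -> {ae P, forall w, Z (tau n) w @[n --> \oo] --> C w}.
  move=> tP tm; have h1 : {ae P, forall w, forall i, Y i (tau n) w @[n --> \oo] --> 0}.
    by apply: (fast_ae dlP tP) => n; rewrite (lt_le_trans (tm n))// ge_min lexx.
  have tm0 : mesh (tau n) @[n --> \oo] --> 0.
    apply: (squeeze_cvgr (f := fun=> 0) (h := fun n => n.+1%:R^-1)); last 2 first.
    - exact: cvg_cst.
    - exact: cvg_harmonic.
    - apply: nearW => n; apply/andP; split; first exact: bigmax_ge_id.
      by rewrite ltW// (lt_le_trans (tm n))// ge_min lexx orbT.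
  by apply: filterS2 YZ h1 => w Hw Yw; exact: Hw.
(* C is an almost sure limit along a fast selection among the given partitions. *)
have mC : measurable_fun setT C.
  have /choice[m mP] : forall n, exists m, mesh (pi m) < ep n.
    move=> n; move/cvgrPdist_lt : pi0 => /(_ _ (ep0 n)) [m _ /(_ m (leqnn m))].
    by rewrite sub0r normrN => h; exists m; rewrite (le_lt_trans (ler_norm _)).
  apply: (ae_cvg_measurable (Z := fun n => Z (pi (m n))) Pc).
    by move=> n; exact: mZ.
  exact: fast.
have mZC s : itv_partition 0 T s -> measurable_fun setT (fun w => Z s w - C w).
  by move=> sP; apply: measurable_funB => //; exact: mZ.
move=> e e0.
exists (fun n => [set w | (e <= `|Z (pi n) w - C w|)%R]); split.
- by move=> n; apply: measurable_suplevel_norm; exact: mZC.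
- by move=> n w /=; rewrite lee_fin.
pose g s := fine (P [set w | (e <= `|Z s w - C w|)%R]).
have gE s : itv_partition 0 T s -> P [set w | (e <= `|Z s w - C w|)%R] = (g s)%:E.
  move=> sP; rewrite /g fineK// fin_num_measure//.
  by apply: measurable_suplevel_norm; exact: mZC.
under eq_fun do rewrite gE//.
apply: cvg_EFin; first exact: nearW.
apply/cvgrPdist_lt => eta eta0.
suff [dd dd0 H] : exists2 dd : R, 0 < dd & forall s, itv_partition 0 T s -> mesh s < dd -> g s < eta.
  move/cvgrPdist_lt : pi0 => /(_ _ dd0); apply: filterS => n; rewrite !sub0r !normrN => h.
  rewrite /= ger0_norm ?fine_ge0//; apply: H => //.
  by rewrite (le_lt_trans (ler_norm _)).
apply: contrapT => h.
have /choice[tau tauP] : forall n, exists s, [/\ itv_partition 0 T s, mesh s < ep n & eta <= g s].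
  move=> n; apply: contrapT => h'; apply: h; exists (ep n) => // s sP sm.
  by rewrite ltNge; apply/negP => gs; apply: h'; exists s.
have tP n : itv_partition 0 T (tau n) by have [] := tauP n.
have [N0 [mN0 PN0 N0H]] := fast tau tP (fun n => let: And3 _ h _ := tauP n in h).
have : P [set w | (e <= `|Z (tau n) w - C w|)%R] @[n --> \oo] --> 0%E.
  apply: (@null_sup_cvg0 _ _ _ P _ N0).
  - by move=> n; apply: measurable_suplevel_norm; exact: mZC.
  - by exists N0; split => // w; exact: id.
  - move=> w wN; have /cvgrPdist_lt/(_ e e0) : Z (tau n) w @[n --> \oo] --> C w.
      by apply: contrapT => hh; apply: wN; exact: N0H.
    by apply: filterS => n /=; rewrite distrC ltNge => /negP.
under eq_fun do rewrite gE//.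
move=> /fine_cvgP[_] /cvgrPdist_lt /(_ _ eta0) [m _ /(_ m (leqnn m))] /=.
rewrite sub0r normrN => /(le_lt_trans (ler_norm _)); rewrite ltNge.
by have [_ _ ->] := tauP m.
Qed.

End MeshInProbability.

(** * Increments of Ito integrals *)

Section PathModulus.
Context {R : realType} {disp : measure_display} {Omega : measurableType disp}.
Variables (P : probability Omega R) (F : R -> set (set Omega)) (T : R).
Hypothesis cF : complete_filtration P T F.
Hypothesis T0 : 0 < T.

Lemma rat_near_itv (u e : R) : 0 <= u <= T -> 0 < e ->
  exists2 q : rat, 0 <= (ratr q : R) <= T & `|u - ratr q| < e.
Proof.
move=> /andP[u0 uT] e0.
have H : Num.max 0 (u - e) < Num.min T (u + e).
  rewrite gt_max !lt_min T0 (ltr_wpDl u0 e0) /=.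
  by apply/andP; split; lra.
have [q] := rat_in_itvoo H; rewrite in_itv/= gt_max lt_min.
move=> /andP[/andP[q0 qe] /andP[qT qe']]; exists q; first by rewrite !ltW.
by rewrite ltr_distl; apply/andP; split; lra.
Qed.

(** That some pair of rational times violates the modulus is a countable union of events, whose
    probability tends to 0 because almost every path is uniformly continuous. Real times follow by
    density, the conditions being strict inequalities. *)
Lemma modulus_in_prob (X : R -> Omega -> R) (e eta : R) : adapted F T X -> ae_continuous P T X ->
  0 < e -> 0 < eta -> exists2 d : R, 0 < d & exists A : set Omega,
    [/\ measurable A, (P A <= eta%:E)%E & forall w, ~ A w -> forall u v,
      0 <= u <= T -> 0 <= v <= T -> `|u - v| < d -> `|X u w - X v w| <= e].
Proof.
move=> aX [N0 [mN0 PN0 N0X]] e0 eta0.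
have cX w : ~ N0 w -> {within `[0, T], continuous (X ^~ w)}.
  by move=> wN; apply: contrapT => h; apply: wN; exact: N0X.
pose G n (q r : rat) := [set w | [/\ 0 <= (ratr q : R) <= T, 0 <= (ratr r : R) <= T,
  `|ratr q - ratr r| < n.+1%:R^-1 :> R & e < `|X (ratr q) w - X (ratr r) w|]].
pose E n := \bigcup_q \bigcup_r G n q r.
have mG n q r : measurable (G n q r).
  have [qT|qT] := boolP (0 <= (ratr q : R) <= T); last first.
    by rewrite (_ : G n q r = set0)//; apply/seteqP; split => w // [] /idPn; rewrite qT.
  have [rT|rT] := boolP (0 <= (ratr r : R) <= T); last first.
    by rewrite (_ : G n q r = set0)//; apply/seteqP; split => w // [] _ /idPn; rewrite rT.
  have [qr|qr] := boolP (`|ratr q - ratr r| < n.+1%:R^-1 :> R); last first.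
    by rewrite (_ : G n q r = set0)//; apply/seteqP; split => w // [] _ _ /idPn; rewrite qr.
  rewrite (_ : G n q r = ~` [set w | (- e <= - `|X (ratr q) w - X (ratr r) w|)%R]).
    apply: measurableC; apply: measurable_superlevel; apply: measurableT_comp => //.
    apply: measurableT_comp => //; apply: measurable_funB; exact: (adapted_measurable cF).
  apply/seteqP; split => w /=; first by case=> _ _ _ h; rewrite lerN2 leNgt h.
  by rewrite lerN2 => /negP; rewrite -ltNge => h; split.
have mE n : measurable (E n).
  by apply: bigcupT_measurable_rat => q; apply: bigcupT_measurable_rat => r; exact: mG.
have PE : P (E n) @[n --> \oo] --> 0%E.
  apply: (@null_sup_cvg0 _ _ _ P E N0) => //; first by exists N0; split => // w; exact: id.
  move=> w /cX cw; have [d d0 H] := within_uniform_continuous cw e0.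
  near=> n; move=> [q _ [r _ [qT rT qr]]]; rewrite ltNge => /negP; apply; apply/ltW/H => //.
  apply: (lt_trans qr); near: n.
  by have := @near_infty_natSinv_lt R (PosNum d0).
move/fine_cvgP: PE => [_ /cvgrPdist_lt/(_ _ eta0)] [n _ /(_ n (leqnn n))] /=.
rewrite sub0r normrN ger0_norm ?fine_ge0// => Pn.
exists n.+1%:R^-1; first by rewrite invr_gt0.
exists (E n `|` N0); split.
- exact: measurableU.
- have h : (P (E n `|` N0) <= P (E n) + P N0)%E by exact: measureU2.
  apply: (le_trans h); rewrite PN0 adde0.
  by rewrite -(@fineK _ (P (E n))) ?lee_fin ?ltW// fin_num_measure.
move=> w /not_orP[wE /cX cw] u v uT vT uv; rewrite leNgt; apply/negP => ew.
(* The violation exceeds e by g and |u - v| is strictly below 1/(n+1); rational approximations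
   closer than the r below spoil neither. *)
pose g := `|X u w - X v w| - e; have g0 : 0 < g / 2 by rewrite divr_gt0// subr_gt0.
have [d d0 H] := within_uniform_continuous cw g0.
pose r := Num.min d ((n.+1%:R^-1 - `|u - v|) / 2).
have r0 : 0 < r by rewrite lt_min d0 divr_gt0// subr_gt0.
have [q qT uq] := rat_near_itv uT r0; have [q' qT' vq] := rat_near_itv vT r0.
apply: wE; exists q => //; exists q' => //; split => //.
  have h1 : `|u - ratr q| < (n.+1%:R^-1 - `|u - v|) / 2 by rewrite (lt_le_trans uq)// ge_min lexx orbT.
  have h2 : `|v - ratr q'| < (n.+1%:R^-1 - `|u - v|) / 2 by rewrite (lt_le_trans vq)// ge_min lexx orbT.
  rewrite (_ : _ - _ = (u - v) - (u - ratr q) + (v - ratr q')); last by ring.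
  rewrite (le_lt_trans (ler_normD _ _))//.
  have := ler_normB (u - v) (u - ratr q); move: h1 h2; set c := n.+1%:R^-1; lra.
have h1 : `|X u w - X (ratr q) w| < g / 2 by apply: H => //; rewrite (lt_le_trans uq)// ge_min lexx.
have h2 : `|X v w - X (ratr q') w| < g / 2 by apply: H => //; rewrite (lt_le_trans vq)// ge_min lexx.
have : `|X u w - X v w| <= `|X u w - X (ratr q) w| + `|X (ratr q) w - X (ratr q') w| + `|X v w - X (ratr q') w|.
  rewrite (_ : X u w - X v w = (X u w - X (ratr q) w) + (X (ratr q) w - X (ratr q') w) - (X v w - X (ratr q') w)); last by ring.
  by rewrite (le_trans (ler_normB _ _))// lerD// ler_normD.
move: h1 h2; rewrite /g; lra.
Unshelve. all: by end_near.
Qed.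

End PathModulus.

Lemma sum_divn_block {V : nmodType} (J K k : nat) (f : nat -> V) : (0 < J)%N -> (k < K)%N ->
  \sum_(m < K * J | (m %/ J)%N == k) f m = \sum_(j < J) f (k * J + j)%N.
Proof.
move=> J0 kK; rewrite big_mkcond/= -(big_mkord xpredT (fun m => if (m %/ J)%N == k then f m else 0)).
rewrite big_nat_mul big_mkord (bigD1 (Ordinal kK))//= [X in _ + X]big1 ?addr0.
  rewrite mulSn addnC -{1}[(k * J)%N]add0n big_addn addnC addnK big_mkord; apply: eq_bigr => j _.
  by rewrite addnC divnMDl// divn_small ?ltn_ord// addn0 eqxx.
move=> i /negP ik; rewrite big_nat_cond big1// => m /andP[/andP[im mi] _].
case: ifPn => // /eqP mk; exfalso; apply: ik; apply/eqP/val_inj => /=.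
rewrite -mk; apply/eqP; rewrite eqn_leq leq_divRL// im -ltnS ltn_divLR// mi//.
Qed.

Section CommonRefinement.
Context {R : realType}.
Variables (T t : R) (t0T : 0 <= t <= T) (s sp : seq R).
Hypotheses (sP : itv_partition 0 T s) (spP : itv_partition 0 T sp) (sp0 : (0 < size sp)%N).
Local Notation J := (size sp).
Local Notation K := (size s).
Local Notation p := (stopped s t).

(* The knots of sp lying in the k-th interval of s stopped at t are the
   clamp k j; listing them block by block gives a common refinement. *)
Definition clamp (k j : nat) : R := Num.max (p k) (Num.min (knot sp j) (p k.+1)).
Definition refinement (m : nat) : R := clamp (m %/ J)%N (m %% J)%N.

Lemma clamp_size k : (k < K)%N -> clamp k J = p k.+1.
Proof.
move=> kK; rewrite /clamp (knot_size spP) min_r ?(stopped_leT s t0T)//.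
by apply/max_r; exact: (stopped_leS t sP).
Qed.

Lemma clamp0 k : clamp k 0 = p k.
Proof.
rewrite /clamp /knot/= min_l ?(stopped_ge0 t0T sP)//.
by apply/max_l; exact: (stopped_ge0 t0T sP).
Qed.

Lemma refinementE k j : (j < J)%N -> refinement (k * J + j) = clamp k j.
Proof.
by move=> jJ; rewrite /refinement divnMDl// modnMDl divn_small// modn_small// addn0.
Qed.

Lemma refinementS k j : (k < K)%N -> (j < J)%N -> refinement (k * J + j).+1 = clamp k j.+1.
Proof.
move=> kK; rewrite -addnS leq_eqVlt => /predU1P[jJ|jJ]; last by rewrite refinementE.
by rewrite jJ -mulSnr -[(k.+1 * J)%N]addn0 refinementE// clamp0 clamp_size.
Qed.

Lemma clamp_leS k j : (j < J)%N -> clamp k j <= clamp k j.+1.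
Proof.
move=> jJ; rewrite /clamp; apply: le_max2 => //; apply: le_min2 => //.
by rewrite ltW// (knot_ltS spP).
Qed.

Lemma clamp_in k j : 0 <= clamp k j <= T.
Proof.
rewrite /clamp le_max (stopped_ge0 t0T sP)//= ge_max (stopped_leT s t0T)//=.
by rewrite ge_min (stopped_leT s t0T) orbT.
Qed.

(** A nondegenerate interval of the refinement lies in an interval of each of the two partitions. A
    degenerate one may lie off the j-th interval of [sp], hence the restriction. *)
Lemma clamp_lt k j : clamp k j < clamp k j.+1 ->
  [/\ p k <= clamp k j, knot sp j <= clamp k j, clamp k j.+1 <= knot sp j.+1 &
      clamp k j.+1 <= p k.+1].
Proof.
rewrite /clamp => h; have h1 : p k < Num.min (knot sp j.+1) (p k.+1).
  have : p k < Num.max (p k) (Num.min (knot sp j.+1) (p k.+1)).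
    by apply: le_lt_trans h; rewrite le_max lexx.
  by rewrite lt_max ltxx.
move: h; rewrite (max_r (ltW h1)) gt_max h1/= => h2.
have h3 : Num.min (knot sp j) (p k.+1) = knot sp j.
  apply/min_l; rewrite leNgt; apply/negP => h3.
  by move: h2; rewrite (min_r (ltW h3)) lt_min ltxx andbF.
split; first by rewrite le_max lexx.
- by rewrite h3 le_max lexx orbT.
- by rewrite ge_min lexx.
- by rewrite ge_min lexx orbT.
Qed.

Lemma sum_refinement_block {V : nmodType} (f : R -> R -> nat -> nat -> V) k : (k < K)%N ->
  \sum_(m < K * J | (m %/ J)%N == k) f (refinement m) (refinement m.+1) (m %/ J)%N (m %% J)%N =
  \sum_(j < J) f (clamp k j) (clamp k j.+1) k j.
Proof.
move=> kK.
rewrite (sum_divn_block (fun m => f (refinement m) (refinement m.+1) (m %/ J)%N (m %% J)%N))//.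
apply: eq_bigr => j _.
by rewrite refinementE// refinementS// divnMDl// modnMDl divn_small// modn_small// addn0.
Qed.

Lemma refinement_in m : 0 <= refinement m <= T. Proof. exact: clamp_in. Qed.

Lemma refinement_split m : (m < K * J)%N ->
  [/\ (m %/ J < K)%N, (m %% J < J)%N & refinement m.+1 = clamp (m %/ J)%N (m %% J).+1].
Proof.
move=> mK; have h1 : (m %/ J < K)%N by rewrite ltn_divLR.
have h2 : (m %% J < J)%N by rewrite ltn_mod.
by split => //; rewrite {1}(divn_eq m J) refinementS.
Qed.

Lemma refinement_leS m : (m < K * J)%N -> refinement m <= refinement m.+1.
Proof. by move=> /refinement_split[_ mJ ->]; exact: clamp_leS. Qed.

(** Both sides are 0 when x <= p_k, and the minima and maxima simplify when x > p_k. This converts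
    the change of a term of [sp_integral] between p_k and p_{k+1} into an increment along clamped
    knots. *)
Lemma clamp_increment (f : R -> R) k x : (k < K)%N ->
  f (Num.min x (p k.+1)) - f (Num.min x (p k)) =
  f (Num.max (p k) (Num.min x (p k.+1))) - f (p k).
Proof.
move=> kK; have pk := stopped_leS t sP kK.
have [xp|px] := leP x (p k).
  have -> : Num.min x (p k.+1) = x by apply/min_l; exact: le_trans pk.
  by rewrite (max_l xp) !subrr.
by have -> // : Num.max (p k) (Num.min x (p k.+1)) = Num.min x (p k.+1)
  by apply/max_r; rewrite le_min pk ltW.
Qed.

End CommonRefinement.

Section ItoIncrements.
Context {R : realType} {disp : measure_display} {Omega : measurableType disp}.
Variables (P : probability Omega R) (F : R -> set (set Omega)) (T : R).
Hypothesis cF : complete_filtration P T F.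
Hypothesis T0 : 0 < T.
Variable W : R -> Omega -> R.
Hypothesis bW : brownian P F T W.
Local Notation mu := (@lebesgue_measure R).

Lemma sp_eval_itv (Phi : simple_process F T) (j : nat) (x : R) (w : Omega) :
  (j < size (sp_part Phi))%N -> knot (sp_part Phi) j < x <= knot (sp_part Phi) j.+1 ->
  sp_eval Phi x w = sp_val Phi j w.
Proof.
move=> jJ /andP[jx xj]; rewrite /sp_eval (bigD1 (Ordinal jJ))//= jx xj mulr1n big1 ?addr0// => i /negP ij.
have mono a b : (a < b)%N -> (b <= size (sp_part Phi))%N -> knot (sp_part Phi) a < knot (sp_part Phi) b.
  elim: b => // b ih; rewrite ltnS leq_eqVlt => /predU1P[->|ab] bs.
    exact: (knot_ltS (sp_partP Phi)).
  by apply: (lt_trans (ih ab (ltnW bs))); exact: (knot_ltS (sp_partP Phi)).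
have [ij'|ji|E] := ltngtP i j.
- suff -> : (x <= knot (sp_part Phi) i.+1) = false by rewrite andbF.
  apply/negbTE; rewrite -ltNge (le_lt_trans _ jx)//.
  by move: ij'; rewrite leq_eqVlt => /predU1P[->//|ij']; rewrite ltW// mono// ltnW.
- suff -> : (knot (sp_part Phi) i < x) = false by [].
  apply/negbTE; rewrite -leNgt (le_trans xj)//.
  by move: ji; rewrite leq_eqVlt => /predU1P[->//|ji]; rewrite ltW// mono// ltnW.
- by exfalso; apply: ij; apply/eqP/val_inj.
Qed.

Lemma measurable_sp_eval (Phi : simple_process F T) (w : Omega) :
  measurable_fun setT (fun x => sp_eval Phi x w).
Proof.
apply: measurable_sum => i.
rewrite (_ : (fun _ => _) = (fun x => sp_val Phi i w *
  \1_(`]knot (sp_part Phi) i, knot (sp_part Phi) i.+1]%classic) x)).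
  by apply: measurable_funM => //; exact: measurable_indic.
apply/funext => x; rewrite indicE mem_setE in_itv/= -[LHS]mulr_natr; congr (_ * _).
Qed.

End ItoIncrements.

Section RefinementEnergy.
Context {R : realType}.
Variables (T t : R) (t0T : 0 <= t <= T) (s sp : seq R).
Hypotheses (sP : itv_partition 0 T s) (spP : itv_partition 0 T sp) (sp0 : (0 < size sp)%N).
Local Notation J := (size sp).
Local Notation K := (size s).
Local Notation p := (stopped s t).
Local Notation rf := (refinement t s sp).
Local Notation mu := (@lebesgue_measure R).
Variables (v : nat -> R) (f g : R -> R) (e : R).
Hypothesis fv : forall j x, (j < J)%N -> knot sp j < x <= knot sp j.+1 -> f x = v j.
Hypothesis mf : measurable_fun `[0, T] f.
Hypothesis mg : measurable_fun `[0, T] g.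
Hypothesis ge : forall u w, 0 <= u <= T -> 0 <= w <= T -> `|u - w| <= mesh s -> `|g u - g w| <= e.

(** On a nondegenerate refined interval f is the constant v_j, and g differs by at most e from its
    value at the left knot of s, so the squared difference is at most 2 (f - g)^2 + 2 e^2. Integrals
    over the refined intervals are added up by induction; degenerate intervals contribute 0. *)
Lemma refinement_energy :
  ((\sum_(m < K * J) ((v (m %% J)%N - g (p (m %/ J)%N)) *+ (rf m < rf m.+1)%R) ^+ 2
       * (rf m.+1 - rf m))%:E <=
   2%:E * \int[mu]_(x in `[0%R, T]) ((f x - g x) ^+ 2)%:E + (2 * e ^+ 2 * T)%:E)%E.
Proof.
pose D x := ((f x - g x) ^+ 2)%:E.
have D0 x : (0 <= D x)%E by rewrite lee_fin sqr_ge0.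
have mD : measurable_fun `[0, T] D.
  by apply/measurable_EFinP; apply: measurable_funX; exact: measurable_funB.
have T0 : 0 <= T by case/andP: t0T => /le_trans; apply.
have subT a b : 0 <= a -> b <= T -> (`]a, b] `<=` `[0, T])%classic.
  move=> a0 bT x /=; rewrite !in_itv/= => /andP[ax xb].
  by rewrite (le_trans a0 (ltW ax)) (le_trans xb).
have mDs a b : 0 <= a -> b <= T -> measurable_fun `]a, b] D.
  by move=> a0 bT; apply: measurable_funS mD => //; exact: subT.
have rT m := refinement_in t0T sp sP m.
have e20 : 0 <= 2 * e ^+ 2 by rewrite mulr_ge0 ?sqr_ge0.
have H n : (n <= K * J)%N ->
  ((\sum_(m < n) ((v (m %% J)%N - g (p (m %/ J)%N)) *+ (rf m < rf m.+1)%R) ^+ 2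
       * (rf m.+1 - rf m))%:E <=
   2%:E * \int[mu]_(x in `]0%R, rf n]) D x + (2 * e ^+ 2 * rf n)%:E)%E.
  elim: n => [|n ih nM].
    rewrite big_ord0 adde_ge0//; first by rewrite mule_ge0// integral_ge0.
    by rewrite lee_fin mulr_ge0//; have /andP[] := rT 0%N.
  have := refinement_leS t0T sP spP sp0 nM; rewrite le_eqVlt => /predU1P[E|lt].
    by rewrite big_ord_recr/= -E subrr mulr0 addr0 ih// ltnW.
  have [kK jJ E] := refinement_split t0T sP spP sp0 nM.
  rewrite big_ord_recr/= EFinD lt mulr1n.
  have /andP[r0 _] := rT n; have /andP[_ r1] := rT n.+1.
  have -> : (\int[mu]_(x in `]0%R, rf n.+1]) D x =
      \int[mu]_(x in `]0%R, rf n]) D x + \int[mu]_(x in `](rf n), (rf n.+1)]) D x)%E.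
    rewrite -ge0_integral_setU//=.
    - congr (integral _ _ _); rewrite -itv_bndbnd_setU// bnd_simp//; exact: ltW.
    - by apply: measurable_funS mD => //; rewrite subUset; split; apply: subT => //;
        rewrite (le_trans _ r1)// ltW.
    - apply/disj_setPLR => x /=; rewrite !in_itv/= => /andP[_ xr]; apply/negP.
      by rewrite negb_and -leNgt xr.
  rewrite ge0_muleDr ?integral_ge0// (_ : 2 * e ^+ 2 * rf n.+1 = 2 * e ^+ 2 * rf n + 2 * e ^+ 2 * (rf n.+1 - rf n)); last by ring.
  rewrite [X in (_ <= _ + X)%E]EFinD addeACA leeD//; first by rewrite ih// ltnW.
  set x := v _ - _; set dl := rf n.+1 - rf n.
  have muE : (mu `](rf n), (rf n.+1)] = dl%:E)%E.
    by rewrite lebesgue_measure_itv/= lte_fin lt -EFinB.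
  have -> : ((x ^+ 2 * dl)%:E = \int[mu]_(y in `](rf n), (rf n.+1)]) (x ^+ 2)%:E)%E.
    by rewrite integral_cst// EFinM; congr (_ * _)%E.
  have -> : ((2 * e ^+ 2 * dl)%:E = \int[mu]_(y in `](rf n), (rf n.+1)]) (2 * e ^+ 2)%:E)%E.
    by rewrite integral_cst// EFinM; congr (_ * _)%E.
  have mDn : measurable_fun `](rf n), (rf n.+1)] D by exact: mDs.
  rewrite -ge0_integralZl// -ge0_integralD//.
  - apply: ge0_le_integral => //.
    + by move=> y _; rewrite lee_fin sqr_ge0.
    + by apply: emeasurable_funD => //; exact: measurable_funeM.
    + move=> y /=; rewrite in_itv/= => /andP[ny yn].
      have yT : 0 <= y <= T by rewrite (le_trans r0 (ltW ny)) (le_trans yn r1).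
      have := lt; rewrite E => /clamp_lt[h1 h2 h3 h4].
      have fy : f y = v (n %% J)%N.
        by apply: fv => //; rewrite (le_lt_trans h2)//= (le_trans _ h3)// -E.
      rewrite /D fy -EFinM -EFinD lee_fin.
      have gy : `|g y - g (p (n %/ J)%N)| <= e.
        apply: ge => //; first exact: (stopped_in t0T sP).
        have py : p (n %/ J)%N <= y by rewrite (le_trans h1)// ltW.
        rewrite ger0_norm ?subr_ge0//; apply: le_trans (stopped_mesh t sP kK).
        by rewrite lerD2r (le_trans _ h4)// -E.
      have e2 : (g y - g (p (n %/ J)%N)) ^+ 2 <= e ^+ 2.
        rewrite -[leLHS]real_normK ?num_real// lerXn2r ?nnegrE//.
        exact: le_trans gy.
      rewrite /x; have := sqr_ge0 ((v (n %% J)%N - g y) - (g y - g (p (n %/ J)%N))).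
      move: e2; set A := v _; set B := g y; set C := g _.
      nra.
  - by move=> y _; rewrite mule_ge0.
  - exact: measurable_funeM.
apply: (le_trans (H _ (leqnn _))); apply: leeD.
  apply: lee_wpmul2l => //; apply: ge0_subset_integral => //.
  by apply: subT => //; have /andP[] := rT (K * J)%N.
by rewrite lee_fin ler_wpM2l//; have /andP[] := rT (K * J)%N.
Qed.

End RefinementEnergy.

Lemma cvge0_small {R : realType} (u : nat -> \bar R) : u n @[n --> \oo] --> 0%E ->
  forall c : R, 0 < c -> \forall n \near \oo, (u n <= c%:E)%E.
Proof.
move=> /fine_cvgP[fu /cvgrPdist_lt H] c c0; near=> n.
have fn : u n \is a fin_num by near: n.
rewrite -(fineK fn) lee_fin.
have : `|0 - (fine \o u) n| < c by near: n; exact: H.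
by rewrite /= sub0r normrN => h; rewrite ltW// (le_lt_trans (ler_norm _)).
Unshelve. all: by end_near.
Qed.

Section ItoIncrementsConvergence.
Context {R : realType} {disp : measure_display} {Omega : measurableType disp}.
Variables (P : probability Omega R) (F : R -> set (set Omega)) (T : R).
Hypothesis cF : complete_filtration P T F.
Hypothesis T0 : 0 < T.
Variable W : R -> Omega -> R.
Hypothesis bW : brownian P F T W.
Local Notation mu := (@lebesgue_measure R).

Section Block.
Variables (t : R) (t0T : 0 <= t <= T) (s : seq R) (sP : itv_partition 0 T s).
Variables (Phi : simple_process F T) (X : R -> Omega -> R).
Local Notation sp := (sp_part Phi).
Local Notation J := (size sp).
Local Notation p := (stopped s t).
Local Notation rf := (refinement t s sp).

(** Simple process minus X frozen at the left knot of s. The cut-off on degenerate intervals makes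
    it measurable at the refined knot: elsewhere the knot of [sp] is known to come no later. *)
Definition block_integrand m w :=
  (sp_val Phi (m %% J)%N w - X (p (m %/ J)%N) w) *+ (rf m < rf m.+1)%R.

Lemma partition_size_gt0 : (0 < J)%N.
Proof.
have := sp_partP Phi; case: (sp_part Phi) => //= /itv_partition_nil E.
by move: T0; rewrite E ltxx.
Qed.

(** Over the k-th block the terms of the simple process add up to the increment of its integral, by
    [clamp_increment], and the increments of W multiplying X (p k) telescope. *)
Lemma block_integral k w : (k < size s)%N ->
  \sum_(m < size s * J | (m %/ J)%N == k) block_integrand m w * incr W (rf m) (rf m.+1) w =
  sp_integral W Phi (p k.+1) w - sp_integral W Phi (p k) w - X (p k) w * incr W (p k) (p k.+1) w.
Proof.
move=> kK.
pose f (a b : R) k j := ((sp_val Phi j w - X (p k) w) *+ (a < b)%R) * (W b w - W a w).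
rewrite (sum_refinement_block t0T sP (sp_partP Phi) partition_size_gt0 f kK).
have fE j : (j < J)%N -> f (clamp t s sp k j) (clamp t s sp k j.+1) k j =
    (sp_val Phi j w - X (p k) w) * (W (clamp t s sp k j.+1) w - W (clamp t s sp k j) w).
  move=> jJ; have := clamp_leS t s (sp_partP Phi) k jJ; rewrite le_eqVlt => /predU1P[E|lt].
    by rewrite /f E !subrr !mulr0.
  by rewrite /f lt mulr1n.
under eq_bigr => j _ do rewrite fE//.
under eq_bigr do rewrite mulrBl.
rewrite sumrB; congr (_ - _).
  rewrite /sp_integral -sumrB; apply: eq_bigr => j _; rewrite -mulrBr; congr (_ * _).
  have h1 := clamp_increment t sP (W ^~ w) (knot sp j) kK.
  have h2 := clamp_increment t sP (W ^~ w) (knot sp j.+1) kK.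
  have := congr2 (fun x y => x - y) h2 h1; rewrite /clamp /incr /= => E.
  transitivity (W (Num.min (knot sp j.+1) (p k.+1)) w - W (Num.min (knot sp j.+1) (p k)) w -
    (W (Num.min (knot sp j) (p k.+1)) w - W (Num.min (knot sp j) (p k)) w)); last by ring.
  by rewrite E; ring.
rewrite -mulr_sumr; congr (_ * _).
rewrite -(big_mkord xpredT (fun j => W (clamp t s sp k j.+1) w - W (clamp t s sp k j) w)).
rewrite (telescope_sumr (fun j => W (clamp t s sp k j) w))//.
by rewrite (clamp_size t0T sP (sp_partP Phi) kK) (clamp0 t0T sp sP).
Qed.

Hypothesis aX : adapted F T X.

Lemma block_integrand_measurable m : (m < size s * J)%N ->
  sigma_measurable (F (rf m)) (block_integrand m).
Proof.
move=> mM; have rT := refinement_in t0T sp sP m; have algF := filtration_algebra cF rT.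
rewrite /block_integrand; have [lt|_] := boolP (rf m < rf m.+1); last first.
  by under eq_fun do rewrite mulr0n; exact: (sigma_measurable_cst algF).
have [kK jJ E] := refinement_split t0T sP (sp_partP Phi) partition_size_gt0 mM.
move: lt; rewrite E => /clamp_lt[h1 h2 _ _].
have /andP[r0 r1] := rT.
apply: (sigma_measurableB algF).
  apply: (sigma_measurable_filtration cF (sp_meas (s := Phi) jJ) _ h2 r1).
  by have /andP[] := knot_bounds t0T (sp_partP Phi) (m %% J)%N.
apply: (adapted_filtration cF aX _ h1 r1).
exact: (stopped_ge0 t0T sP).
Qed.

End Block.

(** The threshold on the mesh depends on the modulus of continuity of X alone. Given the partition
    s, a simple process is then taken so far in the sequence that it is close to X in L^2([0, T])
    and its integral close to I at all knots of s, outside small events; [step_integral_blocks]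
    bounds what remains. Four exceptional events of probability at most e/8 and a null set occur. *)
Lemma ito_integral_increments (X I : R -> Omega -> R) :
  ito_integral P F T W X I -> ae_continuous P T X -> approximates_integral P T W X I.
Proof.
move=> [aX [N0 [mN0 PN0 N0X]] aI cI [Phi [Phi1 Phi2]]] cX t t0T e e0.
have e8 : 0 < e / 8 by rewrite divr_gt0.
(* An energy below e1 against the threshold e/4 gives the probability e1 / (e/4) = e/8. Half of e1
   is left to the oscillation of X, 2 e2^2 T <= e1/2, and half to twice the L^2 error, kept below
   e1/4. *)
pose e1 := e / 4 * (e / 8); have e10 : 0 < e1 by rewrite mulr_gt0// divr_gt0.
pose e2 := Num.sqrt (e1 / (4 * (T + 1))).
have T1 : 0 < T + 1 by rewrite addr_gt0.
have e2E : e2 ^+ 2 = e1 / (4 * (T + 1)).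
  by rewrite sqr_sqrtr// divr_ge0 ?ltW// mulr_gt0.
have e20 : 0 < e2 by rewrite sqrtr_gt0 divr_gt0// mulr_gt0.
have e2T : 2 * e2 ^+ 2 * T <= e1 / 2.
  rewrite e2E (_ : 2 * _ * T = e1 / 2 * (T / (T + 1))); last by field; rewrite gt_eqF.
  by rewrite ler_piMr ?divr_ge0 ?(ltW e10)// ler_pdivrMr// mul1r lerDl.
have [dl dl0 [A3 [mA3 PA3 A3H]]] := modulus_in_prob cF T0 aX cX e20 e8.
exists dl => // s sP ms; set K := size s; set p := stopped s t.
have K0 : 0 < K.+1%:R :> R by rewrite ltr0n.
(* Errors of at most [tt] at all knots contribute 8 tt^2 K <= e/2 in the end. *)
pose tt := Num.sqrt (e / (16 * K.+1%:R)).
have tt0 : 0 < tt by rewrite sqrtr_gt0 divr_gt0// mulr_gt0.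
have ttE : tt ^+ 2 = e / (16 * K.+1%:R).
  by rewrite sqr_sqrtr// divr_ge0 ?(ltW e0)// mulr_ge0.
have [A2 [mA2 A2H PA2]] : exists A : nat -> set Omega, [/\ forall n, measurable (A n),
    forall n, [set w | ((e1 / 4)%:E <= \int[mu]_(x in `[0%R, T])
       ((sp_eval (Phi n) x w - X x w) ^+ 2)%R%:E)%E] `<=` A n & P (A n) @[n --> \oo] --> 0%E].
  by apply: Phi1; rewrite divr_gt0.
have /choice[A4 A4H] : forall k : nat, exists A : nat -> set Omega, [/\ forall n, measurable (A n),
    forall n, [set w | (tt%:E <= `|sp_integral W (Phi n) (p k) w - I (p k) w|%:E)%E] `<=` A n &
    P (A n) @[n --> \oo] --> 0%E].
  by move=> k; apply: Phi2 => //; exact: (stopped_in t0T sP).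
have [n [PA2n PA4n]] : exists n, (P (A2 n) <= (e / 8)%:E)%E /\
    forall k : 'I_K.+1, (P (A4 k n) <= (e / 8 / K.+1%:R)%:E)%E.
  have h1 := cvge0_small PA2 e8.
  have h2 : \forall n \near \oo, forall k : 'I_K.+1, (P (A4 k n) <= (e / 8 / K.+1%:R)%:E)%E.
    apply: filter_forall => k; apply: cvge0_small; last by rewrite divr_gt0.
    by have [] := A4H k.
  by have [m _ Hm] := filterI h1 h2; exists m; apply: Hm => /=.
set J := size (sp_part (Phi n)).
have J0 : (0 < J)%N := partition_size_gt0 (Phi n).
pose rf := refinement t s (sp_part (Phi n)); pose g := block_integrand t s (Phi n) X.
have rT m : (m <= K * J)%N -> 0 <= rf m <= T.
  by move=> _; exact: (refinement_in t0T _ sP).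
have rS m : (m < K * J)%N -> rf m <= rf m.+1.
  by move=> mM; apply: (refinement_leS t0T sP (sp_partP (Phi n)) J0).
have bm m : (m < K * J)%N -> sigma_measurable (F (rf m)) (g m).
  exact: block_integrand_measurable.
have b0 m : (m < K * J)%N -> rf m = rf m.+1 ->
    g m = fun=> 0.
  by move=> _ E; apply/funext => w; rewrite /g /block_integrand -/rf -E ltxx.
have kK m : (m < K * J)%N -> (m %/ J < K)%N by move=> mM; rewrite ltn_divLR.
have e40 : 0 < e / 4 by rewrite divr_gt0.
have [A1 [mA1 PA1 A1H]] := step_integral_blocks cF bW rT rS bm b0 e10 e40 kK.
pose A4n := \big[setU/set0]_(k < K.+1) A4 k n.
have mA4n : measurable A4n.
  by apply: bigsetU_measurable => k _; have [] := A4H k.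
have PA4 : (P A4n <= (e / 8)%:E)%E.
  apply: (le_trans (Boole_inequality P (A := fun k => A4 k n) (n := K.+1) _)).
    by move=> k _; have [] := A4H k.
  apply: (@le_trans _ _ (\sum_(k < K.+1) (e / 8 / K.+1%:R)%:E)%E); first by apply: lee_sum => k _; exact: PA4n.
  rewrite sumEFin lee_fin sumr_const card_ord -[leLHS]mulr_natr divfK// gt_eqF//.
exists (A1 `|` A2 n `|` A3 `|` A4n `|` N0); split.
- by do 4 (apply: measurableU => //).
- have unionP (A A' : set Omega) (x y : R) : measurable A -> measurable A' ->
      (P A <= x%:E)%E -> (P A' <= y%:E)%E -> (P (A `|` A') <= (x + y)%:E)%E.
    by move=> mA mA' PA PA'; rewrite (le_trans (measureU2 P mA mA'))// EFinD leeD.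
  have PA1' : (P A1 <= (e / 8)%:E)%E by rewrite (le_trans PA1)// lee_fin /e1 mulrC mulKf// gt_eqF.
  have PN : (P N0 <= 0%:E)%E by rewrite [X in (X <= _)%E]PN0.
  apply: (@le_trans _ _ (e / 8 + e / 8 + e / 8 + e / 8 + 0)%:E); last by rewrite lee_fin; lra.
  by do 4! [apply: (unionP) => //; do ?[apply: measurableU => //]].
move=> w /not_orP[/not_orP[/not_orP[/not_orP[wA1 wA2] wA3] wA4] wN].
have mXw : measurable_fun `[0, T] (X ^~ w) by apply: contrapT => h; apply: wN; exact: N0X.
have I4 : (\int[mu]_(x in `[0%R, T]) ((sp_eval (Phi n) x w - X x w) ^+ 2)%R%:E <= (e1 / 4)%:E)%E.
  by rewrite leNgt; apply/negP => h; apply: wA2; apply: A2H => /=; exact: ltW.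
have energy : \sum_(m < K * J) g m w ^+ 2 *
    (rf m.+1 - rf m) <= e1.
  rewrite -lee_fin; apply: (le_trans (refinement_energy (e := e2) t0T sP (sp_partP (Phi n)) J0
    (v := fun j => sp_val (Phi n) j w) (f := fun x => sp_eval (Phi n) x w) (g := fun x => X x w) _ _ _ _)).
  - by move=> j x; exact: sp_eval_itv.
  - by apply: measurable_funTS; exact: measurable_sp_eval.
  - exact: mXw.
  - move=> u v uT vT uv; apply: A3H => //; exact: le_lt_trans ms.
  - apply: (@le_trans _ _ (2%:E * (e1 / 4)%:E + (e1 / 2)%:E)%E).
      by apply: leeD; [exact: lee_wpmul2l|rewrite lee_fin].
    by rewrite -EFinM -EFinD lee_fin; lra.
have blocks := A1H w wA1 energy.
have close k : (k <= K)%N -> `|sp_integral W (Phi n) (p k) w - I (p k) w| <= tt.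
  rewrite -ltnS => kK1; rewrite leNgt; apply/negP => h; apply: wA4.
  rewrite /A4n (bigD1 (Ordinal kK1))//=; left.
  by have [_ + _] := A4H k; apply => /=; rewrite lee_fin ltW.
rewrite /integral_error ger0_norm; last by apply: sumr_ge0 => k _; exact: sqr_ge0.
(* dI - X dW is the block integral up to an error of at most 2 tt in absolute value, and (x - y)^2
   <= 2 x^2 + 2 y^2. *)
apply: (@le_lt_trans _ _ (\sum_(k < K) (2 * (\sum_(m < K * J | (m %/ J)%N == k)
    g m w *
    incr W (rf m) (rf m.+1) w) ^+ 2
    + 8 * tt ^+ 2))).
  apply: ler_sum => k _; rewrite block_integral// -/p.
  have c1 := close k (ltnW (ltn_ord k)); have c2 := close k.+1 (ltn_ord k).
  set y := X _ _ * _; rewrite /incr.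
  move: c1 c2; set a := sp_integral _ _ _ _; set a' := sp_integral _ _ _ _.
  set b := I _ _; set b' := I _ _ => c1 c2.
  have c3 : (a' - b' - (a - b)) ^+ 2 <= 4 * tt ^+ 2.
    rewrite -[leLHS]real_normK ?num_real// (_ : 4 * tt ^+ 2 = (tt + tt) ^+ 2); last by ring.
    rewrite lerXn2r ?nnegrE ?addr_ge0 ?(ltW tt0)//.
    by rewrite (le_trans (ler_normB _ _))// lerD.
  by have := sqr_ge0 (a' - a - y + (a' - b' - (a - b))); nra.
rewrite big_split/= -mulr_sumr sumr_const card_ord ttE -[X in _ + X]mulr_natr.
have h : 8 * (e / (16 * K.+1%:R)) * K%:R <= e / 2.
  rewrite (_ : 8 * _ * _ = e / 2 * (K%:R / K.+1%:R)); last by field; rewrite gt_eqF.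
  rewrite ler_piMr ?divr_ge0 ?(ltW e0)//; rewrite ler_pdivrMr// mul1r ler_nat//.
apply: (@lt_le_trans _ _ (2 * (e / 4) + e / 2)); last by lra.
by apply: ltr_leD => //; rewrite ltr_pM2l.
Qed.

End ItoIncrementsConvergence.

(** * Hamiltonian vector fields *)

Section SecondDerivatives.
Context {R : realType} {V : normedModType R}.
Implicit Types (h : V -> R) (u v w x : V).

Lemma is_derive_translate h u w x : derivable h (x + w) u ->
  is_derive x u (fun y => h (y + w)) ('D_u h (x + w)).
Proof.
move=> dh.
have E : (fun r : R => r^-1 *: (h (r *: u + x + w) - h (x + w))) =
    (fun r => r^-1 *: (h (r *: u + (x + w)) - h (x + w))).
  by apply/funext => r; rewrite addrA.
apply: DeriveDef.
  by rewrite /derivable /= E.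
by rewrite /derive /= E.
Qed.

(** The mean value theorem twice: along u for k(y) = h(y + s v) - h(y), then along v for the
    derivative of h in the direction u. *)
Lemma second_difference h u v : (forall x, derivable h x u) ->
  (forall x, derivable ('D_u h) x v) -> forall x (s : R), exists r q : R,
  [/\ `|r| <= `|s|, `|q| <= `|s| &
    h (x + s *: u + s *: v) - h (x + s *: u) - (h (x + s *: v) - h x) =
    'D_v ('D_u h) (x + r *: u + q *: v) * s * s].
Proof.
move=> du dv x s; pose k y := h (y + s *: v) - h y.
have dk y : is_derive y u k ('D_u h (y + s *: v) - 'D_u h y).
  by apply: is_deriveB; [exact: is_derive_translate|exact: derivableP].
have [|r rs] := @line_mean_value _ _ k u _ x s.
  by move=> y; exact: (@ex_derive _ _ _ _ _ _ _ (dk y)).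
rewrite (@derive_val _ _ _ _ _ _ _ (dk _)) => E.
have [q qs E'] := line_mean_value dv (x + r *: u) s.
by exists r, q; split => //; rewrite -E' -E /k.
Qed.

(** F and G share values at pairs of points arbitrarily close to x, so their values at x agree by
    continuity. *)
Lemma continuous_coincidence (F G : V -> R) u v x :
  {for x, continuous F} -> {for x, continuous G} ->
  (forall s : R, s != 0 -> exists r q r' q' : R,
    [/\ `|r| <= `|s|, `|q| <= `|s|, `|r'| <= `|s|, `|q'| <= `|s| &
      F (x + r *: u + q *: v) = G (x + r' *: u + q' *: v)]) ->
  F x = G x.
Proof.
move=> cF cG FG; apply/eqP; rewrite -subr_eq0 -normr_le0; apply/ler_addgt0Pl => e e0.
rewrite addr0; have e2 : 0 < e / 2 by rewrite divr_gt0.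
have := cF => /cvgrPdist_le/(_ _ e2)/nbhs_normP[d1 /= d10 D1].
have := cG => /cvgrPdist_le/(_ _ e2)/nbhs_normP[d2 /= d20 D2].
have [d [d0 dd1 dd2]] : exists d, [/\ 0 < d, d <= d1 & d <= d2].
  by exists (Num.min d1 d2); rewrite lt_min d10 d20 !ge_min !lexx orbT.
have [s s0 sd] : exists2 s, 0 < s & s * (`|u| + `|v|) < d.
  have c0 : 0 < `|u| + `|v| + 1 by rewrite ltr_wpDl// addr_ge0.
  exists (d / (2 * (`|u| + `|v| + 1))); first by rewrite divr_gt0// mulr_gt0.
  rewrite mulrAC ltr_pdivrMr ?mulr_gt0// ltr_pM2l//.
  by have := normr_ge0 u; have := normr_ge0 v; lra.
have near_x (r q : R) : `|r| <= `|s| -> `|q| <= `|s| -> `|x - (x + r *: u + q *: v)| < d.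
  rewrite (gtr0_norm s0) => rs qs; rewrite -addrA opprD addrA subrr sub0r normrN.
  apply: (le_lt_trans (ler_normD _ _)); apply: le_lt_trans sd.
  by rewrite !normrZ mulrDr; apply: lerD; rewrite ler_wpM2r.
have [|r [q [r' [q' [rs qs rs' qs' E]]]]] := FG s; first by rewrite gt_eqF.
have h1 := D1 _ (lt_le_trans (near_x _ _ rs qs) dd1).
have h2 := D2 _ (lt_le_trans (near_x _ _ rs' qs') dd2).
move: h1 h2; rewrite /= E; move: (F x) (G x) (G _) => a b c h1.
rewrite distrC => h2; rewrite -(subrKA c) (splitr e).
by apply: (le_trans (ler_normD _ _)); apply: lerD.
Qed.

(** Both mixed derivatives are read off the same second difference, at intermediate points shrinking
    to x. *)
Lemma schwarz h u v :
  (forall x, derivable h x u) -> (forall x, derivable h x v) ->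
  (forall x, derivable ('D_u h) x v) -> (forall x, derivable ('D_v h) x u) ->
  continuous ('D_v ('D_u h)) -> continuous ('D_u ('D_v h)) ->
  'D_v ('D_u h) = 'D_u ('D_v h).
Proof.
move=> du dv duv dvu cuv cvu; apply/funext => x.
apply: (continuous_coincidence (u := u) (v := v) (cuv x) (cvu x)) => s s0.
have [r [q [rs qs E]]] := second_difference du duv x s.
have [r' [q' [rs' qs' E']]] := second_difference dv dvu x s.
(* The second expansion has u and v exchanged, hence q' before r'. *)
exists r, q, q', r'; split=> [//|//|//|//|]; rewrite (addrAC x (q' *: u)).
apply: (mulIf s0); apply: (mulIf s0); apply: (etrans (esym E)); apply: etrans E'.
rewrite (addrAC x (s *: v)); move: (h _) (h _) (h _) (h _) => h1 h2 h3 h4; ring.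
Qed.

(** Along each basis direction the Hamiltonians H_0, H_1, H_2 are polynomials of degree at most 2,
    so their partial derivatives are linear coefficients. *)
Lemma derive_quadratic h u x (l c : R) :
  (forall r : R, h (x + r *: u) = h x + r * l + r ^+ 2 * c) -> 'D_u h x = l.
Proof.
move=> E; rewrite /derive /=; apply/cvg_lim => //.
apply: (@cvg_trans _ ((fun r : R => l + r * c) @ 0^')).
  apply: near_eq_cvg; near=> r; rewrite /= (addrC _ x) E.
  have r0 : r != 0 by near: r; exact: nbhs_dnbhs_neq.
  by rewrite /GRing.scale/=; field.
suff : l + r * c @[r --> 0^'] --> l + 0 * c by rewrite mul0r addr0.
apply: cvgD; first exact: cvg_cst.
by apply: cvgM; [apply: cvg_within_filter; exact: cvg_id|exact: cvg_cst].
Unshelve. all: by end_near. Qed.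

Section Classes.
Context {I : finType}.
Variable e : I -> V.

Definition C1 h := continuous h /\
  forall i, (forall x, derivable h x (e i)) /\ continuous ('D_(e i) h).

Definition C2 h := C1 h /\ forall i, C1 ('D_(e i) h).

Lemma C2_schwarz h i j : C2 h -> 'D_(e i) ('D_(e j) h) = 'D_(e j) ('D_(e i) h).
Proof.
move=> [[_ H1] H2].
by apply: schwarz; [exact: (H1 j).1|exact: (H1 i).1|exact: ((H2 j).2 i).1
  |exact: ((H2 i).2 j).1|exact: ((H2 j).2 i).2|exact: ((H2 i).2 j).2].
Qed.

End Classes.
End SecondDerivatives.

(** * Calculus on phase space *)

Section PhaseCalculus.
Context {R : realType} {d : nat}.
Local Notation V := (phase R d).
Implicit Types (x u : V) (phi : V -> 'cV[R]_d).

Definition pcoord (y : V) (i : 'I_d + 'I_d) : R :=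
  match i with inl j => y.1 j ord0 | inr j => y.2 j ord0 end.

Lemma phase_expansion (x y : V) :
  y = x + \sum_i (pcoord y i - pcoord x i) *: ebasis i.
Proof.
have colE (z : 'cV[R]_d) : z = \sum_j z j ord0 *: delta_mx j ord0.
  apply/colP => i; rewrite summxE (bigD1 i)//= !mxE !eqxx mulr1 big1 ?addr0// => j ji.
  by rewrite !mxE eq_sym (negbTE ji) mulr0.
suff E z : z = \sum_i pcoord z i *: ebasis i :> V.
  rewrite (eq_bigr _ (fun i _ => scalerBl _ _ _)) sumrB -!E.
  by rewrite addrCA subrr addr0.
case: z => z1 z2; rewrite big_sumType/=.
rewrite {1}(colE z1) {1}(colE z2).
have pair_sum (u v : 'I_d -> 'cV[R]_d) :
    \sum_j ((u j, v j) : V) = (\sum_j u j, \sum_j v j).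
  by elim/big_rec3 : _ => // i a b c _ ->.
rewrite (eq_bigr (fun j => (z1 j ord0 *: delta_mx j ord0, 0) : V)); last first.
  by move=> j _; exact: (congr2 pair (erefl _) (scaler0 _ _)).
rewrite [X in _ = _ + X](eq_bigr (fun j => (0, z2 j ord0 *: delta_mx j ord0) : V)); last first.
  by move=> j _; exact: (congr2 pair (scaler0 _ _) (erefl _)).
rewrite (pair_sum (fun j => z1 j ord0 *: delta_mx j ord0) (fun=> 0)).
rewrite (pair_sum (fun=> 0) (fun j => z2 j ord0 *: delta_mx j ord0)) !big1_eq.
by apply: (congr2 pair); [exact: (esym (addr0 _))|exact: (esym (add0r _))].
Qed.

Lemma Ck_weaken k phi : Ck k.+1 phi -> Ck k phi.
Proof.
elim: k phi => [|k ih] phi [cphi H]; first by split.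
split=> // i; have [dphi Hi] := H i; split=> //; exact: ih.
Qed.

Lemma continuous_coord phi j : continuous phi -> continuous (fun x => phi x j ord0).
Proof.
move=> cphi x; apply: (continuous_comp (g := fun M : 'cV[R]_d => M j ord0)).
  exact: cphi.
exact: coord_continuous.
Qed.

Lemma derive_coord phi v j : (forall x, derivable phi x v) ->
  'D_v (fun x => phi x j ord0) = fun x => 'D_v phi x j ord0.
Proof. by move=> dphi; apply/funext => x; rewrite derive_mx// mxE. Qed.

Lemma C1_coord phi j : Ck 1 phi -> C1 ebasis (fun x => phi x j ord0).
Proof.
move=> [cphi H]; split=> [|i]; first exact: continuous_coord.
have [dphi [cD _]] := H i; split=> [x|]; first exact: ((derivable_mxP _ _ _).1 (dphi x) j ord0).
by rewrite derive_coord//; exact: continuous_coord.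
Qed.

Lemma C2_coord phi j : Ck 2 phi -> C2 ebasis (fun x => phi x j ord0).
Proof.
move=> H2; split; first exact/C1_coord/Ck_weaken.
case: H2 => _ H i; have [dphi H1] := H i.
by rewrite derive_coord//; exact: C1_coord.
Qed.

Lemma jac_mulE phi x u j :
  (jacP phi x *m u.1 + jacQ phi x *m u.2) j ord0 =
  \sum_i 'D_(ebasis i) (fun y => phi y j ord0) x * pcoord u i.
Proof.
rewrite mxE [X in X + _]mxE [X in _ + X]mxE big_sumType/=.
by congr (_ + _); apply: eq_bigr => k _; rewrite mxE.
Qed.

Section HamiltonianField.
Variables (H : V -> R) (f g : V -> 'cV[R]_d).
Hypothesis dH : forall x, differentiable H x.
Hypotheses (fE : f = (fun x => - gradQ H x)) (gE : g = gradP H).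
Hypotheses (f1 : Ck 1 f) (g1 : Ck 1 g).

Let derivePH j : 'D_(ebasis (inl j)) H = fun x => g x j ord0.
Proof. by apply/funext => x; rewrite gE mxE. Qed.

Let deriveQH j : 'D_(ebasis (inr j)) H = - (fun x => f x j ord0).
Proof. by apply/funext => x; rewrite /GRing.opp/= fE !mxE opprK. Qed.

(** The gradient of H is (g, -f), which is C^1, so the differentiable function H is C^2. *)
Lemma hamiltonian_C2 : C2 ebasis H.
Proof.
have C1N h : C1 (ebasis (R := R) (d := d)) h -> C1 ebasis (- h).
  move=> [ch Hh]; split=> [x|i]; first by apply: cvgN; exact: ch.
  have [dh cD] := Hh i; split=> [x|]; first exact: derivableN.
  rewrite (_ : 'D_(ebasis i) (- h) = - 'D_(ebasis i) h); last first.
    by apply/funext => x; rewrite deriveN.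
  by move=> x; apply: cvgN; exact: cD.
have C1D i : C1 ebasis ('D_(ebasis i) H).
  case: i => j; first by rewrite derivePH; exact: C1_coord.
  by rewrite deriveQH; apply: C1N; exact: C1_coord.
split=> //; split=> [x|i]; first exact: differentiable_continuous.
by split; [move=> x; exact: diff_derivable|have [] := C1D i].
Qed.

Let df j x v : (exists i, v = ebasis i) -> derivable (fun y => f y j ord0) x v.
Proof. by move=> [i ->]; have [_ /(_ i)[+ _]] := C1_coord j f1; apply. Qed.

(** Up to sign the Jacobian blocks are the blocks of the Hessian of H, symmetric by [C2_schwarz]. *)
Lemma hamiltonian_jac x :
  [/\ (jacQ f x)^T = jacQ f x, (jacP g x)^T = jacP g x & jacQ g x = - (jacP f x)^T].
Proof.
have S i j := congr1 (fun h => h x) (C2_schwarz i j hamiltonian_C2).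
have d_f i j : 'D_(ebasis i) (fun y => f y j ord0) x = - 'D_(ebasis i) ('D_(ebasis (inr j)) H) x.
  by rewrite deriveQH deriveN ?opprK//; apply: df; exists i.
have d_g i j : 'D_(ebasis i) (fun y => g y j ord0) x = 'D_(ebasis i) ('D_(ebasis (inl j)) H) x.
  by rewrite derivePH.
split; apply/matrixP => i j; rewrite !mxE.
- by rewrite (d_f (inr i)) (d_f (inr j)) S.
- by rewrite (d_g (inl i)) (d_g (inl j)) S.
- by rewrite (d_f (inl i)) (d_g (inr j)) opprK S.
Qed.

End HamiltonianField.

End PhaseCalculus.

(** * Gradients of the quadratic and linear Hamiltonians *)

Section HamiltonianGradients.
Context {R : realType} {d : nat}.
Implicit Types (x u : phase R d) (f g a b : phase R d -> 'cV[R]_d).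

Definition bilinear_mx (A : 'M[R]_d) (y z : 'cV[R]_d) : R :=
  (y^T *m A *m z) ord0 ord0.

Implicit Types (A : 'M[R]_d) (y z : 'cV[R]_d).
Lemma bilinear_mxDZl A y (y' : 'cV[R]_d) z (r : R) :
  bilinear_mx A (y + r *: y') z = bilinear_mx A y z + r * bilinear_mx A y' z.
Proof.
by rewrite /bilinear_mx linearD linearZ/= !mulmxDl -!scalemxAl !mxE.
Qed.

Lemma bilinear_mx_tr A y z : bilinear_mx A y z = bilinear_mx A^T z y.
Proof.
rewrite /bilinear_mx (_ : z^T *m A^T *m y = (y^T *m A *m z)^T); first by rewrite [RHS]mxE.
by rewrite !trmx_mul trmxK mulmxA.
Qed.

Lemma bilinear_mx_delta A z j :
  bilinear_mx A (delta_mx j ord0) z = (A *m z) j ord0.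
Proof. by rewrite /bilinear_mx -mulmxA trmx_delta -rowE mxE. Qed.

Lemma quadratic_mx_delta A y (r : R) j : A^T = A ->
  bilinear_mx A (y + r *: delta_mx j ord0) (y + r *: delta_mx j ord0) =
  bilinear_mx A y y + r * (2 * (A *m y) j ord0) + r ^+ 2 * A j j.
Proof.
move=> tA; rewrite bilinear_mxDZl [X in X + _]bilinear_mx_tr tA.
have E : (A *m (y + r *: delta_mx j ord0)) j ord0 = (A *m y) j ord0 + r * A j j.
  by rewrite mulmxDr -scalemxAr -colE mxE; congr (_ + _); rewrite !mxE.
by rewrite bilinear_mxDZl !bilinear_mx_delta E; ring.
Qed.

Lemma gradQ_quadratic f g x u : (jacQ f x)^T = jacQ f x ->
  - gradQ (quadratic_hamiltonian f g x) u = jacP f x *m u.1 + jacQ f x *m u.2.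
Proof.
move=> fQ; apply/colP => j; rewrite mxE [X in - X]mxE [RHS]mxE -[RHS]opprK; congr (- _).
apply: (derive_quadratic (c := - (2^-1 * (jacQ f x) j j))) => r.
rewrite /quadratic_hamiltonian -!/(bilinear_mx _ _ _).
rewrite (_ : (u + r *: eQ j).1 = u.1); last by rewrite /= scaler0 addr0.
rewrite (_ : (u + r *: eQ j).2 = u.2 + r *: delta_mx j ord0)//.
move: (jacP f x) (jacQ f x) (jacP g x) u.1 u.2 fQ => A B C y z tB.
rewrite bilinear_mxDZl (quadratic_mx_delta _ _ _ tB) bilinear_mx_delta.
move: (bilinear_mx _ _ _) (bilinear_mx _ _ _) (bilinear_mx _ _ _) => p q s.
move: (fun_of_matrix _ _ _) (fun_of_matrix _ _ _) (fun_of_matrix _ _ _) => k l m; by field.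
Qed.

(** The mixed term - U_Q^T f_P U_P has the gradient - f_P^T U_Q in U_P, which is g_Q U_Q. *)
Lemma gradP_quadratic f g x u : (jacP g x)^T = jacP g x -> jacQ g x = - (jacP f x)^T ->
  gradP (quadratic_hamiltonian f g x) u = jacP g x *m u.1 + jacQ g x *m u.2.
Proof.
move=> gP gQ; apply/colP => j; rewrite mxE [RHS]mxE.
apply: (derive_quadratic (c := 2^-1 * (jacP g x) j j)) => r.
rewrite /quadratic_hamiltonian -!/(bilinear_mx _ _ _).
rewrite (_ : (u + r *: eP j).2 = u.2); last by rewrite /= scaler0 addr0.
rewrite (_ : (u + r *: eP j).1 = u.1 + r *: delta_mx j ord0)//.
rewrite gQ mulNmx [X in r * (_ + X)]mxE.
move: (jacP f x) (jacQ f x) (jacP g x) u.1 u.2 gP => A B C y z tC.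
rewrite (quadratic_mx_delta _ _ _ tC).
rewrite (bilinear_mx_tr A z) bilinear_mxDZl -bilinear_mx_tr bilinear_mx_delta.
move: (bilinear_mx _ _ _) (bilinear_mx _ _ _) (bilinear_mx _ _ _) => p q s.
move: (fun_of_matrix _ _ _) (fun_of_matrix _ _ _) (fun_of_matrix _ _ _) => k l m; by field.
Qed.

Lemma linear_mx_delta y z (r : R) j :
  ((y + r *: delta_mx j ord0)^T *m z) ord0 ord0 = (y^T *m z) ord0 ord0 + r * z j ord0.
Proof.
rewrite linearD linearZ/= mulmxDl -scalemxAl trmx_delta -rowE mxE; congr (_ + _).
by rewrite !mxE.
Qed.

Lemma gradQ_linear (theta : R) a b x u :
  - gradQ (linear_hamiltonian theta a b x) u =
  (2 * theta - 1) / Num.sqrt 2 *: (jacP a x *m a x - jacQ a x *m b x).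
Proof.
set y := jacP a x *m a x - _; apply/colP => j; rewrite mxE [X in - X]mxE [RHS]mxE -[RHS]opprK; congr (- _).
apply: (derive_quadratic (c := 0)) => r.
rewrite /linear_hamiltonian -/y; move: y => y.
rewrite (_ : (u + r *: eQ j).1 = u.1); last by rewrite /= scaler0 addr0.
rewrite (_ : (u + r *: eQ j).2 = u.2 + r *: delta_mx j ord0)//.
rewrite linear_mx_delta; move: (fun_of_matrix _ _ _) (fun_of_matrix _ _ _) => p q; ring.
Qed.

Lemma gradP_linear (theta : R) a b x u :
  gradP (linear_hamiltonian theta a b x) u =
  (2 * theta - 1) / Num.sqrt 2 *: (jacP b x *m a x - jacQ b x *m b x).
Proof.
set y := jacP b x *m a x - _; apply/colP => j; rewrite mxE [RHS]mxE.
apply: (derive_quadratic (c := 0)) => r.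
rewrite /linear_hamiltonian -/y; move: y => y.
rewrite (_ : (u + r *: eP j).2 = u.2); last by rewrite /= scaler0 addr0.
rewrite (_ : (u + r *: eP j).1 = u.1 + r *: delta_mx j ord0)//.
rewrite linear_mx_delta; move: (fun_of_matrix _ _ _) (fun_of_matrix _ _ _) => p q; ring.
Qed.

End HamiltonianGradients.

(** To be read with c the gradient of a component of f or g, A the Hessian and k the gradient of a
    component of s = (a, b), and q l m = D_l s_m. Symmetry of A treats the first correction term, an
    exchange of sums the second. *)
Lemma drift_rearrangement {R : realFieldType} (I : finType) (A : I -> I -> R) (c s k u : I -> R)
    (q : I -> I -> R) : (forall l m, A l m = A m l) ->
  \sum_l (c l + 2^-1 * \sum_m (A l m * s m + k m * q l m)) * u l =
  \sum_l c l * u l +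
  2^-1 * \sum_l ((\sum_m A m l * s m) * u l + k l * \sum_m q m l * u m).
Proof.
move=> AC; under eq_bigr do rewrite mulrDl -mulrA.
rewrite big_split/= -mulr_sumr; congr (_ + _ * _).
rewrite (eq_bigr (fun l => (\sum_m A l m * s m) * u l + (\sum_m k m * q l m) * u l)); last first.
  by move=> l _; rewrite -mulrDl -big_split.
rewrite !big_split/=; congr (_ + _).
  by apply: eq_bigr => l _; congr (_ * _); apply: eq_bigr => m _; rewrite AC.
under eq_bigr do rewrite mulr_suml.
rewrite exchange_big/=; apply: eq_bigr => m _; rewrite mulr_sumr.
by apply: eq_bigr => l _; rewrite mulrA.
Qed.

(** * The Ito correction of the linearized drift *)

Section ItoCorrection.
Context {R : realType} {d : nat}.
Local Notation V := (phase R d).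
Local Notation D i h := ('D_(@ebasis R d i) h).
Implicit Types (x u : V) (f phi a b : V -> 'cV[R]_d).

Lemma is_derive_bigsum (I : Type) (r : seq I) (h : I -> V -> R) (dh : I -> R) x v :
  (forall i, is_derive x v (h i) (dh i)) ->
  is_derive x v (fun y => \sum_(i <- r) h i y) (\sum_(i <- r) dh i).
Proof.
move=> H; elim: r => [|i r ih].
  have -> : (fun y => \sum_(i <- [::]) h i y) = cst 0 by apply/funext => y; rewrite big_nil.
  by rewrite big_nil; exact: is_derive_cst.
have -> : (fun y => \sum_(j <- i :: r) h j y) = h i + (fun y => \sum_(j <- r) h j y).
  by apply/funext => y; rewrite big_cons.
by rewrite big_cons; exact: is_deriveD.
Qed.

Definition field_coord a b m : V -> R := fun x => pcoord (a x, b x) m.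

Lemma field_coord_C1 a b m : Ck 1 a -> Ck 1 b -> C1 ebasis (field_coord a b m).
Proof. by move=> ha hb; case: m => j; [exact: (C1_coord j ha)|exact: (C1_coord j hb)]. Qed.

(* The density of the bracket of sum_l D_l h(X) U_l with W, that is, twice the
   Ito correction of the drift. *)
Definition linear_bracket (h : V -> R) a b x u : R :=
  \sum_l ((\sum_m D m (D l h) x * field_coord a b m x) * pcoord u l +
          D l h x * \sum_m D m (field_coord a b l) x * pcoord u m).

(** The correction 1/2 sum_m D_m phi_j (a, b)_m is differentiated by the product rule and contracted
    with u; exchanging second derivatives turns it into half the bracket density. *)
Lemma ito_drift f phi a b j : Ck 1 f -> Ck 2 phi -> Ck 1 a -> Ck 1 b -> forall x u,
  let F y := f y + 2^-1 *: (jacP phi y *m a y) + 2^-1 *: (jacQ phi y *m b y) in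
  (jacP F x *m u.1 + jacQ F x *m u.2) j ord0 =
  (jacP f x *m u.1 + jacQ f x *m u.2) j ord0 +
  2^-1 * linear_bracket (fun y => phi y j ord0) a b x u.
Proof.
move=> f1 phi2 a1 b1 x u F; set h := fun y => phi y j ord0.
have h2 : C2 ebasis h by exact: C2_coord.
have FE : (fun y => F y j ord0) =
    (fun y => f y j ord0) + 2^-1 \*: (fun y => \sum_m (D m h * field_coord a b m) y).
  apply/funext => y; rewrite /F -addrA -scalerDr [LHS]mxE; congr (_ + _).
  by rewrite [LHS]mxE (jac_mulE phi y (a y, b y)).
have dF l : D l (fun y => F y j ord0) x = D l (fun y => f y j ord0) x +
    2^-1 * \sum_m (D l (D m h) x * field_coord a b m x + D m h x * D l (field_coord a b m) x).
  have df : derivable (fun y => f y j ord0) x (ebasis l) by have [_ /(_ l)[+ _]] := C1_coord j f1; apply.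
  have ds m : is_derive x (ebasis l) (D m h * field_coord a b m)
      (D l (D m h) x * field_coord a b m x + D m h x * D l (field_coord a b m) x).
    have dh : derivable (D m h) x (ebasis l) by have [_ /(_ m)[_ /(_ l)[+ _]]] := h2; apply.
    have dm : derivable (field_coord a b m) x (ebasis l).
      by have [_ /(_ l)[+ _]] := field_coord_C1 m a1 b1; apply.
    have := is_deriveM (derivableP dh) (derivableP dm).
    by rewrite addrC /GRing.scale/= (mulrC (field_coord a b m x)).
  have dS := is_derive_bigsum (index_enum _) ds.
  have dG := is_deriveD (derivableP df) (is_deriveZ 2^-1 dS).
  by rewrite FE; exact: (@derive_val _ _ _ _ _ _ _ dG).
rewrite !jac_mulE /linear_bracket (eq_bigr _ (fun l _ => congr1 ( *%R^~ _) (dF l))).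
exact: (drift_rearrangement (fun l => D l (fun y => f y j ord0) x)
  (fun m => field_coord a b m x) (fun m => D m h x) (pcoord u)
  (fun l m => D l (field_coord a b m) x)
  (fun l m => congr1 (fun h => h x) (C2_schwarz l m h2))).
Qed.

End ItoCorrection.

Section C1Closure.
Context {R : realType} {V : normedModType R} {I : finType}.
Variable e : I -> V.
Implicit Types h k : V -> R.

Lemma C1_cst (c : R) : C1 e (fun=> c).
Proof.
split=> [x|i]; first exact: cvg_cst.
split=> [x|]; first exact: derivable_cst.
rewrite (_ : 'D_(e i) _ = fun=> 0); first by move=> x; exact: cvg_cst.
by apply/funext => x; rewrite derive_cst.
Qed.

Lemma C1D h k : C1 e h -> C1 e k -> C1 e (fun x => h x + k x).
Proof.
move=> [ch dh] [ck dk]; split=> [x|i]; first by apply: cvgD; [exact: ch|exact: ck].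
have [dhi chi] := dh i; have [dki cki] := dk i.
split=> [x|]; first exact: derivableD.
rewrite (_ : 'D_(e i) _ = fun x => 'D_(e i) h x + 'D_(e i) k x).
  by move=> x; apply: cvgD; [exact: chi|exact: cki].
by apply/funext => x; exact: deriveD.
Qed.

Lemma C1M h k : C1 e h -> C1 e k -> C1 e (fun x => h x * k x).
Proof.
move=> [ch dh] [ck dk]; split=> [x|i]; first by apply: cvgM; [exact: ch|exact: ck].
have [dhi chi] := dh i; have [dki cki] := dk i.
split=> [x|]; first exact: derivableM.
rewrite (_ : 'D_(e i) _ = fun x => h x * 'D_(e i) k x + k x * 'D_(e i) h x).
  by move=> x; apply: cvgD; apply: cvgM; [exact: ch|exact: cki|exact: ck|exact: chi].
by apply/funext => x; exact: deriveM.
Qed.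

Lemma C1_sum (J : Type) (r : seq J) (h : J -> V -> R) : (forall j, C1 e (h j)) ->
  C1 e (fun x => \sum_(j <- r) h j x).
Proof.
move=> H; elim: r => [|j r ih].
  by under eq_fun do rewrite big_nil; exact: C1_cst.
by under eq_fun do rewrite big_cons; exact: C1D.
Qed.

End C1Closure.

(** * Controlled expansions along the solution and its linearization *)

Section ControlledFlow.
Context {R : realType} {d : nat}.
Variables (T t : R) (N : nat -> nat) (p : nat -> nat -> R).
Hypothesis pP : fine_grid T t N p.
Variables W B : R -> R.
Hypotheses (sW : square_bounded N (grid_incr p W)) (sB : square_bounded N (grid_incr p B)).
Local Notation D i h := ('D_(@ebasis R d i) h).
Local Notation controlled := (controlled T N p W B).

Lemma eq_controlled f w b f' w' b' : f =1 f' -> w =1 w' -> b =1 b' ->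
  controlled f w b -> controlled f' w' b'.
Proof. by move=> /funext -> /funext -> /funext ->. Qed.

Lemma continuous_phase_path (X : R -> phase R d) :
  (forall m, {within `[0, T], continuous (fun s => pcoord (X s) m)}) ->
  {within `[0, T], continuous X}.
Proof.
move=> cX; rewrite (_ : X = fun s => 0 + \sum_m (pcoord (X s) m - pcoord 0 m) *: ebasis m).
  move=> x; apply: cvgD; first exact: cvg_cst.
  apply: (within_continuous_sum (f := fun m s => (pcoord (X s) m - pcoord 0 m) *: ebasis m)) => m.
  move=> y; apply: cvgZr_tmp; apply: cvgB; last exact: cvg_cst.
  exact: cX.
by apply/funext => s; exact: phase_expansion.
Qed.

Variables (a b : phase R d -> 'cV[R]_d) (X : R -> phase R d).
Hypothesis ctrlX : forall m, controlled (fun s => pcoord (X s) m)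
  (fun s => field_coord a b m (X s)) (fun=> 0).

(** Chain rule; X has no dB part, and so neither has h(X). *)
Lemma controlled_flow_comp h : C1 ebasis h ->
  controlled (fun s => h (X s)) (fun s => \sum_m D m h (X s) * field_coord a b m (X s)) (fun=> 0).
Proof.
move=> [ch dh]; have cX : {within `[0, T], continuous X}.
  by apply: continuous_phase_path => m; have [] := ctrlX m.
have := controlled_comp pP sW sB cX ch (fun u v => phase_expansion (X u) (X v))
  (fun i => (dh i).1) (fun i => (dh i).2) ctrlX.
by apply: eq_controlled => // s; rewrite big1// => i _; rewrite mulr0.
Qed.

Variables (U : R -> phase R d) (c : 'I_d + 'I_d -> R -> R).
Hypothesis ctrlU : forall l, controlled (fun s => pcoord (U s) l)
  (fun s => \sum_m D m (field_coord a b l) (X s) * pcoord (U s) m) (c l).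

(** Product rule for each D_l h(X) U_l. The dW coefficients of the two factors combine to
    [linear_bracket]; the only dB part is that of U_l. *)
Lemma controlled_linear_form h : C2 ebasis h ->
  controlled (fun s => \sum_l D l h (X s) * pcoord (U s) l)
    (fun s => linear_bracket h a b (X s) (U s)) (fun s => \sum_l D l h (X s) * c l s).
Proof.
move=> [_ h2]; apply: (controlled_sum (index_enum _)) => l.
have := controlledM pP sW sB (controlled_flow_comp (h2 l)) (ctrlU l).
apply: eq_controlled => // s.
  by rewrite mulrC.
by rewrite mulr0 add0r.
Qed.

End ControlledFlow.

(** On a grid without intervals all sums are empty, so the continuity part of a statement about
    controlled paths can be extracted from it. *)
Lemma trivial_fine_grid {R : realType} (T : R) : 0 <= T ->
  fine_grid T 0 (fun=> 0%N) (fun _ _ => 0).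
Proof.
by move=> T0; split=> // [n k _|e e0]; [rewrite lexx|apply: nearW].
Qed.

Lemma trivial_controlled {R : realType} (T : R) (W B f w b : R -> R) :
  {within `[0, T], continuous f} -> {within `[0, T], continuous w} ->
  {within `[0, T], continuous b} -> controlled T (fun=> 0%N) (fun _ _ => 0) W B f w b.
Proof. by move=> cf cw cb; split=> // e e0; apply: nearW => n; rewrite big_ord0. Qed.

(** * Solutions of stochastic differential equations *)

Section LipschitzPath.
Context {R : realType}.
Variables (T : R) (f : R -> R) (K : R).
Hypothesis fK : forall u v, 0 <= u -> u <= v -> v <= T -> `|f v - f u| <= K * (v - u).

Lemma lipschitz_path_continuous : {within `[0, T], continuous f}.
Proof.
have K0 : 0 < `|K| + 1 by rewrite ltr_wpDl.
apply: uniform_continuous_within => u e uT e0; exists (e / (`|K| + 1)).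
  by rewrite divr_gt0.
have H x y : 0 <= x -> x <= y -> y <= T -> y - x < e / (`|K| + 1) -> `|f y - f x| < e.
  move=> x0 xy yT; rewrite ltr_pdivlMr// mulrC => xye.
  apply: (le_lt_trans (fK x0 xy yT)); apply: le_lt_trans xye.
  by rewrite ler_wpM2r ?subr_ge0// (le_trans (ler_norm K))// lerDl.
move=> v /andP[v0 vT] uv; case/andP: uT => u0 uT.
have [le_uv|/ltW le_vu] := leP u v.
  by rewrite distrC; apply: H => //; rewrite -[ltLHS]ger0_norm ?subr_ge0// distrC.
by apply: H => //; rewrite -[ltLHS]ger0_norm ?subr_ge0.
Qed.

(** f is the difference of the nondecreasing functions f + |K| x and |K| x. *)
Lemma lipschitz_path_bounded_variation : 0 < T -> bounded_variation 0 T f.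
Proof.
move=> T0.
have H1 : {in `[0, T] &, {homo (fun x => f x + `|K| * x) : x y / x <= y}}.
  move=> x y; rewrite !in_itv/= => /andP[x0 xT] /andP[y0 yT] xy.
  have := fK x0 xy yT; have := ler_norm K; rewrite ler_norml => h /andP[h1 _].
  rewrite -subr_ge0 (_ : _ - _ = (f y - f x) + `|K| * (y - x)); last by ring.
  have := ler_wpM2r (_ : 0 <= y - x) h; rewrite subr_ge0 => /(_ xy); lra.
have H2 : {in `[0, T] &, {homo (fun x => `|K| * x) : x y / x <= y}}.
  by move=> x y _ _ xy; rewrite ler_wpM2l.
have := bounded_variationD T0 (nondecreasing_bounded_variation H1)
  (bounded_variationN (nondecreasing_bounded_variation H2)).
by congr bounded_variation; apply/funext => x /=; rewrite addrK.
Qed.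

End LipschitzPath.

Section NullVariation.
Context {R : realType}.
Variable T : R.
Implicit Types f g : R -> R.
Local Notation mu := (@lebesgue_measure R).

Lemma integral_path_lipschitz f : {within `[0, T], continuous f} -> exists K, forall u v,
  0 <= u -> u <= v -> v <= T ->
  `|\int[mu]_(x in `[0, v]) f x - \int[mu]_(x in `[0, u]) f x| <= K * (v - u).
Proof.
move=> cf; have [K K0 fK] := within_continuous_bounded cf; exists K => u v u0 uv vT.
apply: (integral_increment_le cf u0 uv vT) => x /andP[ux xv].
by apply: fK; rewrite (le_trans u0 ux) (le_trans xv vT).
Qed.

(** Continuous paths of zero quadratic variation along all fine grids: the class to which finite
    variation parts belong. *)
Definition null_variation f := {within `[0, T], continuous f} /\
  forall t N p, fine_grid T t N p -> vanishing N (grid_incr p f).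

Lemma null_variation_lipschitz f (K : R) :
  (forall u v, 0 <= u -> u <= v -> v <= T -> `|f v - f u| <= K * (v - u)) -> null_variation f.
Proof.
move=> fK; have cf := lipschitz_path_continuous fK; split=> // t N p pP.
exact: (vanishing_variation pP cf (grid_variation_lipschitz pP fK)).
Qed.

Lemma null_variation_bounded f : {within `[0, T], continuous f} -> bounded_variation 0 T f ->
  null_variation f.
Proof.
move=> cf bf; split=> // t N p pP; have [K fK] := grid_variation_bounded pP bf.
exact: (vanishing_variation pP cf fK).
Qed.

Lemma null_variation_integral f : {within `[0, T], continuous f} ->
  null_variation (fun t => \int[mu]_(x in `[0, t]) f x).
Proof. by move=> /integral_path_lipschitz[K fK]; exact: null_variation_lipschitz fK. Qed.

Lemma null_variationD f g : null_variation f -> null_variation g ->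
  null_variation (fun x => f x + g x).
Proof.
move=> [cf vf] [cg vg]; split=> [|t N p pP]; first exact: within_continuousD.
apply: eq_vanishing (vanishingD (vf _ _ _ pP) (vg _ _ _ pP)) => n k.
by rewrite /grid_incr; ring.
Qed.

Lemma null_variationZ c f : null_variation f -> null_variation (fun x => c * f x).
Proof.
move=> [cf vf]; split=> [|t N p pP].
  by apply: within_continuousM => // x; exact: cvg_cst.
apply: (vanishing_le (M := `|c|) (vf _ _ _ pP)) => n k _.
by rewrite /grid_incr -mulrBr normrM.
Qed.

Lemma eq_null_variation f g : (forall t, 0 <= t <= T -> f t = g t) ->
  null_variation f -> null_variation g.
Proof.
move=> fg [cf vf]; split=> [|t N p pP].
  apply: (subspace_eq_continuous _ cf) => x; rewrite inE/= in_itv/= => xT.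
  exact: fg.
have [_ _ pT _ _] := pP.
apply: (vanishing_le (M := 1) (vf _ _ _ pP)) => n k kN.
by rewrite mul1r /grid_incr !fg// ?pT// ltnW.
Qed.

End NullVariation.

(** * Brackets of functionals of controlled processes *)

Section ControlledProcesses.
Context {R : realType} {disp : measure_display} {Omega : measurableType disp}.
Variables (P : probability Omega R) (F : R -> set (set Omega)) (T : R).
Hypotheses (cF : complete_filtration P T F) (T0 : 0 < T).
Variables W B : R -> Omega -> R.
Hypotheses (bW : brownian P F T W) (bB : brownian P F T B).
Hypothesis iBW : independent_processes P T B W.
Local Notation process := (R -> Omega -> R).
Local Notation mu := (@lebesgue_measure R).

Definition fine_partitions (tau : nat -> seq R) :=
  (forall n, itv_partition 0 T (tau n)) /\ mesh (tau n) @[n --> \oo] --> 0.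

Lemma stopped_fine_grid tau t : fine_partitions tau -> 0 <= t <= T ->
  fine_grid T t (fun n => size (tau n)) (fun n k => stopped (tau n) t k).
Proof.
move=> [tP t0] t0T; split=> [n|n|n k _|n k kN|e e0].
- exact: (stopped0 _ t0T).
- exact: (stopped_size t0T (tP n)).
- exact: (stopped_in t0T (tP n)).
- exact: (stopped_leS t (tP n)).
- move/cvgrPdist_lt : t0 => /(_ e e0); apply: filterS => n.
  rewrite sub0r normrN => ne k kN; apply: (le_lt_trans (stopped_mesh t (tP n) kN)).
  exact: le_lt_trans (ler_norm _) ne.
Qed.

(* Z has the first-order expansion dZ = w dW + b dB almost surely along all
   partitions for which countably many suitable functionals tend to 0. *)
Definition sde_controlled (Z w b : process) : Prop :=
  [/\ ae_continuous P T Z, ae_continuous P T w, ae_continuous P T b &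
  forall t, 0 <= t <= T -> exists Y : nat -> seq R -> Omega -> R,
    (forall i, mesh_cvg0 P T (Y i)) /\
    {ae P, forall o tau, fine_partitions tau -> (forall i, Y i (tau n) o @[n --> \oo] --> 0) ->
      controlled T (fun n => size (tau n)) (fun n k => stopped (tau n) t k)
        (W ^~ o) (B ^~ o) (Z ^~ o) (w ^~ o) (b ^~ o)}].

Let block t M i (s : seq R) k := Num.truncn (stopped s t k * M%:R) == i.

(** [H] is pathwise: on every grid G is controlled as soon as all Z_j are. The Z_j are controlled
    along partitions on which countably many errors vanish, and [mesh_cvg_in_prob] turns the
    resulting pathwise limits into brackets along arbitrary partitions. *)
Lemma controlled_covariation (J : finType) (Z w b : J -> process) (G v vb : process) :
  (forall j, sde_controlled (Z j) (w j) (b j)) -> adapted F T G ->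
  (forall o t N p, fine_grid T t N p ->
    square_bounded N (grid_incr p (W ^~ o)) -> square_bounded N (grid_incr p (B ^~ o)) ->
    (forall j, controlled T N p (W ^~ o) (B ^~ o) (Z j ^~ o) (w j ^~ o) (b j ^~ o)) ->
    controlled T N p (W ^~ o) (B ^~ o) (G ^~ o) (v ^~ o) (vb ^~ o)) ->
  [/\ ae_continuous P T v,
    covariation P T G W (fun t o => \int[mu]_(x in `[0, t]) v x o) &
    covariation P T G B (fun t o => \int[mu]_(x in `[0, t]) vb x o)].
Proof.
move=> cZ aG H.
have cont : {ae P, forall o, {within `[0, T], continuous (v ^~ o)} /\ {within `[0, T], continuous (vb ^~ o)}}.
  have h : {ae P, forall o, forall j, [/\ {within `[0, T], continuous (Z j ^~ o)},
      {within `[0, T], continuous (w j ^~ o)} & {within `[0, T], continuous (b j ^~ o)}]}.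
    apply: filter_forall => j; have [h1 h2 h3 _] := cZ j.
    by apply: filterS3 h1 h2 h3 => o.
  apply: filterS h => o h.
  (* The empty grid meets every condition of [H], which then yields the continuity of v and vb. *)
  have sb (X : R -> R) : square_bounded (fun=> 0%N) (grid_incr (fun _ _ => 0) X).
    by exists 0; apply: nearW => n; rewrite big_ord0.
  have [|//] := H o 0 (fun=> 0%N) (fun _ _ => 0) (trivial_fine_grid (ltW T0)) (sb _) (sb _) _.
  by move=> j; have [h1 h2 h3] := h j; exact: trivial_controlled.
have path (u : process) : ae_continuous P T u ->
    {ae P, forall o, {within `[0, T], continuous (fun t => \int[mu]_(x in `[0, t]) u x o)} /\
      bounded_variation 0 T (fun t => \int[mu]_(x in `[0, t]) u x o)}.
  apply: filterS => o /integral_path_lipschitz[K uK]; split.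
    exact: lipschitz_path_continuous uK.
  exact: lipschitz_path_bounded_variation uK T0.
have cv : ae_continuous P T v by apply: filterS cont => o [].
have cvb : ae_continuous P T vb by apply: filterS cont => o [].
pose p t (s : seq R) k := stopped s t k.
pose S (M : process) t (s : seq R) o :=
  \sum_(k < size s) incr G (p t s k) (p t s k.+1) o * incr M (p t s k) (p t s k.+1) o.
suff main t : 0 <= t <= T -> forall pi : nat -> seq R,
    (forall n, itv_partition 0 T (pi n)) -> mesh (pi n) @[n --> \oo] --> 0 ->
    cvg_in_prob0 P (fun n o => `|S W t (pi n) o - \int[mu]_(x in `[0, t]) v x o|%:E) /\
    cvg_in_prob0 P (fun n o => `|S B t (pi n) o - \int[mu]_(x in `[0, t]) vb x o|%:E).
  split=> //; split=> [|pi piP pi0 t t0T]; try exact: path.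
    exact: (main t t0T pi piP pi0).1.
  exact: (main t t0T pi piP pi0).2.
move=> t0T.
have /choice[YJ YJP] : forall j, exists Y : nat -> seq R -> Omega -> R,
    (forall i, mesh_cvg0 P T (Y i)) /\
    {ae P, forall o tau, fine_partitions tau -> (forall i, Y i (tau n) o @[n --> \oo] --> 0) ->
      controlled T (fun n => size (tau n)) (fun n k => stopped (tau n) t k)
        (W ^~ o) (B ^~ o) (Z j ^~ o) (w j ^~ o) (b j ^~ o)}.
  by move=> j; have [_ _ _] := cZ j; apply.
(* One countable family for all errors: those attached to the Z_j and, for every pair (M, i), the
   block sums of dW^2 - dt, dB^2 - dt and dB dW. *)
pose Y (i : (J * nat) + ((nat * nat) + ((nat * nat) + (nat * nat)))) (s : seq R) (o : Omega) : R :=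
  match i with
  | inl (j, i) => YJ j i s o
  | inr (inl (M, i)) => \sum_(k < size s | block t M i s k)
      (incr W (p t s k) (p t s k.+1) o ^+ 2 - (p t s k.+1 - p t s k))
  | inr (inr (inl (M, i))) => \sum_(k < size s | block t M i s k)
      (incr B (p t s k) (p t s k.+1) o ^+ 2 - (p t s k.+1 - p t s k))
  | inr (inr (inr (M, i))) => \sum_(k < size s | block t M i s k)
      (incr B (p t s k) (p t s k.+1) o * incr W (p t s k) (p t s k.+1) o)
  end.
have Y0 i : mesh_cvg0 P T (Y i).
  case: i => [[j i]|[[M i]|[[M i]|[M i]]]].
  - exact: (YJP j).1.
  - exact: (brownian_quadratic_variation cF t0T (block t M i) bW).
  - exact: (brownian_quadratic_variation cF t0T (block t M i) bB).
  - exact: (independent_brownian_covariation cF t0T (block t M i) bB bW iBW).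
have brackets : {ae P, forall o tau, (forall n, itv_partition 0 T (tau n)) ->
    mesh (tau n) @[n --> \oo] --> 0 -> (forall i, Y i (tau n) o @[n --> \oo] --> 0) ->
    S W t (tau n) o @[n --> \oo] --> \int[mu]_(x in `[0, t]) v x o /\
    S B t (tau n) o @[n --> \oo] --> \int[mu]_(x in `[0, t]) vb x o}.
  have h : {ae P, forall o, forall j tau, fine_partitions tau ->
      (forall i, YJ j i (tau n) o @[n --> \oo] --> 0) ->
      controlled T (fun n => size (tau n)) (fun n k => stopped (tau n) t k)
        (W ^~ o) (B ^~ o) (Z j ^~ o) (w j ^~ o) (b j ^~ o)}.
    by apply: filter_forall => j; exact: (YJP j).2.
  apply: filterS h => o h tau tP t0 Yo; have ft : fine_partitions tau by split.
  have pP := stopped_fine_grid ft t0T.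
  have bWo : bracket_time (fun n => size (tau n)) (fun n k => stopped (tau n) t k) (W ^~ o).
    by move=> M i; exact: (Yo (inr (inl (M, i)))).
  have bBo : bracket_time (fun n => size (tau n)) (fun n k => stopped (tau n) t k) (B ^~ o).
    by move=> M i; exact: (Yo (inr (inr (inl (M, i))))).
  have bBWo : block_cvg0 (fun n => size (tau n)) (fun n k => stopped (tau n) t k)
      (fun n k => grid_incr (fun n k => stopped (tau n) t k) (B ^~ o) n k *
        grid_incr (fun n k => stopped (tau n) t k) (W ^~ o) n k).
    by move=> M i; exact: (Yo (inr (inr (inr (M, i))))).
  have ctrl := H o t _ _ pP (bracket_time_square_bounded pP bWo) (bracket_time_square_bounded pP bBo)
    (fun j => h j tau ft (fun i => Yo (inl (j, i)))).
  split; first exact: (controlled_bracket pP bWo bBo bBWo ctrl).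
  exact: (controlled_bracketr pP bWo bBo bBWo ctrl).
have mS (M : process) : adapted F T M -> forall s, itv_partition 0 T s ->
    measurable_fun setT (S M t s).
  move=> aM s sP; apply: (measurable_sum _ (h := fun (k : 'I_(size s)) o =>
    incr G (p t s k) (p t s k.+1) o * incr M (p t s k) (p t s k.+1) o)) => k.
  by apply: measurable_funM; apply: measurable_funB; apply: (adapted_measurable cF) => //;
    exact: (stopped_in t0T sP).
have Pc : measure_is_complete P by case: cF.
move=> pi piP pi0; split.
  apply: (mesh_cvg_in_prob Pc Y0 (mS _ (brownian_adapted bW)) _ piP pi0).
  by apply: filterS brackets => o h tau tP t0 Yo; exact: (h tau tP t0 Yo).1.
apply: (mesh_cvg_in_prob Pc Y0 (mS _ (brownian_adapted bB)) _ piP pi0).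
by apply: filterS brackets => o h tau tP t0 Yo; exact: (h tau tP t0 Yo).2.
Qed.

End ControlledProcesses.

Section SolutionExpansion.
Context {R : realType} {disp : measure_display} {Omega : measurableType disp}.
Variables (P : probability Omega R) (F : R -> set (set Omega)) (T : R).
Hypotheses (cF : complete_filtration P T F) (T0 : 0 < T).
Variables W B : R -> Omega -> R.
Hypotheses (bW : brownian P F T W) (bB : brownian P F T B).
Local Notation process := (R -> Omega -> R).
Local Notation mu := (@lebesgue_measure R).

Lemma time_integral_null_variation (alpha A : process) : ae_continuous P T alpha ->
  time_integral P T alpha A -> {ae P, forall o, null_variation T (A ^~ o)}.
Proof.
apply: filterS2 => o ca [_ AE]; apply: eq_null_variation (null_variation_integral ca) => t tT.
by rewrite AE.
Qed.

Lemma approximates_integral0 (M : process) : approximates_integral P T M (fun _ _ => 0) (fun _ _ => 0).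
Proof.
move=> t t0T e e0; exists 1 => // s _ _; exists set0; split => //.
  by rewrite measure0 lee_fin ltW.
by move=> o _; rewrite /integral_error big1 ?normr0// => k _; rewrite /incr subrr mul0r subr0 expr0n.
Qed.

(** V is negligible in the square mean, and the errors of the two integrals are the functionals
    asked for in [sde_controlled]. *)
Lemma sde_controlled_decomposition (Z w b V I I' : process) (z0 : R) :
  ae_continuous P T Z -> ae_continuous P T w -> ae_continuous P T b ->
  {ae P, forall o, null_variation T (V ^~ o)} ->
  approximates_integral P T W w I -> approximates_integral P T B b I' ->
  {ae P, forall o t, 0 <= t <= T -> Z t o = z0 + V t o + I t o + I' t o} ->
  sde_controlled P T W B Z w b.
Proof.
move=> cZ cw cb nV HI HI' ZE; split=> // t t0T.
(* Index 0 carries the error of the dW integral; every other index repeats that of the dB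
   integral. *)
exists (fun i => if i is 0%N then integral_error W w I t else integral_error B b I' t).
split; first by case=> [|_]; [exact: HI|exact: HI'].
near=> o.
have cZo : {within `[0, T], continuous (Z ^~ o)} by near: o.
have cwo : {within `[0, T], continuous (w ^~ o)} by near: o.
have cbo : {within `[0, T], continuous (b ^~ o)} by near: o.
have [_ nVo] : null_variation T (V ^~ o) by near: o.
have ZEo : forall t, 0 <= t <= T -> Z t o = z0 + V t o + I t o + I' t o by near: o.
move=> tau ft Yo; split=> //.
have pP := stopped_fine_grid ft t0T; have [_ _ pT _ _] := pP.
have err (M z J : process) : integral_error M z J t (tau n) o @[n --> \oo] --> 0 ->
    vanishing (fun n => size (tau n)) (fun n k =>
      incr J (stopped (tau n) t k) (stopped (tau n) t k.+1) o -
      z (stopped (tau n) t k) o * incr M (stopped (tau n) t k) (stopped (tau n) t k.+1) o).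
  move=> /cvgrPdist_lt H e e0; apply: filterS (H e e0) => n.
  rewrite sub0r normrN; exact: le_lt_trans (ler_norm _).
have v1 := err _ _ _ (Yo 0%N); have v2 := err _ _ _ (Yo 1%N).
apply: (vanishing_le (M := 1) (vanishingD (vanishingD (nVo _ _ _ pP) v1) v2)) => n k kN.
rewrite mul1r /grid_incr !ZEo; [|exact: pT (ltnW kN)|exact: pT kN].
have eq_le (x y : R) : x = y -> `|x| <= `|y| by move=> ->.
apply: eq_le; rewrite /incr; ring.
Unshelve. all: by end_near. Qed.

(** Half the bracket of the Stratonovich integral is put into V together with the drift: by
    definition of [covariation] its paths are continuous and of bounded variation, whatever its
    value. *)
Lemma sde_controlled_stratonovich (d : nat) (z0 : 'cV[R]_d) (Z alpha beta : vprocess d) i :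
  stratonovich_sde P F T z0 Z alpha [:: (W, beta)] ->
  ae_continuous P T (Defs.coord alpha i) -> ae_continuous P T (Defs.coord beta i) ->
  sde_controlled P T W B (Defs.coord Z i) (Defs.coord beta i) (fun _ _ => 0).
Proof.
move=> [adZ [A [S [HA HS HZ]]]] ca cb.
have [aZ cZ] := adZ i.
have /= [I [C [HI HC HE]]] := HS ord0 i.
apply: (sde_controlled_decomposition (V := fun t o => Defs.coord A i t o + 2^-1 * C t o)
  (I := I) (I' := fun _ _ => 0) (z0 := z0 i ord0)) => //.
- by apply: aeW => o x; exact: cvg_cst.
- have nA := time_integral_null_variation ca (HA i).
  apply: filterS2 nA HC.1 => o nAo [cC bC].
  by apply: null_variationD => //; apply: null_variationZ; exact: null_variation_bounded.
- exact: (ito_integral_increments cF T0 bW HI cb).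
- exact: approximates_integral0.
- apply: filterS2 HZ HE => o HZo HEo t tT; rewrite /Defs.coord HZo// big_ord1 !mxE.
  by have := HEo t tT; rewrite /Defs.coord => ->; ring.
Qed.

Lemma sde_controlled_ito (d : nat) (z0 : 'cV[R]_d) (Z alpha beta gamma : vprocess d) i :
  ito_sde P F T z0 Z alpha [:: (W, beta); (B, gamma)] ->
  ae_continuous P T (Defs.coord alpha i) -> ae_continuous P T (Defs.coord beta i) ->
  ae_continuous P T (Defs.coord gamma i) ->
  sde_controlled P T W B (Defs.coord Z i) (Defs.coord beta i) (Defs.coord gamma i).
Proof.
move=> [adZ [A [S [HA HS HZ]]]] ca cb cg.
have [aZ cZ] := adZ i.
have /= HI := HS ord0 i; have /= HI' := HS (lift ord0 ord0) i.
apply: (sde_controlled_decomposition (V := Defs.coord A i) (I := Defs.coord (S ord0) i)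
  (I' := Defs.coord (S (lift ord0 ord0)) i) (z0 := z0 i ord0)) => //.
- exact: time_integral_null_variation ca (HA i).
- exact: (ito_integral_increments cF T0 bW HI cb).
- exact: (ito_integral_increments cF T0 bB HI' cg).
- apply: filterS HZ => o HZo t tT; rewrite /Defs.coord HZo// big_ord_recl big_ord1 !mxE.
  by rewrite addrA.
Qed.

(** 1/2 int rho dt is moved from the drift into the dW integral, where it is [beta, W] / 2; since
    [gamma, B] = 0, the dB integral is the same in both senses. *)
Lemma stratonovich_of_ito (d : nat) (z0 : 'cV[R]_d) (Z alphaI alphaS beta gamma rho : vprocess d) :
  ito_sde P F T z0 Z alphaI [:: (W, beta); (B, gamma)] ->
  (forall i, ae_continuous P T (Defs.coord alphaS i)) ->
  (forall i, ae_continuous P T (Defs.coord rho i)) ->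
  (forall t o, alphaI t o = alphaS t o + 2^-1 *: rho t o) ->
  (forall i, covariation P T (Defs.coord beta i) W
     (fun t o => \int[mu]_(x in `[0, t]) Defs.coord rho i x o)) ->
  (forall i, covariation P T (Defs.coord gamma i) B (fun _ _ => 0)) ->
  stratonovich_sde P F T z0 Z alphaS [:: (W, beta); (B, gamma)].
Proof.
move=> [adZ [A [S [HA HS HZ]]]] ca cr aE HC HC'; split=> //.
pose C t o i := \int[mu]_(x in `[0, t]) Defs.coord rho i x o.
exists (fun t o => \col_i \int[mu]_(x in `[0, t]) Defs.coord alphaS i x o).
exists (fun k t o => if k == ord0 then S k t o + 2^-1 *: (\col_i C t o i) else S k t o).
split.
- move=> i; apply: filterS (ca i) => o cao; split.
    have := integrable_subitv cao (u := BLeft 0) (v := BRight T).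
    by apply; rewrite bnd_simp.
  by move=> t tT; rewrite /Defs.coord mxE.
- move=> k i; have := HS k i; case: k => -[|[|//]] k2 /= HI.
    exists (Defs.coord (S (Ordinal k2)) i), (fun t o => C t o i); split; [exact: HI|exact: (HC i)|].
    by apply: aeW => o t tT; rewrite /Defs.coord !mxE.
  exists (Defs.coord (S (Ordinal k2)) i), (fun _ _ => 0); split; [exact: HI|exact: (HC' i)|].
  by apply: aeW => o t tT; rewrite mulr0 addr0.
have HAe : {ae P, forall o i, forall t, 0 <= t <= T -> A t o i ord0 =
    \int[mu]_(x in `[0, t]) Defs.coord alphaS i x o + 2^-1 * C t o i}.
  apply: filter_forall => i; apply: filterS3 (HA i) (ca i) (cr i) => o [_ AE] cao cro t tT.
  have /andP[t0 tT'] := tT.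
  have int (f : R -> R) : {within `[0, T], continuous f} -> mu.-integrable `[0, t] (EFin \o f).
    by move=> cf; apply: (integrable_subitv cf); rewrite bnd_simp.
  have := AE t tT; rewrite {1}/Defs.coord => ->.
  rewrite (_ : (fun x => _) = (fun x => Defs.coord alphaS i x o + 2^-1 * Defs.coord rho i x o)); last first.
    by apply/funext => x; rewrite /Defs.coord aE !mxE.
  rewrite RintegralD//; last 2 first.
  - exact: int.
  - by apply: int => x; apply: cvgM; [exact: cvg_cst|exact: cro].
  by congr (_ + _); rewrite RintegralZl//; exact: int.
apply: filterS2 HZ HAe => o HZo HAo t tT; rewrite HZo//.
rewrite [in LHS]big_ord_recl [in RHS]big_ord_recl !big_ord1/=.
by apply/colP => i; rewrite !mxE HAo//; ring.
Qed.

End SolutionExpansion.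

(** * The linearized equations along the solution *)

Section LinearizedFlow.
Context {R : realType} {d : nat} {disp : measure_display} {Omega : measurableType disp}.
Variables (Pr : probability Omega R) (F : R -> set (set Omega)) (T : R).
Hypotheses (cF : complete_filtration Pr T F) (T0 : 0 < T).
Variables W B : R -> Omega -> R.
Hypotheses (bW : brownian Pr F T W) (bB : brownian Pr F T B).
Hypothesis iBW : independent_processes Pr T B W.
Local Notation mu := (@lebesgue_measure R).
Local Notation D i h := ('D_(@ebasis R d i) h).
Variables (a b : phase R d -> 'cV[R]_d) (X U : R -> Omega -> phase R d).
Hypotheses (a2 : Ck 2 a) (b2 : Ck 2 b).
Hypothesis cX : forall m, ae_continuous Pr T (fun t o => pcoord (X t o) m).
Hypothesis cU : forall m, ae_continuous Pr T (fun t o => pcoord (U t o) m).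
Implicit Types (h : phase R d -> R) (f phi : phase R d -> 'cV[R]_d).

(** Derivative of phi at X in the direction U; the drifts and the dW coefficients of both
    formulations have this form. *)
Definition linearization phi : vprocess d :=
  fun t o => jacP phi (X t o) *m (U t o).1 + jacQ phi (X t o) *m (U t o).2.

Definition correction phi : vprocess d :=
  fun t o => \col_j linear_bracket (fun x => phi x j ord0) a b (X t o) (U t o).

Lemma linearization_coord phi j : Defs.coord (linearization phi) j =
  fun t o => \sum_l D l (fun x => phi x j ord0) (X t o) * pcoord (U t o) l.
Proof. by apply/funext => t; apply/funext => o; rewrite /Defs.coord /linearization jac_mulE. Qed.

Lemma phase_ae_continuous h : continuous h -> ae_continuous Pr T (fun t o => h (X t o)).
Proof.
move=> ch; have : {ae Pr, forall o, forall m, {within `[0, T], continuous (fun t => pcoord (X t o) m)}}.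
  by apply: filter_forall => m; exact: cX.
apply: filterS => o cXo.
exact: (within_continuous_comp2 (continuous_phase_path cXo) ch).
Qed.

Lemma ae_continuousM (Y Z : R -> Omega -> R) :
  ae_continuous Pr T Y -> ae_continuous Pr T Z -> ae_continuous Pr T (fun t o => Y t o * Z t o).
Proof. by apply: filterS2 => o; exact: within_continuousM. Qed.

Lemma ae_continuousD (Y Z : R -> Omega -> R) :
  ae_continuous Pr T Y -> ae_continuous Pr T Z -> ae_continuous Pr T (fun t o => Y t o + Z t o).
Proof. by apply: filterS2 => o; exact: within_continuousD. Qed.

Lemma ae_continuous_sum (I : finType) (Y : I -> R -> Omega -> R) :
  (forall i, ae_continuous Pr T (Y i)) -> ae_continuous Pr T (fun t o => \sum_i Y i t o).
Proof.
move=> cY; have : {ae Pr, forall o, forall i, {within `[0, T], continuous (Y i ^~ o)}}.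
  by apply: filter_forall => i; exact: cY.
by apply: filterS => o cYo; exact: (within_continuous_sum (f := fun i => Y i ^~ o)).
Qed.

Lemma linear_form_ae_continuous h : C1 ebasis h ->
  ae_continuous Pr T (fun t o => \sum_l D l h (X t o) * pcoord (U t o) l).
Proof.
move=> [_ dh]; apply: ae_continuous_sum => l; apply: ae_continuousM => //.
exact: (phase_ae_continuous (dh l).2).
Qed.

Lemma linear_bracket_ae_continuous h : C2 ebasis h ->
  ae_continuous Pr T (fun t o => linear_bracket h a b (X t o) (U t o)).
Proof.
move=> [h1 h2]; apply: ae_continuous_sum => l; apply: ae_continuousD.
  apply: ae_continuousM => //; apply: ae_continuous_sum => m; apply: ae_continuousM.
    exact: (phase_ae_continuous ((h2 l).2 m).2).
  exact: (phase_ae_continuous (field_coord_C1 m (Ck_weaken a2) (Ck_weaken b2)).1).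
apply: ae_continuousM; first exact: (phase_ae_continuous (h1.2 l).2).
by apply: linear_form_ae_continuous; exact: (field_coord_C1 l (Ck_weaken a2) (Ck_weaken b2)).
Qed.

Lemma correction_ae_continuous phi j : Ck 2 phi -> ae_continuous Pr T (Defs.coord (correction phi) j).
Proof.
move=> phi2; have := linear_bracket_ae_continuous (C2_coord j phi2).
by congr ae_continuous; apply/funext => t; apply/funext => o; rewrite /Defs.coord mxE.
Qed.

Lemma linearization_ae_continuous f j : Ck 1 f -> ae_continuous Pr T (Defs.coord (linearization f) j).
Proof. by move=> f1; rewrite linearization_coord; apply/linear_form_ae_continuous/C1_coord. Qed.

Lemma ito_drift_linearization f phi : Ck 1 f -> Ck 2 phi ->
  let fI x := f x + 2^-1 *: (jacP phi x *m a x) + 2^-1 *: (jacQ phi x *m b x) in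
  forall t o, linearization fI t o = linearization f t o + 2^-1 *: correction phi t o.
Proof.
move=> f1 phi2 fI t o; apply/colP => j; rewrite !mxE.
have := ito_drift j f1 phi2 (Ck_weaken a2) (Ck_weaken b2) (X t o) (U t o).
by rewrite /= !mxE.
Qed.

Lemma ito_drift_ae_continuous f phi j : Ck 1 f -> Ck 2 phi ->
  let fI x := f x + 2^-1 *: (jacP phi x *m a x) + 2^-1 *: (jacQ phi x *m b x) in
  ae_continuous Pr T (Defs.coord (linearization fI) j).
Proof.
move=> f1 phi2 fI.
have c2 : ae_continuous Pr T (fun _ _ => 2^-1) by apply: aeW => o x; exact: cvg_cst.
have := ae_continuousD (linearization_ae_continuous j f1)
  (ae_continuousM c2 (correction_ae_continuous j phi2)).
congr ae_continuous; apply/funext => t; apply/funext => o.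
have E := congr1 (fun M : 'cV[R]_d => M j ord0) (ito_drift_linearization f1 phi2 t o).
by apply: (etrans _ (esym E)); rewrite [RHS]mxE [X in _ = _ + X]mxE.
Qed.

(** For c = (2 theta - 1) / sqrt 2 and phi = a, b these are the dB coefficients of U_P and U_Q. *)
Definition noise (c : R) phi x : 'cV[R]_d := c *: (jacP phi x *m a x - jacQ phi x *m b x).

Lemma noise_C1 c phi j : Ck 2 phi -> C1 ebasis (fun x => noise c phi x j ord0).
Proof.
move=> phi2; have [_ h2] := C2_coord j phi2.
(* The minus sign of the Q part goes into s, so the noise becomes a single sum over phase
   coordinates of products of C^1 functions. *)
pose s (m : 'I_d + 'I_d) : R := if m is inl _ then c else - c.
rewrite (_ : (fun x => _) = fun x => \sum_m (s m * D m (fun x => phi x j ord0) x) * field_coord a b m x).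
  apply: C1_sum => m; apply: C1M; last exact: field_coord_C1 (Ck_weaken a2) (Ck_weaken b2).
  by apply: C1M; [exact: C1_cst|exact: h2].
apply/funext => x; rewrite /noise mxE [X in c * X]mxE [X in c * (_ + X)]mxE.
rewrite big_sumType/= mulrDr mulrN -mulNr [X in c * X]mxE [X in - c * X]mxE !mulr_sumr.
by congr (_ + _); apply: eq_bigr => k _; rewrite mxE mulrA.
Qed.

Hypothesis ctrlX : forall m, sde_controlled Pr T W B (fun t o => pcoord (X t o) m)
  (fun t o => field_coord a b m (X t o)) (fun _ _ => 0).

(** The coefficient is a C^1 function of X alone, which has no dB part, so its bracket with B is the
    integral of 0. *)
Lemma noise_covariation c phi j : Ck 2 phi ->
  adapted F T (Defs.coord (fun t o => noise c phi (X t o)) j) ->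
  covariation Pr T (Defs.coord (fun t o => noise c phi (X t o)) j) B (fun _ _ => 0).
Proof.
move=> phi2 aG; have n1 := noise_C1 c j phi2.
have [_ _] := controlled_covariation cF T0 bW bB iBW ctrlX aG
  (fun o t N p pP sW sB cXo => controlled_flow_comp pP sW sB cXo n1).
by congr covariation; apply/funext => t; apply/funext => o; rewrite /Rintegral integral0.
Qed.

Variable c : 'I_d + 'I_d -> R -> Omega -> R.
Hypothesis ctrlU : forall l, sde_controlled Pr T W B (fun t o => pcoord (U t o) l)
  (fun t o => \sum_m D m (field_coord a b l) (X t o) * pcoord (U t o) m) (c l).

(** The controlled family consists of the coordinates of X and of U. The dB coefficients c of U do
    not show in the bracket with W, as the sums of dB dW tend to 0. *)
Lemma linearization_covariation phi j : Ck 2 phi -> adapted F T (Defs.coord (linearization phi) j) ->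
  covariation Pr T (Defs.coord (linearization phi) j) W
    (fun t o => \int[mu]_(x in `[0, t]) Defs.coord (correction phi) j x o).
Proof.
move=> phi2; rewrite linearization_coord => aG.
pose Z (i : ('I_d + 'I_d) + ('I_d + 'I_d)) : R -> Omega -> R := fun t o =>
  match i with inl m => pcoord (X t o) m | inr l => pcoord (U t o) l end.
pose w (i : ('I_d + 'I_d) + ('I_d + 'I_d)) : R -> Omega -> R := fun t o =>
  match i with inl m => field_coord a b m (X t o)
  | inr l => \sum_m D m (field_coord a b l) (X t o) * pcoord (U t o) m end.
pose v (i : ('I_d + 'I_d) + ('I_d + 'I_d)) : R -> Omega -> R := fun t o =>
  match i with inl m => 0 | inr l => c l t o end.
have ctrl i : sde_controlled Pr T W B (Z i) (w i) (v i).
  by case: i => m; [exact: ctrlX|exact: ctrlU].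
have [_ + _] := controlled_covariation cF T0 bW bB iBW ctrl aG
  (fun o t N p pP sW sB cZo => controlled_linear_form pP sW sB
    (fun m => cZo (inl m)) (fun l => cZo (inr l)) (C2_coord j phi2)).
congr covariation; apply/funext => t; apply/funext => o.
by congr Rintegral; apply/funext => x; rewrite /Defs.coord mxE.
Qed.

End LinearizedFlow.

Theorem theorem3p7 (R : realType) (d : nat)
  (disp : measure_display) (Omega : measurableType disp)
  (Pr : probability Omega R) (T : R) (F : R -> set (set Omega))
  (W B : R -> Omega -> R)
  (theta : R) (H Hbar : phase R d -> R) (f g a b : phase R d -> 'cV[R]_d)
  (P Q UP UQ : R -> Omega -> 'cV[R]_d) (p0 q0 : 'cV[R]_d) :
  0 < T -> complete_filtration Pr T F ->
  brownian Pr F T W -> brownian Pr F T B -> independent_processes Pr T B W ->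
  0 <= theta <= 1 ->
  (forall x, differentiable H x) -> (forall x, differentiable Hbar x) ->
  f = (fun x => - gradQ H x) -> g = gradP H ->
  a = (fun x => - gradQ Hbar x) -> b = gradP Hbar ->
  (let X t w : phase R d := (P t w, Q t w) in
   stratonovich_sde Pr F T p0 P (fun t w => f (X t w))
     [:: (W, fun t w => a (X t w))] /\
   stratonovich_sde Pr F T q0 Q (fun t w => g (X t w))
     [:: (W, fun t w => b (X t w))]) ->
  (lipschitz f /\ lipschitz g /\ lipschitz a /\ lipschitz b /\
   lipschitz (fun x => jacP a x *m a x) /\ lipschitz (fun x => jacQ a x *m b x) /\
   lipschitz (fun x => jacP b x *m a x) /\ lipschitz (fun x => jacQ b x *m b x)) ->
  [/\ Ck 3 f, Ck 3 g, Ck 4 a & Ck 4 b] ->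
  (forall k, (2 <= k <= 3)%N -> Dk_poly_growth k f /\ Dk_poly_growth k g) ->
  (forall k, (2 <= k <= 4)%N -> Dk_poly_growth k a /\ Dk_poly_growth k b) ->
  (let X t w : phase R d := (P t w, Q t w) in
   let fI x := f x + 2^-1 *: (jacP a x *m a x) + 2^-1 *: (jacQ a x *m b x) in
   let gI x := g x + 2^-1 *: (jacP b x *m a x) + 2^-1 *: (jacQ b x *m b x) in
   let c := (2 * theta - 1) / Num.sqrt 2 in
   ito_sde Pr F T 0 UP
     (fun t w => jacP fI (X t w) *m UP t w + jacQ fI (X t w) *m UQ t w)
     [:: (W, fun t w => jacP a (X t w) *m UP t w + jacQ a (X t w) *m UQ t w);
         (B, fun t w => c *: (jacP a (X t w) *m a (X t w)
                              - jacQ a (X t w) *m b (X t w)))] /\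
   ito_sde Pr F T 0 UQ
     (fun t w => jacP gI (X t w) *m UP t w + jacQ gI (X t w) *m UQ t w)
     [:: (W, fun t w => jacP b (X t w) *m UP t w + jacQ b (X t w) *m UQ t w);
         (B, fun t w => c *: (jacP b (X t w) *m a (X t w)
                              - jacQ b (X t w) *m b (X t w)))]) ->
  let X t w : phase R d := (P t w, Q t w) in
  let U t w : phase R d := (UP t w, UQ t w) in
  let H0 := quadratic_hamiltonian f g in
  let H1 := quadratic_hamiltonian a b in
  let H2 := linear_hamiltonian theta a b in
  stratonovich_sde Pr F T 0 UP (fun t w => - gradQ (H0 (X t w)) (U t w))
    [:: (W, fun t w => - gradQ (H1 (X t w)) (U t w));
        (B, fun t w => - gradQ (H2 (X t w)) (U t w))] /\
  stratonovich_sde Pr F T 0 UQ (fun t w => gradP (H0 (X t w)) (U t w))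
    [:: (W, fun t w => gradP (H1 (X t w)) (U t w));
        (B, fun t w => gradP (H2 (X t w)) (U t w))].

Proof.
move=> T0 cF bW bB iBW _ dH dHbar fE gE aE bE [sP sQ] _ [f3 g3 a4 b4] _ _ [iP iQ] X U H0 H1 H2.
have f1 : Ck 1 f by do 2 apply: Ck_weaken.
have g1 : Ck 1 g by do 2 apply: Ck_weaken.
have a2 : Ck 2 a by do 2 apply: Ck_weaken.
have b2 : Ck 2 b by do 2 apply: Ck_weaken.
have JH := hamiltonian_jac dH fE gE f1 g1.
have JHbar := hamiltonian_jac dHbar aE bE (Ck_weaken a2) (Ck_weaken b2).
pose c := (2 * theta - 1) / Num.sqrt 2.
have ext (x y : vprocess d) : (forall t w, x t w = y t w) -> x = y.
  by move=> xy; apply/funext => t; apply/funext => w.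
(* The Hamiltonian structure enters through these identities; what remains is an Ito to Stratonovich
   conversion for smooth coefficient fields. *)
have gradQH0 : (fun t w => - gradQ (H0 (X t w)) (U t w)) = linearization X U f.
  by apply: ext => t w; have [fQ _ _] := JH (X t w); exact: gradQ_quadratic.
have gradPH0 : (fun t w => gradP (H0 (X t w)) (U t w)) = linearization X U g.
  by apply: ext => t w; have [_ gP gQ] := JH (X t w); exact: gradP_quadratic.
have gradQH1 : (fun t w => - gradQ (H1 (X t w)) (U t w)) = linearization X U a.
  by apply: ext => t w; have [aQ _ _] := JHbar (X t w); exact: gradQ_quadratic.
have gradPH1 : (fun t w => gradP (H1 (X t w)) (U t w)) = linearization X U b.
  by apply: ext => t w; have [_ bP bQ] := JHbar (X t w); exact: gradP_quadratic.
have gradQH2 : (fun t w => - gradQ (H2 (X t w)) (U t w)) = fun t w => noise a b c a (X t w).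
  by apply: ext => t w; exact: gradQ_linear.
have gradPH2 : (fun t w => gradP (H2 (X t w)) (U t w)) = fun t w => noise a b c b (X t w).
  by apply: ext => t w; exact: gradP_linear.
have eq_sde (Z alpha alpha' beta beta' gamma gamma' : vprocess d) :
    alpha = alpha' -> beta = beta' -> gamma = gamma' ->
    stratonovich_sde Pr F T 0 Z alpha' [:: (W, beta'); (B, gamma')] ->
    stratonovich_sde Pr F T 0 Z alpha [:: (W, beta); (B, gamma)].
  by move=> -> -> ->.
suff [SP SQ] : stratonovich_sde Pr F T 0 UP (linearization X U f)
      [:: (W, linearization X U a); (B, fun t w => noise a b c a (X t w))] /\
    stratonovich_sde Pr F T 0 UQ (linearization X U g)
      [:: (W, linearization X U b); (B, fun t w => noise a b c b (X t w))].
  by split; [exact: (eq_sde _ _ _ _ _ _ _ gradQH0 gradQH1 gradQH2 SP)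
            |exact: (eq_sde _ _ _ _ _ _ _ gradPH0 gradPH1 gradPH2 SQ)].
clear gradQH0 gradPH0 gradQH1 gradPH1 gradQH2 gradPH2 eq_sde.
have cX m : ae_continuous Pr T (fun t w => pcoord (X t w) m).
  by case: m => i; [exact: (sP.1 i).2|exact: (sQ.1 i).2].
have cU m : ae_continuous Pr T (fun t w => pcoord (U t w) m).
  by case: m => i; [exact: (iP.1 i).2|exact: (iQ.1 i).2].
have cphi phi i : Ck 1 phi -> ae_continuous Pr T (Defs.coord (fun t w => phi (X t w)) i).
  by move=> phi1; exact: (phase_ae_continuous cX (C1_coord i phi1).1).
have ctrlX m : sde_controlled Pr T W B (fun t w => pcoord (X t w) m)
    (fun t w => field_coord a b m (X t w)) (fun _ _ => 0).
  case: m => i.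
    exact: (sde_controlled_stratonovich cF T0 B bW sP (cphi f i f1) (cphi a i (Ck_weaken a2))).
  exact: (sde_controlled_stratonovich cF T0 B bW sQ (cphi g i g1) (cphi b i (Ck_weaken b2))).
pose drift f phi x := f x + 2^-1 *: (jacP phi x *m a x) + 2^-1 *: (jacQ phi x *m b x).
(* The given Ito equations are convertible to their form in [linearization] and [noise]. *)
have {}iP : ito_sde Pr F T 0 UP (linearization X U (drift f a))
  [:: (W, linearization X U a); (B, fun t w => noise a b c a (X t w))] by exact: iP.
have {}iQ : ito_sde Pr F T 0 UQ (linearization X U (drift g b))
  [:: (W, linearization X U b); (B, fun t w => noise a b c b (X t w))] by exact: iQ.
have cnoise phi i : Ck 2 phi -> ae_continuous Pr T (Defs.coord (fun t w => noise a b c phi (X t w)) i).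
  by move=> phi2; exact: (phase_ae_continuous cX (noise_C1 a2 b2 c i phi2).1).
(* The dB coefficients of all coordinates of U, as components of one field on phase space. *)
pose cn l : R -> Omega -> R := fun t w =>
  field_coord (noise a b c a) (noise a b c b) l (X t w).
have ctrlU l : sde_controlled Pr T W B (fun t w => pcoord (U t w) l)
    (fun t w => \sum_m 'D_(ebasis m) (field_coord a b l) (X t w) * pcoord (U t w) m) (cn l).
  case: l => i.
    have := sde_controlled_ito cF T0 bW bB iP (ito_drift_ae_continuous a2 b2 cX cU i f1 a2)
      (linearization_ae_continuous cX cU i (Ck_weaken a2)) (cnoise a i a2).
    by rewrite linearization_coord.
  have := sde_controlled_ito cF T0 bW bB iQ (ito_drift_ae_continuous a2 b2 cX cU i g1 b2)
    (linearization_ae_continuous cX cU i (Ck_weaken b2)) (cnoise b i b2).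
  by rewrite linearization_coord.
(* Both equations are instances, with (f', phi) = (f, a) for U_P and (g, b) for U_Q. *)
have conclude f' phi Z : Ck 1 f' -> Ck 2 phi ->
    ito_sde Pr F T 0 Z (linearization X U (drift f' phi))
      [:: (W, linearization X U phi); (B, fun t w => noise a b c phi (X t w))] ->
    stratonovich_sde Pr F T 0 Z (linearization X U f')
      [:: (W, linearization X U phi); (B, fun t w => noise a b c phi (X t w))].
  (* The adaptedness of both integrands is part of [ito_integral], so it is read off the Ito
     equation. *)
  move=> f1' phi2 iZ; have [_ [_ [S [_ HS _]]]] := iZ.
  apply: (stratonovich_of_ito iZ (rho := correction a b X U phi)) => [i|i|t w|i|i].
  - exact: linearization_ae_continuous.
  - exact: correction_ae_continuous.
  - exact: ito_drift_linearization.
  - have [aG _ _ _ _] := HS ord0 i.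
    exact: (linearization_covariation cF T0 bW bB iBW ctrlX ctrlU phi2 aG).
  - have [aG _ _ _ _] := HS (lift ord0 ord0) i.
    exact: (noise_covariation cF T0 bW bB iBW a2 b2 ctrlX phi2 aG).
by split; apply: conclude.
Qed.
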